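(* Let $n\geq 2$ be an integer and let $p>n$ be real. If $\Omega\subset\mathbb{R}^n$ is nonempty, bounded, open, and $C^1$, and $$\lambda_p(\Omega)<\lambda_p(\mathbb{R}^n_+),$$ where $\mathbb{R}^n_+=\{x\in\mathbb{R}^n:x_n>0\}$, then $\Omega$ has an extremal.
   Context: $\mathcal{D}^{1,p}(\mathbb{R}^n)=\{u\in L^1_{\rm loc}(\mathbb{R}^n): \text{all weak partial derivatives } u_{x_i}\in L^p(\mathbb{R}^n)\}$; since $p>n$, each $u$ is identified with its Hölder continuous representative. For a nonempty open $\Omega\subsetneq\mathbb{R}^n$, $\mathcal{D}^{1,p}_0(\Omega)=\{u\in\mathcal{D}^{1,p}(\mathbb{R}^n): u(x)=0 \text{ for all } x\notin\Omega\}$, with norm $\|Du\|_p$, and $d_\Omega(x)=\inf_{y\in\Omega^c}|x-y|$. For $u\in\mathcal{D}^{1,p}_0(\Omega)\setminus\{0\}$, $\mathcal{R}_p(\Omega,u)=\bigl\|u/d_\Omega^{1-n/p}\bigr\|_\infty^{-p}\,\|Du\|_p^p$ (the supremum norm is taken over $\Omega$), and $\lambda_p(\Omega)=\inf_{u\in\mathcal{D}^{1,p}_0(\Omega)\setminus\{0\}}\mathcal{R}_p(\Omega,u)$. An extremal for $\Omega$ is a $u\in\mathcal{D}^{1,p}_0(\Omega)\setminus\{0\}$ with $\mathcal{R}_p(\Omega,u)=\lambda_p(\Omega)$. $\Omega$ is $C^1$ if its boundary is $C^1$-regular: near each boundary point, after a rigid motion, $\Omega$ coincides with the region above the graph of a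 $C^1$ function of $n-1$ variables. *)

(* Defs.v *)
From HB Require Import structures.
From mathcomp Require Import all_boot all_order all_algebra.
From mathcomp Require Import all_classical all_reals all_analysis.

Set Implicit Arguments.
Unset Strict Implicit.
Unset Printing Implicit Defensive.

Import Order.TTheory GRing.Theory Num.Theory.
Import numFieldNormedType.Exports.

Local Open Scope classical_set_scope.
Local Open Scope ring_scope.

(** * Lebesgue measure on [R^n] *)

Definition rV_display : measure_display.
Proof. exact: measure_tuple_display default_measure_display. Qed.

Section measurable_rV.
Variables (R : realType) (n : nat).

Let coors : 'I_n -> 'rV[R]_n -> R := fun i x => x 0 i.

Let rV_set0 : g_sigma_preimage coors set0.
Proof. exact: sigma_algebra0. Qed.

Let rV_setC A : g_sigma_preimage coors A -> g_sigma_preimage coors (~` A).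
Proof. exact: sigma_algebraC. Qed.

Let rV_bigcup (F : (set 'rV[R]_n)^nat) :
  (forall i, g_sigma_preimage coors (F i)) ->
  g_sigma_preimage coors (\bigcup_i (F i)).
Proof. exact: sigma_algebra_bigcup. Qed.

(* The sigma-algebra generated by the coordinates; as [R] is second countable,
   it is the Borel sigma-algebra of ['rV[R]_n]. *)
HB.instance Definition _ := @isMeasurable.Build rV_display
  'rV[R]_n (g_sigma_preimage coors) rV_set0 rV_setC rV_bigcup.

Lemma measurable_coord (i : 'I_n) :
  measurable_fun [set: 'rV[R]_n] (fun x : 'rV[R]_n => x 0 i).
Proof.
move=> _ Y mY; rewrite setTI; apply: sub_sigma_algebra => /=.
rewrite -bigcup_seq/=; exists i => /=; first by rewrite mem_index_enum.
by exists Y => //; rewrite setTI.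
Qed.

Lemma measurable_fun_rV d (T : measurableType d) (f : T -> 'rV[R]_n) :
  (forall i, measurable_fun [set: T] (fun t => f t 0 i)) ->
  measurable_fun [set: T] f.
Proof.
move=> mf.
suff sub : g_sigma_preimage (fun i => coors i \o f) `<=` measurable.
  move=> _ A mA; apply: sub.
  by rewrite g_sigma_preimage_comp; exists A.
apply: smallest_sub; first exact: sigma_algebra_measurable.
move=> A; rewrite -bigcup_seq => -[i _] [B mB <-].
exact: mf.
Qed.

End measurable_rV.

Section lebesgue_rV.
Variable R : realType.

Definition consrV n (xy : R * 'rV[R]_n) : 'rV[R]_n.+1 :=
  \row_i oapp (xy.2 0) xy.1 (unlift ord0 i).

Lemma measurable_consrV n : measurable_fun setT (@consrV n).
Proof.
apply: measurable_fun_rV => i; rewrite /consrV.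
under eq_fun do rewrite mxE.
case: unliftP => [j _|_] /=; last exact: measurable_fst.
exact: (measurableT_comp (@measurable_coord R n j)).
Qed.

Section cons_measure.
Variables (n : nat) (mu : {sigma_finite_measure set 'rV[R]_n -> \bar R}).
Local Open Scope ereal_scope.

Definition lebesgue_cons : set 'rV[R]_n.+1 -> \bar R :=
  pushforward (lebesgue_measure \x mu) (@consrV n).

Let mcons (A : set 'rV[R]_n.+1) :
  measurable A -> measurable (@consrV n @^-1` A).
Proof.
by move=> mA; rewrite -[X in measurable X]setTI; exact: measurable_consrV.
Qed.

Let lebesgue_cons0 : lebesgue_cons set0 = 0.
Proof. by rewrite /lebesgue_cons /pushforward preimage_set0 measure0. Qed.

Let lebesgue_cons_ge0 A : 0 <= lebesgue_cons A.
Proof. by rewrite /lebesgue_cons /pushforward; exact: measure_ge0. Qed.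

Let lebesgue_cons_sigma_additive : semi_sigma_additive lebesgue_cons.
Proof.
move=> F mF tF mUF; rewrite /lebesgue_cons /pushforward preimage_bigcup.
apply: measure_semi_sigma_additive.
- by move=> k; exact: mcons.
- apply/trivIsetP => /= i j _ _ ij; rewrite -preimage_setI.
  by move/trivIsetP : tF => /(_ _ _ _ _ ij) ->//; rewrite preimage_set0.
- by rewrite -preimage_bigcup; exact: mcons.
Qed.

HB.instance Definition _ := isMeasure.Build _ _ _ lebesgue_cons
  lebesgue_cons0 lebesgue_cons_ge0 lebesgue_cons_sigma_additive.

Let unconsrV (x : 'rV[R]_n.+1) : R * 'rV[R]_n :=
  (x 0%R ord0, \row_j x 0%R (lift ord0 j)).

Let consrVK : cancel (@consrV n) unconsrV.
Proof.
move=> [a y]; rewrite /unconsrV /consrV mxE unlift_none /=; congr pair.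
by apply/rowP => j; rewrite !mxE liftK.
Qed.

Let measurable_unconsrV : measurable_fun setT unconsrV.
Proof.
apply/measurable_fun_pair; first exact: measurable_coord.
apply: measurable_fun_rV => i; under eq_fun do rewrite mxE.
exact: measurable_coord.
Qed.

Let lebesgue_cons_sigma_finite : sigma_finite setT lebesgue_cons.
Proof.
have /sigma_finiteP[F [TF ndF Foo]] := sigma_finiteT (@lebesgue_measure R).
have /sigma_finiteP[G [TG ndG Goo]] := sigma_finiteT mu.
exists (fun k => unconsrV @^-1` (F k `*` G k)).
  rewrite -preimage_bigcup (_ : \bigcup_k _ = setT) ?preimage_setT//.
  apply/seteqP; split=> // -[x y] _.
  have [k _ Fkx] : (\bigcup_k F k) x by rewrite -TF.
  have [l _ Gly] : (\bigcup_l G l) y by rewrite -TG.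
  exists (maxn k l) => //; split => /=.
  - by move: x Fkx; exact/subsetPset/ndF/leq_maxl.
  - by move: y Gly; exact/subsetPset/ndG/leq_maxr.
move=> k; have [? ?] := Foo k; have [? ?] := Goo k; split.
  rewrite -[X in measurable X]setTI; apply: measurable_unconsrV => //.
  exact: measurableX.
rewrite /lebesgue_cons /pushforward -comp_preimage.
rewrite (_ : unconsrV \o _ = id) ?preimage_id.
  by rewrite product_measure1E// lte_mul_pinfty// ge0_fin_numE.
by apply/funext => ?; exact: consrVK.
Qed.

HB.instance Definition _ := Measure_isSigmaFinite.Build _ _ _ lebesgue_cons
  lebesgue_cons_sigma_finite.

End cons_measure.

Fixpoint lebesgue_rV n : {sigma_finite_measure set 'rV[R]_n -> \bar R} :=
  match n with
  | 0%N => \d_(0 : 'rV[R]_0)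
  | m.+1 => lebesgue_cons (lebesgue_rV m)
  end.

Lemma lebesgue_rV_box n (A : 'I_n -> set R) : (forall i, measurable (A i)) ->
  lebesgue_rV n [set x | forall i, A i (x 0 i)] =
  (\prod_(i < n) lebesgue_measure (A i))%E.
Proof.
elim: n A => [|n IH] A mA.
  rewrite big_ord0 /= diracE mem_set// => -[].
  by [].
rewrite big_ord_recl -IH// /= /lebesgue_cons /pushforward.
set B := [set y : 'rV[R]_n | forall i, A (lift ord0 i) (y 0 i)].
have mB : measurable B.
  rewrite (_ : B = \bigcap_(i in [set: 'I_n])
      ((fun y : 'rV[R]_n => y 0 i) @^-1` A (lift ord0 i))).
    apply: fin_bigcap_measurable => // i _.
    by rewrite -[X in measurable X]setTI; exact: measurable_coord.
  by apply/seteqP; split=> y yA i; [move=> _; exact: yA|exact: (yA i I)].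
rewrite (_ : _ @^-1` _ = A ord0 `*` B).
  by rewrite product_measure1E//; exact: mA.
apply/seteqP; split=> -[a y] /=.
  move=> yA; split; first by have := yA ord0; rewrite mxE unlift_none.
  by move=> i; have := yA (lift ord0 i); rewrite mxE liftK.
move=> [Aa Ay] i; rewrite mxE.
by case: (unliftP ord0 i) => [j ->|->] /=.
Qed.

End lebesgue_rV.

(** * Weak derivatives and [D^{1,p}] *)

Section sobolev.
Variables (R : realType) (n : nat).
Implicit Types (u g f : 'rV[R]_n -> R) (p : R) (Omega : set 'rV[R]_n).

Local Notation mu := (lebesgue_rV R n).

(* The canonical norm of ['rV[R]_n] is the max-norm. *)
Definition enorm (x : 'rV[R]_n) : R := Num.sqrt (\sum_(i < n) x 0 i ^+ 2).

Definition partial (i : 'I_n) f : 'rV[R]_n -> R := 'D_(delta_mx 0 i) f.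

Definition C1 f :=
  continuous f /\
  forall i, (forall x, derivable f x (delta_mx 0 i)) /\
            continuous (partial i f).

Definition smooth f := forall s : seq 'I_n, C1 (foldr partial f s).

Definition test_function f :=
  smooth f /\ compact (closure [set x | f x != 0]).

Definition loc_integrable f :=
  measurable_fun setT f /\
  forall K, compact K -> (\int[mu]_(x in K) `|f x|%:E < +oo)%E.

Definition weak_partial u (i : 'I_n) g :=
  loc_integrable g /\
  forall f, test_function f ->
    (\int[mu]_x (u x * partial i f x)%:E = - \int[mu]_x (g x * f x)%:E)%E.

Definition weak_gradient u (G : 'rV[R]_n -> 'rV[R]_n) :=
  forall i, weak_partial u i (fun x => G x 0 i).

(* Some weak gradient of [u]; it is unique almost everywhere if it exists. *)
Definition gradient u : 'rV[R]_n -> 'rV[R]_n := xget (cst 0) (weak_gradient u).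

(* [Lfun mu p%:E] consists of the Borel functions with finite [L^p] norm. *)
Definition D1p p u :=
  loc_integrable u /\
  exists2 G, weak_gradient u G & forall i, (fun x => G x 0 i) \in Lfun mu p%:E.

(* For [p > n] an almost everywhere class in [D^{1,p}] contains exactly one
   continuous function, its Hoelder representative: the class is encoded by
   that function. *)
Definition D1p0 p Omega u :=
  [/\ D1p p u, continuous u & forall x, ~ Omega x -> u x = 0].

Definition dist_compl Omega (x : 'rV[R]_n) : R :=
  inf [set enorm (x - y) | y in ~` Omega].

Definition hardy_norm p Omega u : \bar R :=
  ereal_sup
    [set `|u x / dist_compl Omega x `^ (1 - n%:R / p)|%:E | x in Omega].

Definition grad_norm p u : \bar R :=
  Lnorm mu p%:E (fun x => (enorm (gradient u x))%:E).

Definition rayleigh p Omega u : \bar R :=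
  ((hardy_norm p Omega u `^ p)^-1 * grad_norm p u `^ p)%E.

Definition D1p0_neq0 p Omega : set ('rV[R]_n -> R) :=
  [set u | D1p0 p Omega u /\ u <> cst 0].

Definition lambda p Omega : \bar R :=
  ereal_inf [set rayleigh p Omega u | u in D1p0_neq0 p Omega].

Definition extremal p Omega u :=
  D1p0_neq0 p Omega u /\ rayleigh p Omega u = lambda p Omega.

End sobolev.

(** * The half-space and [C^1] domains *)

(* [l] is the index of the last coordinate whenever [l.+1 = n]. *)
Definition half_space (R : realType) (n : nat) : set 'rV[R]_n :=
  [set x | exists2 l : 'I_n, l.+1 = n & 0 < x 0 l].
Arguments half_space : clear implicits.

Definition boundary (T : topologicalType) (A : set T) : set T :=
  closure A `\` A°.

(* [y = x *m Q + b] are the coordinates of [x] after the rigid motion, and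
   [col' l y] drops the last one of them. *)
Definition C1_domain (R : realType) (n : nat) (Omega : set 'rV[R]_n) :=
  forall x0, boundary Omega x0 ->
  exists (r : R) (Q : 'M[R]_n) (b : 'rV[R]_n) (h : 'rV[R]_n.-1 -> R) (l : 'I_n),
  [/\ 0 < r, Q *m Q^T = 1%:M, C1 h, l.+1 = n &
      forall x, enorm (x - x0) < r ->
        Omega x <-> h (col' l (x *m Q + b)) < (x *m Q + b) 0 l].
Arguments C1_domain {R n} Omega.

(* Main.v *)
Require Import Defs.
From HB Require Import structures.
From mathcomp Require Import all_boot all_order all_algebra.
From mathcomp Require Import all_classical all_reals all_analysis.
From mathcomp Require Import measurable_realfun ring lra.

(** By scaling, [lambda p Omega] is the infimum over [x] in [Omega] of
    [d(x)^(p-n)] times the least energy [int |Du|^p] of a function [u] that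
    vanishes off [Omega] and has [u(x) = 1].  Take almost minimal pairs
    [(x_k, u_k)] with [x_k] converging to some [x0].

    If [x0] is in [Omega], Morrey's inequality gives [u_k(x0) --> 1], and the
    least energy under the constraint [u(x0) = 1] is attained by an extremal.

    If [x0] is on the boundary, the functions [u_k(x_k + d(x_k) eta)] have
    energy tending to [lambda p Omega], equal [1] at [eta = 0] and, [Omega]
    being [C^1], vanish asymptotically on a half-space [eta . nu <= -1].  A
    limit shows that [lambda] of the half-space is at most [lambda p Omega],
    which is excluded.

    Both limits are obtained without weak compactness: in a decreasing sequence
    of convex constraint sets, Clarkson's inequality makes almost minimisers
    Cauchy in energy, and Morrey's inequality gives pointwise convergence. *)

Set Implicit Arguments.
Unset Strict Implicit.
Unset Printing Implicit Defensive.

Import Order.TTheory GRing.Theory Num.Theory.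
Import numFieldNormedType.Exports.

Local Open Scope classical_set_scope.
Local Open Scope ring_scope.

(** The supremum in the Rayleigh quotient need not be attained, so a point where it is almost
    attained is carried along with [u], whose value there is normalised to [1]. Rescaling by
    [d(x_k)] about that point multiplies the energy by exactly [d(x_k)^(p-n)], which cancels the
    weight even when [d(x_k)] tends to [0].

    The obstacle at the boundary is that the rescaled domains need neither be nested nor lie in the
    limiting half-space, whereas Clarkson's inequality needs midpoints of competitors to be
    competitors. The constraint is therefore relaxed: the [j]-th set asks for vanishing only within
    distance [j] of the origin and only where [eta . nu <= -(1 + 1/(j+1))]. These sets are convex
    and decreasing, and suitable rescaled functions lie in each of them. Clarkson's inequality is
    used for [p >= 2], which follows from [p > n >= 2].

    The test functions constructed for Morrey's inequality and for the uniqueness of weak gradients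
    are products of functions of one variable, so that everything about them reduces to one smooth
    step on the line. *)

(** * Borel sets and affine invariance of Lebesgue measure *)

Lemma measurable_box_rV (R : realType) n (A : 'I_n -> set R) :
  (forall i, measurable (A i)) ->
  measurable [set x : 'rV[R]_n | forall i, A i (x 0 i)].
Proof.
move=> mA.
rewrite (_ : mkset _ = \bigcap_(i in [set: 'I_n])
    ((fun y : 'rV[R]_n => y 0 i) @^-1` A i)).
  apply: fin_bigcap_measurable => // i _.
  by rewrite -[X in measurable X]setTI; exact: measurable_coord.
by apply/seteqP; split=> y yA i; [move=> _; exact: yA|exact: (yA i I)].
Qed.

(** The sets [cell (k, z)] are the half-open cubes of side [1/(k+1)] with corner [z/(k+1)]. They are
    countably many boxes, and an open set is the union of those it contains. This ties the
    coordinate sigma-algebra to the topology. *)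
Lemma open_measurable_rV (R : realType) n (U : set 'rV[R]_n) :
  open U -> measurable U.
Proof.
move=> oU.
pose cell (kz : nat * 'rV[int]_n) : set 'rV[R]_n :=
  [set x | forall i, [set t | Num.floor (kz.1.+1%:R * t) = kz.2 0 i] (x 0 i)].
have mcell kz : measurable (cell kz).
  apply: (@measurable_box_rV R n (fun i => [set t | Num.floor (kz.1.+1%:R * t) = kz.2 0 i])) => i.
  set z := kz.2 0 i; set k : R := kz.1.+1%:R.
  have k0 : 0 < k by rewrite ltr0n.
  rewrite (_ : mkset _ = `[z%:~R / k, (z + 1)%:~R / k[%classic).
    exact: measurable_itv.
  apply/seteqP; split => t /=; rewrite in_itv/=.
    move/eqP; rewrite floor_eq => /andP[zt tz].
    by rewrite ler_pdivrMr// ltr_pdivlMr// mulrC zt tz.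
  rewrite ler_pdivrMr// ltr_pdivlMr// mulrC => H.
  by apply/eqP; rewrite floor_eq.
rewrite (_ : U = \bigcup_kz (if `[< cell kz `<=` U >] then cell kz else set0)).
  apply: countable_bigcupT_measurable; first exact: countableP.
  by move=> kz; case: ifP.
apply/seteqP; split => x; last first.
  by move=> [kz _]; case: ifPn => // /asboolP; apply.
move=> Ux.
have /nbhs_ballP[e /= e0 xeU] : nbhs x U by exact: open_nbhs_nbhs.
pose k := Num.truncn (e^-1).
have ke : e^-1 < k.+1%:R by exact: truncnS_gt.
pose z : 'rV[int]_n := \row_i Num.floor (k.+1%:R * x 0 i).
have xc : cell (k, z) x by move=> i /=; rewrite mxE.
exists (k, z) => //; rewrite ifT//; apply/asboolP => y yc; apply: xeU.
split => // i j; rewrite (ord1 i).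
have := xc j => /=; have := yc j => /=; rewrite !mxE => /eqP + _.
set K : R := k.+1%:R; have K0 : 0 < K by rewrite ltr0n.
rewrite floor_eq => /andP[fy yf]; have := floor_itv (K * x 0 j).
move=> /andP[fx xf]; rewrite /ball/=.
have Ke : 1 < K * e by rewrite mulrC -ltr_pdivrMl// mulr1.
rewrite -(ltr_pM2l K0); apply: lt_trans Ke.
rewrite -[in ltLHS](gtr0_norm K0) -normrM mulrBr.
move: fy yf fx xf; rewrite intrD => a1 a2 a3 a4.
rewrite ltr_norml; apply/andP; split; lra.
Qed.

Lemma closed_measurable_rV (R : realType) n (K : set 'rV[R]_n) :
  closed K -> measurable K.
Proof.
move=> cK; rewrite -[K]setCK; apply: measurableC.
by apply: open_measurable_rV; exact: closed_openC.
Qed.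

Lemma continuous_measurable_rV (R : realType) n (f : 'rV[R]_n -> R) :
  continuous f -> measurable_fun setT f.
Proof.
move=> cf; apply: (measurability _ (RGenOpens.measurableE R)) => _ [_ [a [b ->] <-]].
rewrite setTI; apply: open_measurable_rV; apply: open_comp => //.
Qed.

Definition measure_of_pushforward d1 d2 (T1 : measurableType d1)
    (T2 : measurableType d2) (R : realType) (m : {measure set T1 -> \bar R})
    (f : T1 -> T2) (mf : measurable_fun setT f) :
    {measure set T2 -> \bar R} :=
  measure_function_pushforward__canonical__measure_function_Measure m mf.

(** Both sides are measures in [A], so it is enough to compare them on half-open intervals. *)
Lemma lebesgue_measure_affine (R : realType) (s a : R) (A : set R) :
  0 < s -> measurable A ->
  (s%:E * lebesgue_measure ((fun t => (s * t + a)%R) @^-1` A) =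
   lebesgue_measure A)%E.
Proof.
move=> s0 mA; apply/esym.
have mf : measurable_fun setT (fun t => s * t + a : measurableTypeR R).
  by apply: measurable_funD => //; exact: measurable_funM.
pose m : {measure set (measurableTypeR R) -> \bar R} := mscale (NngNum (ltW s0))
  (measure_of_pushforward (@lebesgue_measure R) mf).
rewrite -[RHS]/(m A); apply: (@lebesgue_measure_unique R m) => //.
move=> _ [[u v] _ <-].
change (lebesgue_measure `]u, v] =
  s%:E * lebesgue_measure ((fun t => (s * t + a)%R) @^-1` `]u, v]))%E.
rewrite (_ : _ @^-1` _ = `](u - a) / s, (v - a) / s]%classic).
  rewrite !lebesgue_measure_itv/= !lte_fin ltr_pM2r ?invr_gt0//.
  rewrite ltrD2r; case: ifP => _; last by rewrite mule0.
  rewrite -EFinB -EFinM; congr EFin; field; lra.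
apply/seteqP; split => t; rewrite /= !in_itv/=.
  by rewrite ltr_pdivrMr// ler_pdivlMr// ltrBlDr lerBrDr mulrC.
by rewrite ltr_pdivrMr// ler_pdivlMr// ltrBlDr lerBrDr mulrC.
Qed.

Lemma lebesgue_rV_cube_lty (R : realType) n (a b : R) :
  (lebesgue_rV R n [set x | forall i, `[a, b]%classic (x 0%R i)] < +oo)%E.
Proof.
have -> : lebesgue_rV R n [set x | forall i, `[a, b]%classic (x 0%R i)] =
    (\prod_(i < n) (@lebesgue_measure R `[a, b]%classic))%E.
  exact: (@lebesgue_rV_box R n (fun=> `[a, b]%classic)).
rewrite -ge0_fin_numE; last by apply: prode_ge0.
by apply: prode_fin_num => i _; rewrite lebesgue_measure_itv/=; case: ifP.
Qed.

(** Boxes with measurable sides are stable under intersection and generate the sigma-algebra, and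
    the cubes [[-k, k]^n] exhaust the space with finite measure. Scaling, translation and reflection
    are checked on boxes through this. *)
Lemma lebesgue_rV_unique (R : realType) n
    (m : {measure set 'rV[R]_n -> \bar R}) :
  (forall A : 'I_n -> set R, (forall i, measurable (A i)) ->
    m [set x | forall i, A i (x 0 i)] =
    (\prod_(i < n) lebesgue_measure (A i))%E) ->
  forall B, measurable B -> m B = lebesgue_rV R n B.
Proof.
move=> mE B mB; apply/esym.
pose G := [set C : set 'rV[R]_n | exists2 A : 'I_n -> set R,
  (forall i, measurable (A i)) & C = [set x | forall i, A i (x 0 i)]].
pose g (k : nat) := [set x : 'rV[R]_n | forall i,
  `[-(k%:R), k%:R]%classic (x 0 i)].
apply: (@measure_unique _ R _ G g) => //.
- apply/seteqP; split.
    apply: smallest_sub; first exact: smallest_sigma_algebra.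
    move=> C; rewrite -bigcup_seq => -[i _] [D mD <-].
    apply: sub_sigma_algebra; exists (fun j => if j == i then D else setT).
      by move=> j; case: ifP.
    rewrite setTI; apply/seteqP; split => x /=.
      by move=> Dx j; case: eqP => [->|].
    by move/(_ i); rewrite eqxx.
  apply: smallest_sub; first exact: sigma_algebra_measurable.
  by move=> C [A mA ->]; exact: measurable_box_rV.
- move=> _ _ [A mA ->] [A' mA' ->]; exists (fun i => A i `&` A' i).
    by move=> i; exact: measurableI.
  apply/seteqP; split => x /=; first by move=> [xA xA'] i.
  by move=> xAA; split => i; case: (xAA i).
- by move=> k; exists (fun=> `[-(k%:R), k%:R]%classic).
- apply/seteqP; split => // x _.
  exists (Num.truncn (\sum_(i < n) `|x 0 i|)).+1 => // i /=.
  rewrite in_itv/= -ler_norml; apply: le_trans (ltW (truncnS_gt _)).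
  by rewrite (bigD1 i)//= lerDl sumr_ge0.
- by move=> C [A mA ->]; exact: etrans (lebesgue_rV_box mA) (esym (mE _ mA)).
- by move=> k; exact: lebesgue_rV_cube_lty.
Qed.

Lemma continuous_rVP (R : realType) n (f : 'rV[R]_n -> R) :
  continuous f <-> forall (x : 'rV[R]_n) (e : R), 0 < e ->
    exists2 d : R, 0 < d & forall y : 'rV[R]_n, `|x - y| < d -> `|f x - f y| < e.
Proof.
split=> [cf x e e0|H x].
  have /cvgrPdist_lt/(_ _ e0) := cf x.
  rewrite -[X in X -> _]/(nbhs (x : 'rV[R]_n) _) => /nbhs_ballP[d d0 xdf].
  exists d => // y xy; apply: xdf; rewrite mx_norm_ball; exact: xy.
apply/(@cvgrPdist_lt _ _ _ (nbhs (x : 'rV[R]_n))) => e e0.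
have [d d0 xd] := H x e e0; apply/nbhs_ballP; exists d => // y.
by rewrite mx_norm_ball; exact: xd.
Qed.

Lemma measurable_affine_rV (R : realType) n (s : R) (O : 'M[R]_n) (a : 'rV[R]_n) :
  measurable_fun setT (fun x : 'rV[R]_n => s *: (x *m O) + a).
Proof.
apply: measurable_fun_rV => i.
under eq_fun do rewrite !mxE.
apply: measurable_funD => //; apply: measurable_funM => //.
apply: measurable_sum => j; apply: measurable_funM => //.
exact: measurable_coord.
Qed.

(** The sides of a box transform separately, each contributing a factor [s]. The identity matrix is
    kept so that the map is an instance of [measurable_affine_rV]. *)
Lemma lebesgue_rV_affine (R : realType) n (s : R) (a : 'rV[R]_n) B :
  0 < s -> measurable B ->
  ((s ^+ n)%:E * lebesgue_rV R n ((fun x => s *: (x *m 1%:M) + a)%R @^-1` B) =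
   lebesgue_rV R n B)%E.
Proof.
move=> s0 mB.
pose m : {measure set 'rV[R]_n -> \bar R} :=
  mscale (NngNum (exprn_ge0 n (ltW s0)))
  (measure_of_pushforward (lebesgue_rV R n) (measurable_affine_rV s 1%:M a)).
apply: (@lebesgue_rV_unique R n m) => // A mA.
change ((s ^+ n)%:E * lebesgue_rV R n ((fun x => s *: (x *m 1%:M) + a)%R @^-1`
  [set x | forall i, A i (x 0%R i)]) =  (\prod_(i < n) lebesgue_measure (A i)))%E.
rewrite (_ : _ @^-1` _ = [set x : 'rV[R]_n |
    forall i, ((fun t => s * t + a 0 i) @^-1` A i) (x 0 i)]); last first.
  by apply/seteqP; split => x /= + i => /(_ i); rewrite mulmx1 !mxE.
rewrite (@lebesgue_rV_box R n (fun i => (fun t => s * t + a 0 i) @^-1` A i)); last first.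
  move=> i; rewrite -[X in measurable X]setTI.
  suff : measurable_fun setT (fun t : R => s * t + a 0 i) by exact.
  by apply: measurable_funD => //; exact: measurable_funM.
transitivity (\prod_(i < n) (s%:E *
    lebesgue_measure ((fun t => (s * t + a ord0 i)%R) @^-1` A i)))%E.
  by rewrite big_split/= prodEFin prodr_const card_ord.
by apply: eq_bigr => i _; rewrite lebesgue_measure_affine.
Qed.

Lemma lebesgue_rVN (R : realType) n B : measurable B ->
  (lebesgue_rV R n ((fun x => (-1) *: (x *m 1%:M) + 0)%R @^-1` B) =
   lebesgue_rV R n B)%E.
Proof.
move=> mB.
pose m : {measure set 'rV[R]_n -> \bar R} :=
  measure_of_pushforward (lebesgue_rV R n) (measurable_affine_rV (-1) 1%:M 0).
apply: (@lebesgue_rV_unique R n m) => // A mA.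
change (lebesgue_rV R n ((fun x => (-1) *: (x *m 1%:M) + 0)%R @^-1`
  [set x | forall i, A i (x 0%R i)]) =  (\prod_(i < n) lebesgue_measure (A i)))%E.
rewrite (_ : _ @^-1` _ = [set x : 'rV[R]_n |
    forall i, (-%R @^-1` A i) (x 0 i)]); last first.
  by apply/seteqP; split => x /= + i => /(_ i); rewrite mulmx1 addr0 !mxE mulN1r.
rewrite (@lebesgue_rV_box R n (fun i => -%R @^-1` A i)); last first.
  move=> i; rewrite -[X in measurable X]setTI.
  by suff : measurable_fun setT (-%R : R -> R) by exact.
by apply: eq_bigr => i _; exact: lebesgue_measureN.
Qed.

Section change_of_variables.
Local Open Scope ereal_scope.
Variables (R : realType) (n : nat).
Local Notation mu := (lebesgue_rV R n).
Implicit Types f g : 'rV[R]_n -> \bar R.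

Lemma ge0_integral_scale_rV (s : R) (a : 'rV[R]_n) f : (0 < s)%R ->
  measurable_fun setT f -> (forall x, 0 <= f x) ->
  (s ^+ n)%:E * \int[mu]_x f (s *: x + a)%R = \int[mu]_x f x.
Proof.
move=> s0 mf f0.
transitivity (\int[mscale (NngNum (exprn_ge0 n (ltW s0)))
    (measure_of_pushforward mu (measurable_affine_rV s 1%:M a))]_x f x).
  rewrite ge0_integral_mscale//= ge0_integral_pushforward//.
    congr (_ * _); rewrite preimage_setT; apply: eq_integral => x _ /=.
    by rewrite mulmx1.
  exact: measurable_affine_rV.
by apply: eq_measure_integral => A mA _; exact: lebesgue_rV_affine.
Qed.

Lemma ge0_integral_translate_rV (a : 'rV[R]_n) f :
  measurable_fun setT f -> (forall x, 0 <= f x) ->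
  \int[mu]_x f (x + a)%R = \int[mu]_x f x.
Proof.
move=> mf f0; rewrite -[RHS](ge0_integral_scale_rV a ltr01)// expr1n mul1e.
by apply: eq_integral => x _; rewrite scale1r.
Qed.

Lemma ge0_integralN_rV f :
  measurable_fun setT f -> (forall x, 0 <= f x) ->
  \int[mu]_x f (- x)%R = \int[mu]_x f x.
Proof.
move=> mf f0.
transitivity (\int[measure_of_pushforward mu
    (measurable_affine_rV (-1) 1%:M 0)]_x f x).
  rewrite ge0_integral_pushforward//.
    rewrite preimage_setT; apply: eq_integral => x _ /=.
    by rewrite mulmx1 addr0 scaleN1r.
  exact: measurable_affine_rV.
by apply: eq_measure_integral => A mA _; exact: lebesgue_rVN.
Qed.

End change_of_variables.

(** * Scalar product and Euclidean norm, compared with the max-norm *)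

Section euclidean_norm.
Variables (R : realType) (n : nat).
Implicit Types x y : 'rV[R]_n.

Definition dotv x y : R := \sum_(i < n) x 0 i * y 0 i.

Lemma enorm_ge0 x : 0 <= enorm x.
Proof. exact: sqrtr_ge0. Qed.

Lemma sqr_enorm x : enorm x ^+ 2 = \sum_(i < n) x 0 i ^+ 2.
Proof. by rewrite sqr_sqrtr// sumr_ge0// => i _; exact: sqr_ge0. Qed.

Lemma enorm0 : enorm (0 : 'rV[R]_n) = 0.
Proof.
by rewrite /enorm big1 ?sqrtr0// => i _; rewrite mxE expr0n.
Qed.

Lemma enormZ (s : R) x : enorm (s *: x) = `|s| * enorm x.
Proof.
rewrite /enorm (eq_bigr (fun i => s ^+ 2 * x 0 i ^+ 2)); last first.
  by move=> i _; rewrite mxE exprMn.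
by rewrite -mulr_sumr sqrtrM ?sqr_ge0// sqrtr_sqr.
Qed.

Lemma enormN x : enorm (- x) = enorm x.
Proof. by rewrite -scaleN1r enormZ normrN1 mul1r. Qed.

Lemma dotvC x y : dotv x y = dotv y x.
Proof. by apply: eq_bigr => i _; rewrite mulrC. Qed.

Lemma dotvZl (s : R) x y : dotv (s *: x) y = s * dotv x y.
Proof. by rewrite mulr_sumr; apply: eq_bigr => i _; rewrite mxE mulrA. Qed.

Lemma dotvDl x x' y : dotv (x + x') y = dotv x y + dotv x' y.
Proof. by rewrite -big_split; apply: eq_bigr => i _; rewrite mxE mulrDl. Qed.

Lemma dotvNl x y : dotv (- x) y = - dotv x y.
Proof. by rewrite -scaleN1r dotvZl mulN1r. Qed.

Lemma dotvZr (s : R) x y : dotv x (s *: y) = s * dotv x y.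
Proof. by rewrite dotvC dotvZl dotvC. Qed.

Lemma dotvDr x y y' : dotv x (y + y') = dotv x y + dotv x y'.
Proof. by rewrite dotvC dotvDl !(dotvC x). Qed.

Lemma dotvNr x y : dotv x (- y) = - dotv x y.
Proof. by rewrite dotvC dotvNl dotvC. Qed.

Lemma dotvv x : dotv x x = enorm x ^+ 2.
Proof. by rewrite sqr_enorm; apply: eq_bigr. Qed.

Lemma enorm_eq0 x : enorm x = 0 -> x = 0.
Proof.
move=> x0; have := sqr_enorm x; rewrite x0 expr0n/= => /esym/eqP.
rewrite psumr_eq0; last by move=> i _; exact: sqr_ge0.
move=> /allP H; apply/rowP => i; rewrite mxE; apply/eqP.
by have := H i; rewrite mem_index_enum sqrf_eq0; apply.
Qed.

Lemma dotv_le x y : `|dotv x y| <= enorm x * enorm y.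
Proof.
suff H x' : dotv x' y <= enorm x' * enorm y.
  rewrite ler_norml H andbT lerNl -dotvNl.
  by rewrite -[X in X * _]enormN; exact: H.
have [/enorm_eq0->|x0] := eqVneq (enorm x') 0.
  by rewrite enorm0 mul0r /dotv big1// => i _; rewrite mxE mul0r.
have [/enorm_eq0->|y0] := eqVneq (enorm y) 0.
  by rewrite enorm0 mulr0 /dotv big1// => i _; rewrite mxE mulr0.
(* With [a], [b] the two norms and [c] the scalar product, expanding this square gives
   [2ab(ab - c) >= 0]. *)
have : 0 <= dotv (enorm y *: x' - enorm x' *: y) (enorm y *: x' - enorm x' *: y).
  by rewrite dotvv sqr_ge0.
rewrite !(dotvDl, dotvDr, dotvNl, dotvNr, dotvZl, dotvZr) !dotvv (dotvC y x').
have ex : 0 < enorm x' by rewrite lt_def x0 enorm_ge0.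
have ey : 0 < enorm y by rewrite lt_def y0 enorm_ge0.
move: (enorm x') (enorm y) ex ey (dotv x' y) => a b a0 b0 c H.
have : 0 <= (2 * a * b) * (a * b - c) by lra.
by rewrite pmulr_rge0 ?subr_ge0// !mulr_gt0.
Qed.

Lemma ler_enormD x y : enorm (x + y) <= enorm x + enorm y.
Proof.
rewrite -(@ler_pXn2r _ 2)// ?nnegrE ?addr_ge0 ?enorm_ge0//.
rewrite -dotvv !(dotvDl, dotvDr) !dotvv (dotvC y x).
have := le_trans (ler_norm _) (dotv_le x y); lra.
Qed.

Lemma norm_coord_le_enorm x i : `|x 0 i| <= enorm x.
Proof.
rewrite -(@ler_pXn2r _ 2)// ?nnegrE ?enorm_ge0//.
rewrite sqr_enorm real_normK ?num_real// (bigD1 i)//= lerDl sumr_ge0// => j _.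
exact: sqr_ge0.
Qed.

Lemma norm_coord_le x i : `|x 0 i| <= `|x|.
Proof.
rewrite [leRHS]mx_normrE.
exact: (le_bigmax_cond _ (fun ij => `|x ij.1 ij.2|) (j := (0, i))).
Qed.

Lemma norm_le_enorm x : `|x| <= enorm x.
Proof.
rewrite [leLHS]mx_normrE; apply: bigmax_le; first exact: enorm_ge0.
by move=> [i j] _ /=; rewrite (ord1 i); exact: norm_coord_le_enorm.
Qed.

Lemma enorm_le_norm x : enorm x <= n%:R * `|x|.
Proof.
have n0 : (0 : R) <= n%:R by [].
rewrite -(@ler_pXn2r _ 2)// ?nnegrE ?enorm_ge0// ?mulr_ge0//.
rewrite sqr_enorm exprMn; apply: (@le_trans _ _ (n%:R * `|x| ^+ 2)).
  have -> : n%:R * `|x| ^+ 2 = \sum_(i < n) `|x| ^+ 2.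
    by rewrite sumr_const card_ord mulr_natl.
  apply: ler_sum => i _; rewrite -[leLHS]real_normK ?num_real//.
  by rewrite ler_pXn2r ?nnegrE ?norm_coord_le.
rewrite ler_wpM2r ?sqr_ge0// expr2 -natrM ler_nat.
by case: (n) => // m; rewrite mulSn leq_addr.
Qed.

Lemma enorm_continuous : continuous (@enorm R n).
Proof.
apply/continuous_rVP => x e e0; exists (e / n.+1%:R) => [|y xy].
  by rewrite divr_gt0.
have H1 : enorm x <= enorm (x - y) + enorm y.
  by rewrite -{1}(subrK y x); exact: ler_enormD.
have H2 : enorm y <= enorm (x - y) + enorm x.
  by rewrite -(enormN (x - y)) opprB -{1}(subrK x y); exact: ler_enormD.
apply: (@le_lt_trans _ _ (enorm (x - y))).
  by rewrite ler_norml; apply/andP; split; lra.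
apply: le_lt_trans (enorm_le_norm _) _.
apply: (@le_lt_trans _ _ (n.+1%:R * `|x - y|)).
  by rewrite ler_wpM2r// ler_nat.
by rewrite mulrC -ltr_pdivlMr ?ltr0n.
Qed.

Lemma measurable_enorm : measurable_fun setT (@enorm R n).
Proof. apply: continuous_measurable_rV; exact: enorm_continuous. Qed.

Lemma dotv_mulmx x y (O : 'M[R]_n) : O *m O^T = 1%:M ->
  dotv (x *m O) (y *m O) = dotv x y.
Proof.
have dE u v : dotv u v = (u *m v^T) 0 0.
  by rewrite !mxE; apply: eq_bigr => i _; rewrite mxE.
by move=> OO; rewrite !dE trmx_mul mulmxA -(mulmxA x) OO mulmx1.
Qed.

Lemma enorm_mulmx x (O : 'M[R]_n) : O *m O^T = 1%:M ->
  enorm (x *m O) = enorm x.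
Proof.
move=> OO; apply/eqP; rewrite -(@eqrXn2 _ 2)// ?enorm_ge0//.
by rewrite -!dotvv dotv_mulmx.
Qed.

End euclidean_norm.

(** * Invariance of the integral under orthogonal maps *)

Section orthogonal_invariance.
Local Open Scope ereal_scope.
Variables (R : realType) (n : nat).
Local Notation mu := (lebesgue_rV R n).

Let B := [set x : 'rV[R]_n | (enorm x < 1)%R].

Let mB : measurable B.
Proof.
apply: open_measurable_rV; rewrite (_ : B = @enorm R n @^-1` `]-oo, 1%R[).
  by apply: open_comp => [x _|]; [exact: enorm_continuous|exact: interval_open].
by apply/seteqP; split => x /=; rewrite in_itv.
Qed.

Let B_lty : mu B < +oo.
Proof.
apply: le_lt_trans (lebesgue_rV_cube_lty n (-1) 1).
apply: le_measure; rewrite ?inE//.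
  exact: (measurable_box_rV (A := fun=> `[(-1)%R, 1%R]%classic)).
move=> x Bx i /=; rewrite in_itv/= -ler_norml.
by apply: le_trans (ltW Bx); exact: norm_coord_le_enorm.
Qed.

Let B_gt0 : 0 < mu B.
Proof.
(* A point with max-norm at most [e] has Euclidean norm at most [n/(n+1)], which is strictly less
   than [1], also for [n = 0]. *)
pose e : R := (n.+1%:R^-1)%R.
have e0 : (0 < e)%R by rewrite invr_gt0.
pose C : set 'rV[R]_n := [set x : 'rV[R]_n | forall i, (`](- e)%R, e[%classic) (x 0%R i)].
have mC : measurable C by exact: (measurable_box_rV (A := fun=> `](- e)%R, e[%classic)).
apply: (@lt_le_trans _ _ (mu C)).
  rewrite (_ : mu C = \prod_(i < n) (@lebesgue_measure R `](- e)%R, e[%classic)).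
    rewrite lebesgue_measure_itv/= lte_fin ifT; last lra.
    rewrite -EFinB prodEFin lte_fin prodr_gt0// => i _; lra.
  exact: (@lebesgue_rV_box R n (fun=> `](- e)%R, e[%classic)).
apply: le_measure; rewrite ?inE// => x Cx; rewrite /B/=.
apply: le_lt_trans (enorm_le_norm _) _.
apply: (@le_lt_trans _ _ (n%:R * e)%R).
  apply: ler_wpM2l => //; rewrite [leLHS]mx_normrE; apply: bigmax_le; first lra.
  move=> [i j] _ /=; rewrite (ord1 i); apply: ltW; have := Cx j.
  by rewrite /= in_itv/= -ltr_norml.
by rewrite /e ltr_pdivrMr// mul1r ltr_nat.
Qed.

(** The double integral of [g(y) f(x + yO)], with [g] the indicator of the unit ball, is computed in
    both orders. Integrating in [x] first gives [|B|] times the integral of [f], by translation.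
    Translating [y] by [-xO^T] and using that [g] is invariant under [O] turns the integrand into
    [g(yO - x) f(yO)], whose integral is [|B|] times that of [f(yO)]. Since [|B|] is positive and
    finite it cancels. *)
Lemma ge0_integral_orthogonal (O : 'M[R]_n) (f : 'rV[R]_n -> \bar R) :
  O *m O^T = 1%:M -> measurable_fun setT f -> (forall x, 0 <= f x) ->
  \int[mu]_x f (x *m O) = \int[mu]_x f x.
Proof.
move=> OO mf f0.
have OtO : O^T *m O = 1%:M by exact: mulmx1C.
pose g (x : 'rV[R]_n) : \bar R := (\1_B x)%:E.
have mg : measurable_fun setT g by apply/measurable_EFinP; exact: measurable_indic.
have g0 x : 0 <= g x by rewrite lee_fin.
have gO x : g (x *m O) = g x.
  rewrite /g !indicE; congr (_%:R%:E); congr nat_of_bool.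
  by apply/idP/idP => /set_mem xB; apply/mem_set; move: xB; rewrite /B/= enorm_mulmx.
have mO : measurable_fun setT (fun x : 'rV[R]_n => (x *m O)).
  have := measurable_affine_rV 1 O 0.
  by under eq_fun do rewrite scale1r addr0.
have mxyO : measurable_fun setT
    (fun xy : 'rV[R]_n * 'rV[R]_n => xy.1 + xy.2 *m O)%R.
  apply: measurable_fun_rV => i; under eq_fun do rewrite mxE.
  apply: measurable_funD.
    exact: (measurableT_comp (measurable_coord i)).
  apply: (measurableT_comp (measurable_coord i)).
  exact: (measurableT_comp mO).
have myOx : measurable_fun setT
    (fun xy : 'rV[R]_n * 'rV[R]_n => xy.2 *m O - xy.1)%R.
  apply: measurable_fun_rV => i; under eq_fun do rewrite mxE [X in (_ + X)%R]mxE.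
  apply: measurable_funB.
    apply: (measurableT_comp (measurable_coord i)).
    exact: (measurableT_comp mO).
  exact: (measurableT_comp (measurable_coord i)).
have intg : \int[mu]_x g x = mu B by rewrite integral_indic// setIT.
have mfO : measurable_fun setT (fun y : 'rV[R]_n => f (y *m O)).
  exact: measurableT_comp mf mO.
have mft x : measurable_fun setT (fun y : 'rV[R]_n => f (x + y *m O)%R).
  apply: (measurableT_comp mf).
  exact: (measurableT_comp mxyO (pair1_measurable x)).
have E1 : \int[mu]_y \int[mu]_x (g y * f (x + y *m O)%R) = mu B * \int[mu]_x f x.
  transitivity (\int[mu]_y (g y * \int[mu]_x f x)).
    apply: eq_integral => y _; rewrite ge0_integralZl//; last first.
      apply: (measurableT_comp mf).
      exact: (measurableT_comp mxyO (pair2_measurable y)).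
    by rewrite ge0_integral_translate_rV.
  under eq_integral do rewrite muleC.
  rewrite ge0_integralZl// ?intg 1?muleC//; exact: integral_ge0.
have E2 : \int[mu]_x \int[mu]_y (g y * f (x + y *m O)%R) =
          mu B * \int[mu]_y f (y *m O).
  transitivity (\int[mu]_x \int[mu]_y (g (y *m O - x)%R * f (y *m O))).
    apply: eq_integral => x _.
    rewrite -(ge0_integral_translate_rV (- (x *m O^T))%R); last 2 first.
      by apply: emeasurable_funM.
      by move=> y; exact: mule_ge0.
    apply: eq_integral => y _; rewrite mulmxDl mulNmx -mulmxA OtO mulmx1.
    rewrite addrCA subrr addr0 -[in LHS]gO.
    by rewrite mulmxDl mulNmx -mulmxA OtO mulmx1.
  rewrite (fubini_tonelli (fun xy : 'rV[R]_n * 'rV[R]_n => g (xy.2 *m O - xy.1)%R * f (xy.2 *m O)))/=.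
  - transitivity (\int[mu]_y (mu B * f (y *m O))); last by rewrite ge0_integralZl.
    apply: eq_integral => y _.
    under eq_integral do rewrite muleC.
    rewrite ge0_integralZl//; last first.
      apply: (measurableT_comp mg).
      exact: (measurableT_comp myOx (pair2_measurable y)).
    rewrite muleC; congr (_ * _); rewrite -intg.
    rewrite -[RHS](ge0_integral_translate_rV (y *m O))//.
    rewrite -[RHS]ge0_integralN_rV//.
      by apply: eq_integral => x _; rewrite addrC.
    apply: (measurableT_comp mg).
    have := measurable_affine_rV 1 1%:M (y *m O).
    by under eq_fun do rewrite scale1r mulmx1.
  - apply: emeasurable_funM; first exact: (measurableT_comp mg).
    exact: (measurableT_comp mfO).
  - by move=> xy; exact: mule_ge0.
have : mu B * \int[mu]_x f x = mu B * \int[mu]_y f (y *m O).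
  rewrite -E1 -E2.
  apply/esym/(fubini_tonelli (fun xy : 'rV[R]_n * 'rV[R]_n => g xy.2 * f (xy.1 + xy.2 *m O)%R)).
    apply: emeasurable_funM; first exact: (measurableT_comp mg).
    exact: (measurableT_comp mf).
  by move=> xy; exact: mule_ge0.
have Bf : mu B \is a fin_num by rewrite ge0_fin_numE ?B_lty.
have c : (fine (mu B))^-1%:E * mu B = 1.
  rewrite -[X in _ * X](fineK Bf) -EFinM mulVf// gt_eqF// fine_gt0//.
  by rewrite B_gt0.
move=> /esym /(congr1 (fun t => (fine (mu B))^-1%:E * t)).
by rewrite !muleA c !mul1e.
Qed.

End orthogonal_invariance.

(** * Smooth functions with compact support *)

Section bump.
Variable R : realType.

Let W : {poly R} := 'X * (1 - 'X).

Let WE x : W.[x] = x * (1 - x).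
Proof. by rewrite /W !hornerE. Qed.

(* The functions [P / w^(k+1) exp(-1/w)] with [w = x (1 - x)] are, up to a
   change of [P] and [k], stable under differentiation. *)
Let bumpf (P : {poly R}) (k : nat) (x : R) : R :=
  if 0 < x < 1 then P.[x] * (W.[x]^-1) ^+ k.+1 * expR (- W.[x]^-1) else 0.

Let horner_bound (P : {poly R}) :
  exists2 M : R, 0 <= M & forall x : R, 0 < x < 1 -> `|P.[x]| <= M.
Proof.
exists (\sum_(i < size P) `|P`_i|); first by rewrite sumr_ge0.
move=> x /andP[x0 x1]; rewrite horner_coef.
apply: le_trans (ler_norm_sum _ _ _) _; apply: ler_sum => i _.
rewrite normrM ler_piMr// normrX exprn_ile1// gtr0_norm// ltW//.
Qed.

(** The inequality [e^v >= v^(m+1)/(m+1)!] at [v = 1/w], inverted. *)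
Let exp_bound (m : nat) (w : R) : 0 < w ->
  expR (- w^-1) <= m.+1`!%:R * w ^+ m.+1.
Proof.
move=> w0; have v0 : 0 <= w^-1 by rewrite invr_ge0 ltW.
have := expR_ge1Dxn m v0.
set F : R := m.+1`!%:R; have F0 : 0 < F by rewrite ltr0n fact_gt0.
move=> H; rewrite expRN -[leRHS]invrK lef_pV2 ?posrE ?expR_gt0//; last first.
  by rewrite invr_gt0 mulr_gt0// exprn_gt0.
rewrite invfM mulrC -exprVn; apply: le_trans H.
by rewrite -/F ler_wpDl.
Qed.

(** The exponential absorbs the pole [W^-(k+1)] and leaves a factor [W^2], and [W(y) <= |y - x|]
    when [y] is in the open unit interval and [x] is not. The quadratic bound makes the derivative
    vanish at [x], endpoints included. *)
Let bumpf_quadratic (P : {poly R}) (k : nat) : exists2 M : R, 0 <= M &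
  forall x y : R, ~~ (0 < x < 1) -> `|bumpf P k y| <= M * (y - x) ^+ 2.
Proof.
have [M M0 PM] := horner_bound P.
exists (M * (k.+2.+1)`!%:R) => [|x y x01]; first by rewrite mulr_ge0.
rewrite /bumpf; case: ifPn => y01; last first.
  by rewrite normr0 mulr_ge0// ?sqr_ge0// mulr_ge0.
have /andP[y0 y1] := y01.
have w0 : 0 < W.[y] by rewrite WE mulr_gt0// subr_gt0.
rewrite normrM (ger0_norm (expR_ge0 _)) normrM normrX normfV (gtr0_norm w0).
apply: (@le_trans _ _ (M * (W.[y]^-1) ^+ k.+1 *
    ((k.+2).+1`!%:R * W.[y] ^+ k.+3))).
  apply: ler_pM => //; first by rewrite mulr_ge0// exprn_ge0// invr_ge0 ltW.
    by apply: ler_pM => //; [rewrite exprn_ge0// invr_ge0 ltW|exact: PM].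
  exact: exp_bound.
have -> : M * (W.[y]^-1) ^+ k.+1 * ((k.+2).+1`!%:R * W.[y] ^+ k.+3) =
    M * (k.+2).+1`!%:R * W.[y] ^+ 2.
  rewrite -(addn2 k.+1) exprD -[RHS]mulr1.
  rewrite -(expr1n _ k.+1) -{2}(@mulVf _ W.[y]) ?gt_eqF// exprMn; ring.
apply: ler_wpM2l; first by rewrite mulr_ge0.
suff H : W.[y] <= `|y - x|.
  by rewrite -[leRHS]real_normK ?num_real// ler_pXn2r ?nnegrE// ltW.
rewrite WE; move: x01; rewrite negb_and -!leNgt => /orP[x0|x1].
  by rewrite ger0_norm; [nra|lra].
by rewrite ler0_norm; [nra|lra].
Qed.

(** Inside the interval, the derivative put over the common denominator [W^(k+3)] has this
    polynomial as numerator. Elsewhere the quadratic bound sends the difference quotients to [0]. *)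
Let bumpf_derive (P : {poly R}) (k : nat) (x : R) :
  is_derive x (1 : R) (bumpf P k)
    (bumpf (P^`() * W ^+ 2 - k.+1%:R *: (P * W^`() * W) + P * W^`()) k.+2 x).
Proof.
have [x01|x01] := boolP (0 < x < 1); last first.
  rewrite [X in is_derive _ _ _ X](_ : _ = 0); last first.
    by rewrite /bumpf (negbTE x01).
  have [M M0 MP] : exists2 M : R, 0 < M &
      forall y, `|bumpf P k y| <= M * (y - x) ^+ 2.
    have [M M0 MP] := bumpf_quadratic P k.
    exists (M + 1) => [|y]; first by rewrite ltr_wpDl.
    apply: le_trans (MP x y x01) _.
    by rewrite ler_wpM2r ?sqr_ge0// lerDl.
  have fx0 : bumpf P k x = 0 by rewrite /bumpf (negbTE x01).
  suff H : (h^-1 *: ((bumpf P k \o shift x) (h *: (1 : R)) - bumpf P k x))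
      @[h --> (0 : R)^'] --> (0 : R).
    apply: DeriveDef; first by apply/cvg_ex; exists 0.
    by apply/cvg_lim.
  apply/cvgrPdist_le => e e0; near=> h.
  rewrite fx0 subr0 sub0r normrN /=.
  have h0 : h != 0 by near: h; exact: nbhs_dnbhs_neq.
  have hh : `|h| > 0 by rewrite normr_gt0.
  rewrite normrZ normfV ler_pdivrMl// [_ *: 1]mulr1.
  apply: le_trans (MP _) _; rewrite addrK -real_normK ?num_real// expr2.
  rewrite mulrA mulrC ler_pM2l//.
  rewrite mulrC -ler_pdivlMr//.
  by near: h; apply: dnbhs0_le; exact: divr_gt0.
have /andP[x0 x1] := x01.
have w0 : W.[x] != 0 by rewrite WE mulf_neq0// ?subr_eq0 gt_eqF.
apply: (@near_eq_is_derive _ _ _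
    (fun y => P.[y] * (W.[y]^-1) ^+ k.+1 * expR (- W.[y]^-1))).
  have : nbhs x `]0, 1[%classic.
    by apply: open_nbhs_nbhs; split; [exact: interval_open|rewrite /= in_itv/= x0].
  apply: filterS => y /=; rewrite in_itv/= => y01.
  by rewrite /bumpf y01.
rewrite /bumpf x01.
have dW := is_derive_poly W x.
have dV : is_derive x (1 : R) (fun y => W.[y]^-1) (- W.[x] ^- 2 *: W^`().[x]).
  exact: is_deriveV.
have dVk : is_derive x (1 : R) (fun y => (W.[y]^-1) ^+ k.+1)
    ((k.+1%:R * W.[x]^-1 ^+ k) *: (- W.[x] ^- 2 *: W^`().[x])).
  rewrite (_ : (fun y : R => _) = (fun y : R => W.[y]^-1) ^+ k.+1).
    exact: (is_deriveX k.+1 dV).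
  by apply/funext => y; rewrite exprfctE.
have dE : is_derive x (1 : R) (fun y => expR (- W.[y]^-1))
    (expR (- W.[x]^-1) * - (- W.[x] ^- 2 *: W^`().[x])).
  apply: (@is_derive1_comp _ expR (fun y => - W.[y]^-1)).
apply: (is_derive_eq (is_deriveM (is_deriveM (is_derive_poly P x) dVk) dE)).
rewrite -[(_ * _) x]/(P.[x] * (W.[x]^-1) ^+ k.+1).
clear dW dV dVk dE; set V : {poly R} := W in w0 *; clearbody V.
rewrite !(hornerD, hornerN, hornerZ, hornerM, horner_exp) /GRing.scale/=.
move: (expR (- V.[x]^-1)) (V.[x]) w0 (V^`().[x]) (P.[x]) (P^`().[x]) => E v v0 d q q'.
rewrite -(exprVn v 2) -(addn2 k.+1) exprD exprS; move: (v^-1 ^+ k) => z.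
by field.
Unshelve. all: by end_near. Qed.

Definition smooth1 (f : R -> R) := forall k x, derivable (f^`(k))%classic x 1.

Lemma smooth1_derive f : smooth1 f -> smooth1 (f^`())%classic.
Proof. by move=> sf k x; rewrite -derive1Sn; exact: sf. Qed.

Lemma smooth1_derivable f x : smooth1 f -> derivable f x 1.
Proof. by move=> sf; have := sf 0 x; rewrite derive1n0. Qed.

(** A coinduction principle: a class of derivable functions stable under differentiation consists of
    smooth functions, so that no formula for higher derivatives has to be found. *)
Lemma smooth1_coind (C : (R -> R) -> Prop) :
  (forall g, C g -> (forall x, derivable g x 1) /\ C (g^`())%classic) ->
  forall f, C f -> smooth1 f.
Proof.
move=> CP f Cf k; suff : C (f^`(k))%classic by move=> /CP[].
elim: k => [|k ih]; first by rewrite derive1n0.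
by rewrite derive1nS; have [] := CP _ ih.
Qed.

Lemma smooth1_continuous f : smooth1 f -> continuous f.
Proof.
move=> sf x; apply: differentiable_continuous.
exact/derivable1_diffP/smooth1_derivable.
Qed.

Lemma bump_exists : exists th : R -> R, [/\ smooth1 th,
  forall x, 0 <= th x, forall x : R, ~~ (0 < x < 1) -> th x = 0 &
  forall x : R, 0 < x < 1 -> 0 < th x].
Proof.
exists (bumpf 1 0); split.
- apply: (smooth1_coind (C := fun f => exists P k, f = bumpf P k)); last first.
    by exists 1, 0.
  move=> _ [P [k ->]]; split.
    by move=> x; have [] := bumpf_derive P k x.
  exists (P^`() * W ^+ 2 - k.+1%:R *: (P * W^`() * W) + P * W^`()), k.+2.
  by apply/funext => x; rewrite derive1E; have [_ ->] := bumpf_derive P k x.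
- move=> x; rewrite /bumpf; case: ifP => // /andP[x0 x1].
  rewrite hornerC mul1r expr1 WE mulr_ge0 ?expR_ge0// invr_ge0 mulr_ge0 ?ltW//.
  by rewrite subr_gt0.
- by move=> x; rewrite /bumpf => /negbTE ->.
- move=> x x01; rewrite /bumpf x01; case/andP : x01 => x0 x1.
  rewrite hornerC mul1r expr1 WE mulr_gt0 ?expR_gt0// invr_gt0 mulr_gt0 ?ltW//.
  by rewrite subr_gt0.
Qed.

End bump.

Section smooth_step.
Variable R : realType.
Implicit Types f g : R -> R.

Lemma is_derive_affine f (df : R) (c k b x : R) :
  is_derive (k * x + b) (1 : R) f df ->
  is_derive x (1 : R) (fun t => c * f (k * t + b)) (c * k * df).
Proof.
move=> dfx.
have d1 : is_derive x (1 : R) (fun t : R => k * t + b) k.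
  have -> : (fun t : R => k * t + b) = horner (k *: 'X + b%:P).
    by apply/funext => t; rewrite !hornerE.
  apply: (is_derive_eq (is_derive_poly (k *: 'X + b%:P) x)).
  by rewrite derivD derivZ derivX derivC !hornerE.
have d2 : is_derive x (1 : R) (fun t => f (k * t + b)) (df * k).
  exact: (@is_derive1_comp _ f (fun t => k * t + b)).
apply: (is_derive_eq (is_deriveZ c d2)).
by rewrite /GRing.scale/=; ring.
Qed.

Lemma derive1_affine f (c k b : R) : (forall x, derivable f x 1) ->
  (fun t => c * f (k * t + b))^`()%classic =
  (fun t => c * k * f^`()%classic (k * t + b)).
Proof.
move=> df; apply/funext => x; rewrite derive1E.
have [_ ->//] : is_derive x (1 : R) (fun t => c * f (k * t + b))
    (c * k * f^`()%classic (k * x + b)).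
by apply: is_derive_affine; apply: DeriveDef => //; rewrite derive1E.
Qed.

Lemma smooth1_affine f (c k b : R) : smooth1 f ->
  smooth1 (fun t => c * f (k * t + b)).
Proof.
move=> sf; apply: (smooth1_coind (C := fun g => exists h c, smooth1 h /\
  g = fun t => c * h (k * t + b))); last by exists f, c.
move=> _ [h [{}c [sh ->]]]; split.
  move=> x.
  have [//] : is_derive x (1 : R) (fun t => c * h (k * t + b))
    (c * k * h^`()%classic (k * x + b)).
  apply: is_derive_affine; apply: DeriveDef; last by rewrite derive1E.
  exact: smooth1_derivable.
exists h^`()%classic, (c * k); split; first exact: smooth1_derive.
by apply: derive1_affine => x; exact: smooth1_derivable.
Qed.

Lemma derive1D_smooth1 f g : smooth1 f -> smooth1 g ->
  (fun t => f t + g t)^`()%classic = (fun t => f^`()%classic t + g^`()%classic t).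
Proof.
move=> sf sg; apply/funext => x; rewrite !derive1E.
by rewrite -deriveD//; exact: smooth1_derivable.
Qed.

Lemma smooth1D f g : smooth1 f -> smooth1 g -> smooth1 (fun t => f t + g t).
Proof.
move=> sf sg; apply: (smooth1_coind (C := fun h => exists f g,
  [/\ smooth1 f, smooth1 g & h = fun t => f t + g t])); last by exists f, g.
move=> _ [{sf}f [{sg}g [sf sg ->]]]; split.
  by move=> x; apply: derivableD; exact: smooth1_derivable.
exists f^`()%classic, g^`()%classic; split; [exact: smooth1_derive..|].
exact: derive1D_smooth1.
Qed.

Lemma smooth1_primitive f g : smooth1 f ->
  (forall x : R, is_derive x (1 : R) g (f x)) -> smooth1 g.
Proof.
move=> sf dg; apply: (smooth1_coind (C := fun h => h = g \/ smooth1 h)).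
  move=> h [->|sh]; split.
  - by move=> x; have [] := dg x.
  - right; rewrite (_ : g^`()%classic = f)//.
    by apply/funext => x; rewrite derive1E; have [_ ->] := dg x.
  - by move=> x; exact: smooth1_derivable.
  - by right; exact: smooth1_derive.
by left.
Qed.

Lemma derive0_constant f (a b : R) : a <= b ->
  (forall x, a < x < b -> is_derive x (1 : R) f 0) -> continuous f -> f a = f b.
Proof.
move=> ab df cf.
have df0 (x : R) : x \in `]a, b[ -> is_derive x (1 : R) f (cst 0 x).
  by rewrite in_itv/=; exact: df.
have [c _ /eqP] := MVT_segment ab df0 (continuous_subspaceT cf).
by rewrite mul0r subr_eq0 => /eqP.
Qed.

(** [S] is the primitive of the bump, divided by its total mass. The two are produced together
    because averages against products of [th] are later compared by integration by parts, where
    differences of [S] serve as test functions. *)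
Lemma smooth_step_exists : exists th S : R -> R,
  [/\ smooth1 th, forall x, 0 <= th x,
      forall x : R, ~~ (0 < x < 1) -> th x = 0 &
      forall x : R, 0 < x < 1 -> 0 < th x] /\
  [/\ smooth1 S, S^`()%classic = th, forall x : R, x <= 0 -> S x = 0,
      forall x : R, 1 <= x -> S x = 1 & forall x : R, 0 <= S x <= 1].
Proof.
have [th [sth th0 thz thp]] := bump_exists R.
have cth := smooth1_continuous sth.
have ith : lebesgue_measure.-integrable setT (EFin \o th).
  have : lebesgue_measure.-integrable `[0%R, 1%R]%classic (EFin \o th).
    apply: continuous_compact_integrable; first exact: segment_compact.
    exact: continuous_subspaceT.
  have m01 : measurable (`[0%R, 1%R]%classic : set (measurableTypeR R)).
    exact: measurable_itv.
  rewrite (integrable_mkcond _ m01); apply: eq_integrable => //.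
  move=> x _; rewrite patchE; case: ifPn => // /negP x01 /=.
  rewrite thz//; apply/negP => /andP[x0 x1]; apply: x01.
  by rewrite inE/= in_itv/= !ltW.
pose F x := (\int[lebesgue_measure]_(t in `]-oo, x]) th t)%R.
have dF x : is_derive x (1 : R) F (th x).
  have xx1 : x < x + 1 by rewrite ltrDl.
  have [|||dF FE] := @continuous_FTC1 R th -oo%O x (x + 1) xx1.
  - exact: (integrableS measurableT).
  - by rewrite ltNyr.
  - exact: cth.
  by apply: DeriveDef => //; rewrite -derive1E.
have cF : continuous F.
  move=> x; apply: differentiable_continuous; apply/derivable1_diffP.
  by have [] := dF x.
have F0 x : x <= 0 -> F x = 0.
  move=> x0; rewrite /F; transitivity (\int[lebesgue_measure]_(t in `]-oo, x]) (0 : R))%R.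
    apply: eq_Rintegral => t; rewrite inE/= in_itv/= => tx.
    by rewrite thz// negb_and -!leNgt (le_trans tx).
  by rewrite /Rintegral integral0.
have F1 x : 1 <= x -> F x = F 1.
  move=> x1; apply/esym; apply: derive0_constant => // y /andP[y1 yx].
  by rewrite -(thz y)// negb_and -!leNgt (ltW y1) orbT.
have Fnd x y : x <= y -> F x <= F y.
  move=> xy.
  have [c _ E] := MVT_segment xy (fun z _ => dF z) (continuous_subspaceT cF).
  by rewrite -subr_ge0 E mulr_ge0// subr_ge0.
(* The mean value theorem on [[1/4, 1/2]], well inside the interval where the bump is positive,
   gives a strict increase there. *)
have F1p : 0 < F 1.
  have le42 : 1 / 4 <= 1 / 2 :> R by lra.
  have [c] := MVT_segment le42 (fun z _ => dF z) (continuous_subspaceT cF).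
  rewrite in_itv/= => /andP[c1 c2] E.
  have : 0 < F (1/2) - F (1/4) by rewrite E mulr_gt0// ?thp//; lra.
  have : F 0 <= F (1/4) by apply: Fnd; lra.
  have : F (1/2) <= F 1 by apply: Fnd; lra.
  rewrite (F0 0 (lexx 0)); lra.
have aff f : (fun t => (F 1)^-1 * f (1 * t + 0)) = fun t => (F 1)^-1 * f t.
  by apply/funext => t; rewrite mul1r addr0.
have sth' : smooth1 (fun t => (F 1)^-1 * th t).
  by rewrite -aff; exact: smooth1_affine.
have dF' (x : R) : is_derive x (1 : R) (fun t => (F 1)^-1 * F t) ((F 1)^-1 * th x).
  rewrite -aff -[X in X * th x]mulr1; apply: is_derive_affine.
  by rewrite mul1r addr0.
exists (fun t => (F 1)^-1 * th t), (fun t => (F 1)^-1 * F t); split; split.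
- exact: sth'.
- by move=> x; rewrite mulr_ge0// invr_ge0 ltW.
- by move=> x x01; rewrite thz// mulr0.
- by move=> x x01; rewrite mulr_gt0// ?thp// invr_gt0.
- exact: smooth1_primitive dF'.
- by apply/funext => x; rewrite derive1E; have [_ ->] := dF' x.
- by move=> x x0; rewrite (F0 x x0) mulr0.
- by move=> x x1; rewrite (F1 x x1) mulVf// gt_eqF.
- move=> x; rewrite mulrC ler_pdivrMr// mul1r; apply/andP; split.
    rewrite mulr_ge0// ?invr_ge0 ?(ltW F1p)//.
    by have [/F0->//|/ltW x0] := leP x 0; rewrite -(F0 0)// Fnd.
  by have [/F1->//|/ltW x1] := leP 1 x; rewrite Fnd.
Qed.

End smooth_step.

Lemma bounded_setP (R : realType) (V : normedModType R) (A : set V) :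
  bounded_set A <-> exists L : R, forall x, A x -> `|x| <= L.
Proof.
split=> [/pinfty_ex_gt0[L _ AL]|[L AL]]; first by exists L.
exists L; split=> [|M LM x Ax]; first exact: num_real.
exact: le_trans (AL _ Ax) (ltW LM).
Qed.

(** * Directional derivatives and product test functions *)

Section directional_derivative.
Variables (R : realType) (n : nat).
Implicit Types (f : 'rV[R]_n -> R) (x v : 'rV[R]_n).

Lemma is_derive_lineP f x v (t d : R) :
  is_derive t (1 : R) (fun h : R => f (h *: v + x)) d <->
  is_derive (t *: v + x) v f d.
Proof.
have E : (fun h : R => h^-1 *: (((fun h : R => f (h *: v + x)) \o shift t)
      (h *: (1 : R)) - f (t *: v + x))) =
    (fun h : R => h^-1 *: ((f \o shift (t *: v + x)) (h *: v) - f (t *: v + x))).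
  by apply/funext => h /=; rewrite [_ *: 1]mulr1 scalerDl addrA.
split=> -[dv de]; apply: DeriveDef.
- by move: dv; rewrite /derivable E.
- by move: de; rewrite /derive E.
- by rewrite /derivable E.
- by rewrite /derive E.
Qed.

Lemma is_derive_line0 f x v (d : R) :
  is_derive (0 : R) (1 : R) (fun h : R => f (h *: v + x)) d ->
  is_derive x v f d.
Proof. by move/is_derive_lineP; rewrite scale0r add0r. Qed.

End directional_derivative.

Section test_functions.
Variables (R : realType) (n : nat).
Implicit Types (f : 'rV[R]_n -> R) (x v : 'rV[R]_n) (A : set 'rV[R]_n).

Lemma closed_normball (L : R) : closed [set x : 'rV[R]_n | `|x| <= L].
Proof.
rewrite (_ : mkset _ = (fun x : 'rV[R]_n => `|x|) @^-1` `]-oo, L]%classic).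
  apply: (@preimage_closed _ _ (fun x : 'rV[R]_n => `|x|)).
    by move=> x _; exact: norm_continuous.
  exact: interval_closed.
by apply/seteqP; split => x /=; rewrite in_itv.
Qed.

Lemma compact_normball (L : R) : compact [set x : 'rV[R]_n | `|x| <= L].
Proof.
by apply: bounded_closed_compact; [apply/bounded_setP; exists L|exact: closed_normball].
Qed.

Lemma compact_supportP f :
  compact (closure [set x | f x != 0]) <->
  exists L : R, forall x, L < `|x| -> f x = 0.
Proof.
split=> [/compact_bounded/bounded_setP[L fL]|[L fL]].
  exists L => x Lx; apply/eqP; apply: contraTT Lx => fx0.
  by rewrite -leNgt; apply: fL; exact: subset_closure.
apply: (@subclosed_compact _ _ [set x | `|x| <= L]).
- exact: closed_closure.
- exact: compact_normball.
rewrite closureE; apply: smallest_sub; first exact: closed_normball.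
move=> x /= fx0; rewrite leNgt; apply/negP => /fL fx.
by rewrite fx eqxx in fx0.
Qed.

Lemma test_function_partial f i :
  test_function f -> test_function (partial i f).
Proof.
move=> [sf /compact_supportP[L fL]]; split.
  by move=> s; have := sf (rcons s i); rewrite foldr_rcons.
apply/compact_supportP; exists L => x Lx.
have : is_derive x (delta_mx 0 i) f 0.
  apply: (@near_eq_is_derive _ _ _ (cst 0)).
  apply/nbhs_ballP; exists (`|x| - L) => /=; first by rewrite subr_gt0.
  move=> y; rewrite mx_norm_ball /ball_/= => xy; apply/esym/fL.
  have := lerB_dist x y; lra.
by case.
Qed.

Lemma test_function_bounded f : test_function f ->
  exists M L : R, [/\ 0 <= M, forall x, `|f x| <= M &
    forall x, L < `|x| -> f x = 0].
Proof.
move=> [/(_ [::])[/= cf _] cK].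
have /compact_supportP[L fL] := cK.
have : compact (f @` [set x | `|x| <= L]).
  apply: continuous_compact; first exact: continuous_subspaceT.
  exact: compact_normball.
move=> /compact_bounded/bounded_setP[M HM].
exists (Num.max 0 M), L; split=> [|x|//]; first by rewrite le_max lexx.
have [xL|/fL ->] := leP `|x| L; last by rewrite normr0 le_max lexx.
rewrite le_max; apply/orP; right.
by apply: (HM (f x)); exists x.
Qed.

Definition tensor (phi : 'I_n -> R -> R) x := \prod_(i < n) phi i (x 0 i).

Lemma tensor_continuous (phi : 'I_n -> R -> R) : (forall i, continuous (phi i)) ->
  continuous (tensor phi).
Proof.
move=> cphi; rewrite /tensor.
elim: (index_enum _) => [|j s ih].
  have -> : (fun x : 'rV[R]_n => \prod_(i <- [::]) phi i (x 0 i)) = cst 1.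
    by apply/funext => x; rewrite big_nil.
  exact: cst_continuous.
have -> : (fun x : 'rV[R]_n => \prod_(i <- j :: s) phi i (x 0 i)) =
    (fun x : 'rV[R]_n => phi j (x 0 j) * \prod_(i <- s) phi i (x 0 i)).
  by apply/funext => x; rewrite big_cons.
move=> x; apply: (@continuousM _ _ (fun x : 'rV[R]_n => phi j (x 0 j))).
  apply: (@continuous_comp _ _ _ (fun x : 'rV[R]_n => x 0 j)).
    exact: coord_continuous.
  exact: cphi.
exact: ih.
Qed.

Lemma is_derive_tensor phi j x : (forall i, smooth1 (phi i)) ->
  is_derive x (delta_mx 0 j) (tensor phi)
    (tensor (fun i => if i == j then (phi i)^`()%classic else phi i) x).
Proof.
move=> sphi; apply: is_derive_line0.
pose c := \prod_(i < n | i != j) phi i (x 0 i).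
have -> : (fun h : R => tensor phi (h *: delta_mx 0 j + x)) =
    (fun h => c * phi j (1 * h + x 0 j)).
  apply/funext => h; rewrite /tensor (bigD1 j)//= mulrC; congr (_ * _).
    by apply: eq_bigr => i ij; rewrite !mxE (negbTE ij) mulr0 add0r.
  by rewrite !mxE !eqxx mulr1 mul1r.
rewrite [X in is_derive _ _ _ X](_ : _ = c * 1 * (phi j)^`()%classic (x 0 j)).
  apply: is_derive_affine; rewrite mulr0 add0r.
  by apply: DeriveDef; [exact: smooth1_derivable|rewrite derive1E].
rewrite /tensor (bigD1 j)//= eqxx mulr1 mulrC; congr (_ * _).
by apply: eq_bigr => i ij; rewrite (negbTE ij).
Qed.

Lemma partial_tensor phi j : (forall i, smooth1 (phi i)) ->
  partial j (tensor phi) =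
  tensor (fun i => if i == j then (phi i)^`()%classic else phi i).
Proof.
move=> sphi; apply/funext => x.
by have [_ E] := is_derive_tensor j x sphi; rewrite -E.
Qed.

(** A partial derivative of a product of one-variable functions is again such a product, so all
    iterated partials have the same form. *)
Lemma smooth_tensor phi : (forall i, smooth1 (phi i)) -> smooth (tensor phi).
Proof.
move=> sphi s.
have [psi [spsi ->]] : exists psi, (forall i, smooth1 (psi i)) /\
    foldr (@partial R n) (tensor phi) s = tensor psi.
  elim: s => [|j s [psi [spsi E]]]; first by exists phi.
  exists (fun i => if i == j then (psi i)^`()%classic else psi i).
  rewrite /= E partial_tensor//; split=> // i.
  by case: ifP => _ //; exact: smooth1_derive.
split; first by apply: tensor_continuous => i; exact: smooth1_continuous.
move=> i; split; first by move=> x; have [] := is_derive_tensor i x spsi.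
rewrite partial_tensor//; apply: tensor_continuous => j.
by case: ifP => _; apply: smooth1_continuous => //; exact: smooth1_derive.
Qed.

Lemma test_function_tensor phi (L : R) : (forall i, smooth1 (phi i)) ->
  (forall i t, L < `|t| -> phi i t = 0) -> (0 < n)%N ->
  test_function (tensor phi).
Proof.
move=> sphi phiL n0; split; first exact: smooth_tensor.
(* The maximum with [0] makes [x] nonzero, so that its max-norm is realised by a coordinate, whose
   factor vanishes. *)
apply/compact_supportP; exists (Num.max L 0) => x; rewrite gt_max => /andP[Lx x0].
have : mx_norm x != 0 by rewrite gt_eqF.
move=> /mx_norm_neq0[[i j]/= xE]; rewrite (ord1 i) in xE.
by rewrite /tensor (bigD1 j)//= phiL ?mul0r// -xE.
Qed.

End test_functions.

(** * Local integrability and linearity of weak gradients *)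

Section local_integrability.
Variables (R : realType) (n : nat).
Local Notation mu := (lebesgue_rV R n).
Implicit Types (f g u v : 'rV[R]_n -> R) (G H : 'rV[R]_n -> 'rV[R]_n) (L M : R).

Definition normball (L : R) := [set x : 'rV[R]_n | `|x| <= L].

Lemma measurable_normball L : measurable (normball L).
Proof. by apply: closed_measurable_rV; exact: closed_normball. Qed.

Lemma compact_measurable_rV (K : set 'rV[R]_n) : compact K -> measurable K.
Proof.
by move=> cK; apply: closed_measurable_rV; apply: compact_closed => //; exact: norm_hausdorff.
Qed.

Lemma normball_lty L : (mu (normball L) < +oo)%E.
Proof.
apply: le_lt_trans (lebesgue_rV_cube_lty n (- L) L).
apply: le_measure; rewrite ?inE//.
- exact: measurable_normball.
- exact: (measurable_box_rV (A := fun=> `[(- L)%R, L]%classic)).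
move=> x xL i /=; rewrite in_itv/= -ler_norml.
exact: le_trans (norm_coord_le _ _) xL.
Qed.

Lemma compact_lty (K : set 'rV[R]_n) : compact K -> (mu K < +oo)%E.
Proof.
move=> cK; have /compact_bounded/bounded_setP[L KL] := cK.
apply: le_lt_trans (normball_lty L); apply: le_measure; rewrite ?inE//.
  exact: compact_measurable_rV.
exact: measurable_normball.
Qed.

Lemma loc_integrableP g : loc_integrable g <-> measurable_fun setT g /\
  forall K, compact K -> mu.-integrable K (EFin \o g).
Proof.
split=> -[mg gK]; split=> // K cK.
  apply/integrableP; split; last exact: gK.
  apply/measurable_EFinP; exact: measurable_funS mg.
by have /integrableP[] := gK K cK.
Qed.

Lemma loc_integrable_continuous u : continuous u -> loc_integrable u.
Proof.
move=> cu; apply/loc_integrableP; split=> [|K cK].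
  exact: continuous_measurable_rV.
have mK := compact_measurable_rV cK.
have : compact (u @` K).
  by apply: continuous_compact => //; exact: continuous_subspaceT.
move=> /compact_bounded/bounded_setP[M uM].
apply: measurable_bounded_integrable => //.
- exact: compact_lty.
- apply: measurable_funS (continuous_measurable_rV cu) => //.
- exists M; split=> [|N MN x Kx]; first exact: num_real.
  by apply: le_trans (ltW MN); apply: uM; exists x.
Qed.

Lemma integrable_mul_compact_support g f M L : loc_integrable g ->
  measurable_fun setT f -> (forall x, `|f x| <= M) ->
  (forall x, L < `|x| -> f x = 0) ->
  mu.-integrable setT (fun x => (g x * f x)%:E).
Proof.
move=> /loc_integrableP[mg gK] mf fM fL.
have := gK _ (@compact_normball R n L).
have mK := measurable_normball L.
move=> /(integrableZl mK M); rewrite (integrable_mkcond _ mK).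
apply: le_integrable => //.
  by apply/measurable_EFinP; exact: measurable_funM.
move=> x _; rewrite patchE; case: ifPn => xL.
  change (`|g x * f x|%:E <= `|M * g x|%:E)%E.
  rewrite lee_fin !normrM mulrC; apply: ler_wpM2r => //.
  exact: le_trans (fM x) (ler_norm _).
rewrite fL ?mulr0 ?abse0 ?abse_ge0//.
by rewrite ltNge; apply: contra xL => xL; rewrite inE.
Qed.

Lemma integrable_mul_test g f : loc_integrable g -> test_function f ->
  mu.-integrable setT (fun x => (g x * f x)%:E).
Proof.
move=> lg tf; have [M [L [_ fM fL]]] := test_function_bounded tf.
apply: integrable_mul_compact_support fM fL => //.
by apply: continuous_measurable_rV; have [/(_ [::])[]] := tf.
Qed.

Lemma loc_integrable_lin a b g f : loc_integrable g -> loc_integrable f ->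
  loc_integrable (fun x => a * g x + b * f x).
Proof.
move=> /loc_integrableP[mg gK] /loc_integrableP[mf fK].
apply/loc_integrableP; split=> [|K cK].
  by apply: measurable_funD; exact: measurable_funM.
have mK := compact_measurable_rV cK.
have := integrableD mK (integrableZl mK a (gK _ cK)) (integrableZl mK b (fK _ cK)).
by apply: eq_integrable => // x _ /=; rewrite EFinD !EFinM.
Qed.

Lemma weak_partial_lin a b u v i g h : loc_integrable u -> loc_integrable v ->
  weak_partial u i g -> weak_partial v i h ->
  weak_partial (fun x => a * u x + b * v x) i (fun x => a * g x + b * h x).
Proof.
move=> lu lv [lg ug] [lh vh]; split; first exact: loc_integrable_lin.
have lin (u1 v1 f1 : 'rV[R]_n -> R) :
    mu.-integrable setT (fun x => (u1 x * f1 x)%:E) ->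
    mu.-integrable setT (fun x => (v1 x * f1 x)%:E) ->
    (\int[mu]_x ((a * u1 x + b * v1 x) * f1 x)%:E =
     a%:E * \int[mu]_x (u1 x * f1 x)%:E + b%:E * \int[mu]_x (v1 x * f1 x)%:E)%E.
  move=> iu iv; rewrite -!integralZl// -integralD//; last 2 first.
    exact: integrableZl.
    exact: integrableZl.
  by apply: eq_integral => x _; rewrite -!EFinM -EFinD; congr EFin; ring.
move=> f tf; have tf' := test_function_partial i tf.
rewrite (lin u v _ (integrable_mul_test lu tf') (integrable_mul_test lv tf')).
rewrite (lin g h _ (integrable_mul_test lg tf) (integrable_mul_test lh tf)).
rewrite ug// vh//.
have := integrable_fin_num measurableT (integrable_mul_test lg tf).
have := integrable_fin_num measurableT (integrable_mul_test lh tf).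
move: (integral _ _ _) (integral _ _ _) => [y| |]// [x| |]// _ _.
change ((a * - y + b * - x)%:E = (- (a * y + b * x))%:E).
by congr EFin; ring.
Qed.

Lemma weak_gradient_lin a b u v G H : continuous u -> continuous v ->
  weak_gradient u G -> weak_gradient v H ->
  weak_gradient (fun x => a * u x + b * v x) (fun x => a *: G x + b *: H x).
Proof.
move=> cu cv uG vH i.
rewrite [X in weak_partial _ _ X](_ : _ = (fun x => a * G x 0 i + b * H x 0 i)); last first.
  by apply/funext => x; rewrite !mxE.
by apply: weak_partial_lin => //; exact: loc_integrable_continuous.
Qed.

Lemma measurable_weak_gradient u G : weak_gradient u G ->
  measurable_fun setT G.
Proof. by move=> uG; apply: measurable_fun_rV => i; have [[]] := uG i. Qed.

End local_integrability.

(** * Energy *)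

Section powR_inequalities.
Variable R : realType.
Implicit Types a b p q t : R.

(** For [c] equal to [a] or [b] the ratio [c/(a+b)] is at most [1], so its [q]-th power is at most
    itself; the two ratios add up to [1]. *)
Lemma powR_superadditive a b q : 0 <= a -> 0 <= b -> 1 <= q ->
  a `^ q + b `^ q <= (a + b) `^ q.
Proof.
move=> a0 b0 q1.
have q0 : q != 0 by lra.
have [s0|s0] := eqVneq (a + b) 0.
  have [-> ->] : a = 0 /\ b = 0 by lra.
  by rewrite addr0 powR0// addr0.
have sp : 0 < a + b by rewrite lt_def s0 addr_ge0.
have H c : 0 <= c -> c <= a + b -> c `^ q <= (a + b) `^ q * (c / (a + b)).
  move=> c0 cs; rewrite -{1}(divfK s0 c) powRM ?divr_ge0// ?(ltW sp)// mulrC.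
  apply: ler_wpM2l; first exact: powR_ge0.
  have [->|cn0] := eqVneq c 0; first by rewrite mul0r powR0.
  apply: ge1r_powR => //.
  have cp : 0 < c by rewrite lt_def cn0.
  by rewrite divr_gt0//= ler_pdivrMr// mul1r.
apply: (le_trans (lerD (H a a0 _) (H b b0 _))); rewrite ?lerDl ?lerDr//.
by rewrite -mulrDr -mulrDl divff// mulr1.
Qed.

Lemma powR_midpoint a b q : 0 <= a -> 0 <= b -> 1 <= q ->
  (2^-1 * (a + b)) `^ q <= 2^-1 * (a `^ q + b `^ q).
Proof.
move=> a0 b0 q1.
rewrite !mulrDr {2 4}(_ : 2^-1 = 1 - 2^-1); last by field.
by apply: (convex_powR q1 (Itv01 _ _)) => //=;
  rewrite ?inE/= ?in_itv/= ?a0 ?b0// ?invr_ge0// invf_le1 ?ler1n.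
Qed.

(** If [a > t] then [t^(1-p) a^p = a (a/t)^(p-1) >= a]. This takes the place of Hoelder's
    inequality: the free parameter [t] makes the first term small whatever the energy. *)
Lemma le_powR_young a p t : 0 <= a -> 1 <= p -> 0 < t ->
  a <= t + t `^ (1 - p) * a `^ p.
Proof.
move=> a0 p1 t0.
have [at1|ta] := leP a t.
  by apply: le_trans at1 _; rewrite lerDl mulr_ge0 ?powR_ge0.
apply: ler_wpDl; first exact: ltW.
have ap : 0 < a by exact: lt_trans ta.
rewrite -{1}(powRr1 a0) -{1}(subrK p 1) powRD; last by rewrite (gt_eqF ap) implybT.
apply: ler_wpM2r; first exact: powR_ge0.
rewrite -opprB !powRN lef_pV2 ?posrE ?powR_gt0//.
by apply: ge0_ler_powR; rewrite ?nnegrE ?subr_ge0//; exact: ltW.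
Qed.

End powR_inequalities.

Section energy.
Variables (R : realType) (n : nat).
Local Notation mu := (lebesgue_rV R n).
Implicit Types (f : 'rV[R]_n -> R) (G H : 'rV[R]_n -> 'rV[R]_n) (p : R).

(** With [q = p/2 >= 1] applied to squared norms: superadditivity of the [q]-th power, the
    parallelogram identity, and convexity. *)
Lemma clarkson_pointwise p (a b : 'rV[R]_n) : 2 <= p ->
  enorm (2^-1 *: (a + b)) `^ p + enorm (2^-1 *: (a - b)) `^ p <=
  2^-1 * (enorm a `^ p + enorm b `^ p).
Proof.
move=> p2.
have E (x : 'rV[R]_n) : enorm x `^ p = (enorm x ^+ 2) `^ (p / 2).
  rewrite -powR_mulrn ?enorm_ge0// -powRrM; congr (_ `^ _).
  by rewrite mulrC divfK.
have q1 : 1 <= p / 2 by rewrite ler_pdivlMr// mul1r.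
rewrite !E; apply: le_trans (powR_superadditive _ _ q1) _; rewrite ?sqr_ge0//.
apply: le_trans _ (powR_midpoint _ _ q1); rewrite ?sqr_ge0//.
rewrite -!dotvv !(dotvZl, dotvZr, dotvDl, dotvDr, dotvNl, dotvNr) (dotvC b a).
by rewrite le_eqVlt; apply/orP; left; apply/eqP; congr (_ `^ _); field.
Qed.

(** Attached to a vector field and not to [u], so that limits of gradients have an energy before
    they are known to be gradients. *)
Definition energy p G : \bar R := (\int[mu]_x (enorm (G x) `^ p)%:E)%E.

Lemma measurable_energy p G : measurable_fun setT G ->
  measurable_fun setT (fun x => (enorm (G x) `^ p)%:E).
Proof.
move=> mG; apply/measurable_EFinP.
apply: (measurableT_comp (measurable_powR p)).
exact: measurableT_comp (@measurable_enorm R n) mG.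
Qed.

Lemma energy_ge0 p G : (0 <= energy p G)%E.
Proof. by apply: integral_ge0 => x _; rewrite lee_fin powR_ge0. Qed.

Lemma measurable_lin a b G H : measurable_fun setT G -> measurable_fun setT H ->
  measurable_fun setT (fun x => a *: G x + b *: H x).
Proof.
move=> mG mH; apply: measurable_fun_rV => i.
under eq_fun do rewrite !mxE.
by apply: measurable_funD; apply: measurable_funM => //;
  exact: (measurableT_comp (measurable_coord i)).
Qed.

Lemma energyZ p a G : measurable_fun setT G ->
  energy p (fun x => a *: G x) = ((`|a| `^ p)%:E * energy p G)%E.
Proof.
move=> mG; rewrite /energy -ge0_integralZl//.
- by apply: eq_integral => x _; rewrite enormZ powRM// ?enorm_ge0.
- exact: measurable_energy.
- by move=> x _; rewrite lee_fin powR_ge0.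
Qed.

Lemma energyD p G H : measurable_fun setT G -> measurable_fun setT H ->
  (energy p G + energy p H =
   \int[mu]_x (enorm (G x) `^ p + enorm (H x) `^ p)%:E)%E.
Proof.
move=> mG mH; under [RHS]eq_integral do rewrite EFinD.
apply/esym/ge0_integralD => //.
- by move=> x _; rewrite lee_fin powR_ge0.
- exact: measurable_energy.
- by move=> x _; rewrite lee_fin powR_ge0.
- exact: measurable_energy.
Qed.

Lemma clarkson p G H : 2 <= p -> measurable_fun setT G -> measurable_fun setT H ->
  (energy p (fun x => 2^-1 *: G x + 2^-1 *: H x)%R +
   energy p (fun x => 2^-1 *: G x + (- 2^-1) *: H x)%R <=
   2^-1%:E * (energy p G + energy p H))%E.
Proof.
move=> p2 mG mH.
have mE (K : 'rV[R]_n -> 'rV[R]_n) : measurable_fun setT K ->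
    measurable_fun setT (fun x => enorm (K x) `^ p).
  by move=> /(measurable_energy p)/measurable_EFinP.
have mK1 := measurable_lin 2^-1 2^-1 mG mH.
have mK2 := measurable_lin 2^-1 (- 2^-1) mG mH.
rewrite [leLHS](energyD p mK1 mK2) [X in (_ <= _ * X)%E](energyD p mG mH).
have e0 (K1 K2 : 'rV[R]_n -> 'rV[R]_n) x :
    0 <= enorm (K1 x) `^ p + enorm (K2 x) `^ p.
  by rewrite addr_ge0// powR_ge0.
rewrite -ge0_integralZl//; last 2 first.
- by apply/measurable_EFinP; apply: measurable_funD; exact: mE.
- by move=> x _; rewrite lee_fin.
apply: ge0_le_integral => //.
- by move=> x _; rewrite lee_fin (e0 (fun x => _) (fun x => _)).
- by apply/measurable_EFinP; apply: measurable_funD;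
    apply: mE; exact: measurable_lin.
- apply/measurable_EFinP; apply: measurable_funM => //.
  by apply: measurable_funD; exact: mE.
move=> x _; rewrite -EFinM lee_fin.
have := clarkson_pointwise (G x) (H x) p2.
by rewrite !scalerDr scalerN -scaleNr.
Qed.

Lemma eq_energy p G H : {ae mu, forall x, G x = H x} ->
  measurable_fun setT G -> measurable_fun setT H -> energy p G = energy p H.
Proof.
move=> GH mG mH; apply: ge0_ae_eq_integral => //.
- exact: measurable_energy.
- exact: measurable_energy.
- by move=> x _; rewrite lee_fin powR_ge0.
- by move=> x _; rewrite lee_fin powR_ge0.
- by apply: filterS GH => x GHx _; rewrite GHx.
Qed.

(** Young's inequality [le_powR_young] is integrated over the ball that carries [f]. The bound is
    small once [t] is small and then the energy is small in terms of [t]. *)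
Lemma integral_energy_bound p G f i (M L t e : R) : 1 <= p -> 0 < t -> 0 <= M ->
  measurable_fun setT G -> measurable_fun setT f -> (forall x, `|f x| <= M) ->
  (forall x, L < `|x| -> f x = 0) -> (energy p G <= e%:E)%E ->
  (\int[mu]_x `|(G x 0 i * f x)%R|%:E <=
   (M * (t * fine (mu (@normball R n L)) + t `^ (1 - p) * e))%:E)%E.
Proof.
move=> p1 t0 M0 mG mf fM fL Ge.
have mK := @measurable_normball R n L.
have mGi : measurable_fun setT (fun x => G x 0 i).
  exact: (measurableT_comp (measurable_coord i)).
have mE := measurable_energy p mG.
have t1 : 0 <= t `^ (1 - p) by exact: powR_ge0.
pose F (x : 'rV[R]_n) : \bar R := ((M * t)%:E * (\1_(normball L) x)%:E +
  (M * t `^ (1 - p))%:E * (enorm (G x) `^ p)%:E)%E.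
have F1 : measurable_fun setT (fun x => ((M * t)%:E * (\1_(@normball R n L) x)%:E)%E).
  by apply/measurable_EFinP; apply: measurable_funM => //; exact: measurable_indic.
have F2 : measurable_fun setT
    (fun x => ((M * t `^ (1 - p))%:E * (enorm (G x) `^ p)%:E)%E).
  exact: emeasurable_funM.
have F10 x : (0 <= ((M * t)%:E * (\1_(@normball R n L) x)%:E))%E.
  by rewrite mule_ge0// lee_fin// mulr_ge0// ltW.
have F20 x : (0 <= ((M * t `^ (1 - p))%:E * (enorm (G x) `^ p)%:E))%E.
  by rewrite mule_ge0// lee_fin// ?mulr_ge0// powR_ge0.
apply: (@le_trans _ _ (\int[mu]_x F x)%E).
  apply: ge0_le_integral => //.
  - apply/measurable_EFinP; apply: measurableT_comp => //.
    exact: measurable_funM.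
  - exact: emeasurable_funD.
  move=> x _; rewrite /F -!EFinM -EFinD lee_fin.
  have [xL|Lx] := leP `|x| L.
    rewrite indicE mem_set// mulr1 -mulrA -mulrDr normrM mulrC.
    apply: ler_pM => //.
    apply: le_trans (norm_coord_le_enorm _ _) _.
    by apply: le_powR_young => //; exact: enorm_ge0.
  by rewrite fL// mulr0 normr0 addr_ge0// ?mulr_ge0 ?powR_ge0// ltW.
rewrite /F ge0_integralD// ge0_integralZl//; last 2 first.
- by apply/measurable_EFinP; exact: measurable_indic.
- by rewrite lee_fin mulr_ge0// ltW.
rewrite ge0_integralZl//; last 2 first.
- by move=> x _; rewrite lee_fin powR_ge0.
- by rewrite lee_fin mulr_ge0.
rewrite integral_indic// setIT.
have KE : mu (@normball R n L) = (fine (mu (@normball R n L)))%:E.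
  by rewrite fineK// ge0_fin_numE// normball_lty.
rewrite mulrDr EFinD !mulrA; apply: leeD.
  by rewrite [leRHS]EFinM -KE.
rewrite [leRHS]EFinM; apply: lee_wpmul2l => //.
by rewrite lee_fin mulr_ge0.
Qed.

End energy.

(** * Weak gradients under affine maps *)

Section strict_differentiability.
Variables (R : realType) (n : nat).
Implicit Types (f : 'rV[R]_n -> R) (x y a v : 'rV[R]_n).

Lemma MVT_coord f k x (h : R) :
  (forall z, derivable f z (delta_mx 0 k)) ->
  exists2 t : R, Num.min 0 h <= t <= Num.max 0 h &
    f (h *: delta_mx 0 k + x) - f x = h * partial k f (t *: delta_mx 0 k + x).
Proof.
move=> df.
pose g (t : R) := f (t *: delta_mx 0 k + x).
have dg (t : R) : is_derive t (1 : R) g (partial k f (t *: delta_mx 0 k + x)).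
  by apply/is_derive_lineP; apply: DeriveDef.
have cg : continuous g.
  move=> t; apply: differentiable_continuous; apply/derivable1_diffP.
  by have [] := dg t.
have g0 : g 0 = f x by rewrite /g scale0r add0r.
have [h0|/ltW h0] := leP 0 h.
  have [t] := MVT_segment h0 (fun z _ => dg z) (continuous_subspaceT cg).
  rewrite in_itv/= => t0h E; exists t => //.
  by rewrite -g0 E subr0 mulrC.
have [t] := MVT_segment h0 (fun z _ => dg z) (continuous_subspaceT cg).
rewrite in_itv/= => t0h E; exists t => //.
by rewrite -g0 -opprB E sub0r mulrN opprK mulrC.
Qed.

(** The increment from [y] to [x] is split into [n] steps that change one coordinate each, and the
    mean value theorem is applied to every step; the error [e/(n+1)] per step adds up to less than
    the error allowed. Both points vary, as is needed later for pairs of points near a boundary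
    point. *)
Lemma C1_strict_differentiable f a (e : R) : C1 f -> 0 < e ->
  exists2 d : R, 0 < d & forall x y, `|x - a| < d -> `|y - a| < d ->
    `|f x - f y - \sum_(j < n) partial j f a * (x 0 j - y 0 j)| <= e * `|x - y|.
Proof.
move=> [_ C1f] e0.
pose e' := e / n.+1%:R.
have e'0 : 0 < e' by rewrite divr_gt0.
have [d d0 dP] : exists2 d : R, 0 < d & forall j z, `|z - a| < d ->
    `|partial j f z - partial j f a| <= e'.
  have /choice[d dP] : forall j, exists d : R, 0 < d /\ forall z, `|z - a| < d ->
      `|partial j f z - partial j f a| <= e'.
    move=> j; have [_ /continuous_rVP/(_ a e' e'0)[d d0 dP]] := C1f j.
    by exists d; split=> // z za; rewrite distrC ltW// dP// distrC.
  exists (\big[Num.min/1]_j d j).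
    by rewrite lt_bigmin// => j _; have [] := dP j.
  move=> j z za; have [_] := dP j; apply.
  by apply: lt_le_trans za _; exact: bigmin_le_cond.
exists d => // x y xa ya.
(* All intermediate points stay within [d] of [a], because closeness in the max-norm is tested
   coordinate by coordinate. *)
pose z (k : nat) : 'rV[R]_n := \row_i if (i < k)%N then x 0 i else y 0 i.
have zn : z n = x by apply/rowP => i; rewrite mxE ltn_ord.
have z0 : z 0 = y by apply/rowP => i; rewrite mxE.
have zS (k : 'I_n) : z k.+1 = (x 0 k - y 0 k) *: delta_mx 0 k + z k.
  apply/rowP => i; rewrite !mxE/= ltnS leq_eqVlt.
  have [->|ik] := eqVneq i k; first by rewrite eqxx ltnn mulr1 subrK.
  by rewrite -val_eqE/= in ik *; rewrite (negbTE ik)/= mulr0 add0r.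
have step (k : 'I_n) :
    `|f (z k.+1) - f (z k) - partial k f a * (x 0 k - y 0 k)| <= e' * `|x - y|.
  have [t tP E] := @MVT_coord f k (z k) (x 0 k - y 0 k) (C1f k).1.
  rewrite zS E [X in X - _]mulrC -mulrBl normrM; apply: ler_pM => //; last first.
    by have := norm_coord_le (x - y) k; rewrite !mxE.
  apply: dP; rewrite [ltLHS]mx_normrE; apply: bigmax_lt => // -[i j] _ /=.
  rewrite (ord1 i) !mxE/=.
  have xj := le_lt_trans (norm_coord_le (x - a) j) xa.
  have yj := le_lt_trans (norm_coord_le (y - a) j) ya.
  rewrite !mxE in xj yj.
  have [jk|jk] := eqVneq j k.
    rewrite jk ltnn mulr1; rewrite jk in xj yj.
    move: tP xj yj; rewrite !ltr_norml ge_min le_max.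
    by move=> /andP[/orP[?|?] /orP[?|?]] /andP[? ?] /andP[? ?]; apply/andP; split; lra.
  by rewrite mulr0 add0r; case: ifP.
have -> : f x - f y = \sum_(k < n) (f (z k.+1) - f (z k)).
  by rewrite -(big_mkord xpredT (fun k => f (z k.+1) - f (z k))) telescope_sumr// zn z0.
rewrite -sumrB; apply: le_trans (ler_norm_sum _ _ _) _.
apply: (@le_trans _ _ (\sum_(k < n) e' * `|x - y|)).
  by apply: ler_sum => k _; exact: step.
rewrite sumr_const card_ord -mulr_natl mulrA ler_wpM2r// /e'.
by rewrite mulrA ler_pdivrMr// mulrC ler_wpM2l ?(ltW e0)// ler_nat.
Qed.

Lemma C1_is_derive f x v : C1 f ->
  is_derive x v f (\sum_(j < n) v 0 j * partial j f x).
Proof.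
move=> C1f; set D := \sum_(j < n) _.
suff H : (h^-1 *: ((f \o shift x) (h *: v) - f x)) @[h --> (0 : R)^'] --> D.
  apply: DeriveDef; first by apply/cvg_ex; exists D.
  by apply/cvg_lim.
apply/cvgrPdist_le => e e0.
pose V := `|v| + 1; have V0 : 0 < V by rewrite ltr_wpDl.
have eV : 0 < e / V by rewrite divr_gt0.
have [d d0 dP] := C1_strict_differentiable x C1f eV.
have dV : 0 < d / V by rewrite divr_gt0.
near=> h.
have h0 : h != 0 by near: h; exact: nbhs_dnbhs_neq.
have hp : 0 < `|h| by rewrite normr_gt0.
have hd : `|h| < d / V by near: h; exact: dnbhs0_lt.
have hvd : `|h *: v| < d.
  rewrite normrZ; apply: (@le_lt_trans _ _ (`|h| * V)).
    by rewrite ler_wpM2l// lerDl.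
  by rewrite -ltr_pdivlMr.
have := dP (h *: v + x) x.
rewrite addrK subrr normr0 => /(_ hvd d0).
rewrite (eq_bigr (fun j => h * (v 0 j * partial j f x))); last first.
  by move=> j _; rewrite !mxE; ring.
rewrite -mulr_sumr -/D => H.
rewrite distrC -(ler_pM2l hp) -normrM mulrBr.
rewrite [X in X - _](_ : _ = f (h *: v + x) - f x); last first.
  by rewrite /GRing.scale/= mulrA divff// mul1r.
apply: le_trans H _; rewrite normrZ mulrCA ler_pM2l//.
by rewrite mulrC mulrA ler_pdivrMr// mulrC ler_pM2l// lerDl.
Unshelve. all: by end_near. Qed.

End strict_differentiability.

(** This is [integral_energy_bound] with [t = 1] and [f] the indicator of a ball containing the
    compact set. *)
Lemma loc_integrable_energy (R : realType) n p (G : 'rV[R]_n -> 'rV[R]_n) i :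
  1 <= p -> measurable_fun setT G -> (energy p G < +oo)%E ->
  loc_integrable (fun x => G x 0 i).
Proof.
move=> p1 mG Gfin.
have mGi : measurable_fun setT (fun x => G x 0 i).
  exact: (measurableT_comp (measurable_coord i)).
split=> // K cK.
have /compact_bounded/bounded_setP[L KL] := cK.
have mK := compact_measurable_rV cK.
have mB := @measurable_normball R n L.
have Ge : (energy p G <= (fine (energy p G))%:E)%E.
  by rewrite fineK// ge0_fin_numE// energy_ge0.
have m1 : measurable_fun setT (\1_(@normball R n L) : 'rV[R]_n -> R).
  exact: measurable_indic.
have := @integral_energy_bound R n p G (\1_(normball L)) i 1 L 1 _ p1 ltr01 ler01 mG m1.
move=> /(_ _ _ _ Ge) H; apply: le_lt_trans (le_lt_trans (H _ _) (ltry _)).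
- rewrite [leLHS]integral_mkcond; apply: ge0_le_integral => //.
  + by move=> x _; rewrite patchE; case: ifP.
  + apply/(measurable_restrictT _ mK); apply/measurable_EFinP.
    by apply: measurableT_comp => //; exact: measurable_funS mGi.
  + by apply/measurable_EFinP; apply: measurableT_comp => //; exact: measurable_funM.
  + move=> x _; rewrite patchE; case: ifPn => [/set_mem Kx|_].
      by rewrite indicE mem_set ?mulr1//; exact: KL.
    by rewrite lee_fin.
- by move=> x; rewrite indicE ger0_norm// lern1 leq_b1.
- move=> x Lx; rewrite indicE memNset//= => xL.
  by move: Lx; rewrite ltNge xL.
Qed.

Section affine_smooth.
Variables (R : realType) (n : nat).
Implicit Types (f g u : 'rV[R]_n -> R) (x y : 'rV[R]_n).

(** A recursive form of [smooth] that permits induction: a partial derivative of [f \o A] is not a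
    partial of [f] composed with [A] but a linear combination of such, and [Ck k] is stable under
    these. *)
Fixpoint Ck (k : nat) f : Prop :=
  if k is k'.+1 then C1 f /\ forall i, Ck k' (partial i f) else continuous f.

Lemma smooth_partial f i : smooth f -> smooth (partial i f).
Proof. by move=> sf s; have := sf (rcons s i); rewrite foldr_rcons. Qed.

Lemma smoothP f : smooth f <-> forall k, Ck k f.
Proof.
split=> [sf k|].
  elim: k f sf => [|k ih] f sf /=; first by have [] := sf [::].
  by split=> [|i]; [exact: (sf [::])|apply: ih; exact: smooth_partial].
move=> Cf s; elim/last_ind: s f Cf => [|s i ih] f Cf; first by have [] := Cf 1.
by rewrite foldr_rcons; apply: ih => k; have [_] := Cf k.+1; apply.
Qed.

Lemma C1_lin a b f g : C1 f -> C1 g -> C1 (fun x => a * f x + b * g x) /\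
  forall i, partial i (fun x => a * f x + b * g x) =
    (fun x => a * partial i f x + b * partial i g x).
Proof.
move=> [cf df] [cg dg].
have lin_cont h1 h2 : continuous h1 -> continuous h2 ->
    continuous (fun x : 'rV[R]_n => a * h1 x + b * h2 x).
  move=> c1 c2 x.
  apply: (@continuousD _ _ _ (fun x => a * h1 x) (fun x => b * h2 x)).
    by apply: (@continuousM _ _ (cst a)); [exact: cst_continuous|exact: c1].
  by apply: (@continuousM _ _ (cst b)); [exact: cst_continuous|exact: c2].
have D i x : is_derive x (delta_mx 0 i) (fun x => a * f x + b * g x)
    (a * partial i f x + b * partial i g x).
  have d1 : is_derive x (delta_mx 0 i) f (partial i f x).
    by apply: DeriveDef => //; have [] := df i.
  have d2 : is_derive x (delta_mx 0 i) g (partial i g x).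
    by apply: DeriveDef => //; have [] := dg i.
  exact: (is_deriveD (is_deriveZ a d1) (is_deriveZ b d2)).
have E i : partial i (fun x => a * f x + b * g x) =
    (fun x => a * partial i f x + b * partial i g x).
  by apply/funext => x; have [_] := D i x.
split=> //; split; first exact: lin_cont.
move=> i; split; first by move=> x; have [] := D i x.
by rewrite E; apply: lin_cont; [have [] := df i|have [] := dg i].
Qed.

Lemma Ck_lin k a b f g : Ck k f -> Ck k g -> Ck k (fun x => a * f x + b * g x).
Proof.
elim: k f g => [|k ih] f g /=.
  move=> c1 c2 x.
  apply: (@continuousD _ _ _ (fun x => a * f x) (fun x => b * g x)).
    by apply: (@continuousM _ _ (cst a)); [exact: cst_continuous|exact: c1].
  by apply: (@continuousM _ _ (cst b)); [exact: cst_continuous|exact: c2].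
move=> [C1f Cf] [C1g Cg]; have [C E] := C1_lin a b C1f C1g.
by split=> // i; rewrite E; exact: ih.
Qed.

Lemma Ck0 k : Ck k (cst 0).
Proof.
have E i : partial i (cst 0) = cst 0.
  by apply/funext => x; rewrite /partial derive_cst.
elim: k => [|k ih] /=; first exact: cst_continuous.
split=> [|i]; last by rewrite E.
split; first exact: cst_continuous.
by move=> i; split=> [x|]; [exact: derivable_cst|rewrite E; exact: cst_continuous].
Qed.

Lemma Ck_sum k (I : Type) (r : seq I) (c : I -> R) (F : I -> 'rV[R]_n -> R) :
  (forall i, Ck k (F i)) -> Ck k (fun x => \sum_(i <- r) c i * F i x).
Proof.
move=> CF; elim: r => [|i r ih].
  rewrite (_ : (fun _ => _) = cst 0); first exact: Ck0.
  by apply/funext => x; rewrite big_nil.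
rewrite (_ : (fun _ => _) = (fun x => c i * F i x + 1 * \sum_(i <- r) c i * F i x)).
  exact: Ck_lin.
by apply/funext => x; rewrite big_cons mul1r.
Qed.

Variables (s : R) (O : 'M[R]_n) (a : 'rV[R]_n).
Let A (x : 'rV[R]_n) : 'rV[R]_n := s *: (x *m O) + a.

Lemma continuous_affine_rV u : continuous u -> continuous (u \o A).
Proof.
move=> cu; apply/continuous_rVP => x e e0.
have /continuous_rVP/(_ (A x) e e0)[d d0 dP] := cu.
(* A Lipschitz constant of the affine map in the max-norm, increased by [1] to be positive. *)
pose C : R := `|s| * (n%:R * `|O|) + 1.
have C0 : 0 < C by rewrite ltr_wpDl// !mulr_ge0.
exists (d / C) => [|y xy]; first by rewrite divr_gt0.
apply: dP; rewrite /A opprD addrACA subrr addr0 -scalerBr -mulmxBl normrZ.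
apply: (@le_lt_trans _ _ (`|x - y| * C)); last by rewrite -ltr_pdivlMr.
have -> : `|x - y| * C = `|s| * (n%:R * (`|x - y| * `|O|)) + `|x - y|.
  by rewrite /C; ring.
apply: ler_wpDr => //; apply: ler_wpM2l => //.
rewrite [leLHS]mx_normrE; apply: bigmax_le; first by rewrite !mulr_ge0.
move=> [i j] _ /=; rewrite (ord1 i) mxE.
apply: le_trans (ler_norm_sum _ _ _) _.
apply: (@le_trans _ _ (\sum_(k < n) `|x - y| * `|O|)).
  apply: ler_sum => k _; rewrite normrM; apply: ler_pM => //.
    exact: norm_coord_le.
  rewrite [leRHS]mx_normrE.
  exact: (le_bigmax_cond _ (fun ij => `|O ij.1 ij.2|) (j := (k, j))).
by rewrite sumr_const card_ord mulr_natl lexx.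
Qed.

Lemma partial_affine f i x : C1 f ->
  is_derive x (delta_mx 0 i) (f \o A) (\sum_(j < n) (s * O i j) * partial j f (A x)).
Proof.
move=> C1f; apply: is_derive_line0.
pose v : 'rV[R]_n := s *: (delta_mx 0 i *m O).
rewrite [X in is_derive _ _ X _](_ : _ = (fun h : R => f (h *: v + A x))); last first.
  apply/funext => h /=; congr f; rewrite /A /v mulmxDl scalerDr -addrA.
  by rewrite -scalemxAl scalerA mulrC -scalerA.
have -> : \sum_(j < n) (s * O i j) * partial j f (A x) =
    \sum_(j < n) v 0 j * partial j f (A x).
  by apply: eq_bigr => j _; rewrite /v mxE -rowE mxE.
by apply/is_derive_lineP; rewrite scale0r add0r; exact: C1_is_derive.
Qed.

Lemma Ck_affine k f : Ck k f -> Ck k (f \o A).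
Proof.
elim: k f => [|k ih] f /=; first exact: continuous_affine_rV.
move=> [C1f Cf].
have E i : partial i (f \o A) =
    (fun x => \sum_(j < n) (s * O i j) * (partial j f \o A) x).
  by apply/funext => x; have [_] := partial_affine i x C1f.
split=> [|i]; last by rewrite E; apply: Ck_sum => j; exact: ih.
split; first by apply: continuous_affine_rV; case: C1f.
move=> i; split; first by move=> x; have [] := partial_affine i x C1f.
rewrite E; apply: (@Ck_sum 0) => j /=.
by apply: continuous_affine_rV; have [_ /(_ j)[]] := C1f.
Qed.

Lemma smooth_affine f : smooth f -> smooth (f \o A).
Proof. by move=> /smoothP Cf; apply/smoothP => k; exact: Ck_affine. Qed.

End affine_smooth.

Section affine_change.
Variables (R : realType) (n : nat).
Local Notation mu := (lebesgue_rV R n).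
Implicit Types (f g u : 'rV[R]_n -> R) (x y : 'rV[R]_n).
Variables (s : R) (O : 'M[R]_n) (a : 'rV[R]_n).
Let A (x : 'rV[R]_n) : 'rV[R]_n := s *: (x *m O) + a.
Hypotheses (s0 : 0 < s) (OO : O *m O^T = 1%:M).

Let B (y : 'rV[R]_n) : 'rV[R]_n := s^-1 *: (y *m O^T) + (- s^-1 *: (a *m O^T)).

Lemma affine_inv : cancel A B.
Proof.
move=> x; rewrite /A /B mulmxDl scalerDr -scalemxAl scalerA mulVf ?gt_eqF// scale1r.
by rewrite -mulmxA OO mulmx1 scaleNr addrK.
Qed.

Lemma affine_invK : cancel B A.
Proof.
move=> x; rewrite /A /B mulmxDl scalerDr -!scalemxAl !scalerA mulfV ?gt_eqF//.
by rewrite mulrN mulfV ?gt_eqF// scaleN1r scale1r -!mulmxA (mulmx1C OO) !mulmx1 addrNK.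
Qed.

Lemma ge0_integral_affine_rV (f : 'rV[R]_n -> \bar R) :
  measurable_fun setT f -> (forall x, 0 <= f x)%E ->
  ((s ^+ n)%:E * \int[mu]_x f (A x) = \int[mu]_x f x)%E.
Proof.
move=> mf f0; rewrite -[RHS](ge0_integral_scale_rV a s0)//; congr (_ * _)%E.
rewrite -[RHS](ge0_integral_orthogonal OO)//.
apply: (measurableT_comp mf).
by have := measurable_affine_rV s 1%:M a; under eq_fun do rewrite mulmx1.
Qed.

Lemma integral_affine_rV f : measurable_fun setT f ->
  (\int[mu]_x (f x)%:E = (s ^+ n)%:E * \int[mu]_x (f (A x))%:E)%E.
Proof.
move=> mf; rewrite [LHS]integralE [in RHS]integralE.
have mEf : measurable_fun setT (EFin \o f) by exact/measurable_EFinP.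
have H1 : (\int[mu]_x (EFin \o f)^\+ x =
    (s ^+ n)%:E * \int[mu]_x (EFin \o (f \o A))^\+ x)%E.
  rewrite -(@ge0_integral_affine_rV (EFin \o f)^\+%E)//; last exact: measurable_funepos.
  by congr (_ * _)%E; apply: eq_integral => x _; rewrite !funeposE.
have H2 : (\int[mu]_x (EFin \o f)^\- x =
    (s ^+ n)%:E * \int[mu]_x (EFin \o (f \o A))^\- x)%E.
  rewrite -(@ge0_integral_affine_rV (EFin \o f)^\-%E)//; last exact: measurable_funeneg.
  by congr (_ * _)%E; apply: eq_integral => x _; rewrite !funenegE.
have p1 : (0 <= \int[mu]_x (EFin \o (f \o A))^\+ x)%E by exact: integral_ge0.
have p2 : (0 <= \int[mu]_x (EFin \o (f \o A))^\- x)%E by exact: integral_ge0.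
rewrite [X in (X - _)%E]H1 [X in (_ - X)%E]H2.
have sn : 0 < s ^+ n by exact: exprn_gt0.
move: p1 p2; set X := integral _ _ _; set Y := integral _ _ _.
(* No integrability is assumed, so either part may be infinite; multiplication by the positive
   [s ^+ n] respects the convention for [+oo - +oo]. *)
case: X => [x| |]// _; case: Y => [y| |]// _ /=.
- change ((s ^+ n * x - s ^+ n * y)%:E = (s ^+ n * (x - y))%:E).
  by rewrite mulrBr.
- by rewrite gt0_muley ?lte_fin// gt0_muleNy ?lte_fin.
- by rewrite gt0_muley ?lte_fin.
- by rewrite gt0_muley ?lte_fin// gt0_muleNy ?lte_fin.
Qed.

Let mA : measurable_fun setT A. Proof. exact: measurable_affine_rV. Qed.

(** The factor [s] of the chain rule contributes [s^p] and the change of variables [s^-n]; the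
    orthogonal matrix preserves the norm. *)
Lemma energy_affine p (G : 'rV[R]_n -> 'rV[R]_n) : measurable_fun setT G ->
  energy p (fun x => s *: (G (A x) *m O^T)) =
  ((s `^ (p - n%:R))%:E * energy p G)%E.
Proof.
move=> mG; have mGA : measurable_fun setT (fun x => G (A x)) by exact: measurableT_comp.
have mGAO : measurable_fun setT (fun x => G (A x) *m O^T).
  have := measurableT_comp (measurable_affine_rV 1 O^T 0) mGA.
  by under eq_fun do rewrite /= scale1r addr0.
rewrite [LHS](energyZ p s mGAO) (gtr0_norm s0).
have OtOtt : O^T *m O^T^T = 1%:M by rewrite trmxK; exact: mulmx1C.
rewrite [X in (_ * X)%E](_ : _ = (\int[mu]_x (enorm (G (A x)) `^ p)%:E)%E); last first.
  by apply: eq_integral => x _; rewrite enorm_mulmx.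
rewrite [X in (_ = _ * X)%E](_ : _ =
    ((s ^+ n)%:E * \int[mu]_x (enorm (G (A x)) `^ p)%:E)%E); last first.
  rewrite (@ge0_integral_affine_rV (fun x => (enorm (G x) `^ p)%:E))//.
    exact: measurable_energy.
  by move=> x; rewrite lee_fin powR_ge0.
rewrite muleA -EFinM -powR_mulrn ?(ltW s0)// -powRD ?subrK//.
by rewrite (gt_eqF s0) implybT.
Qed.

(** The test function is transported by the inverse map, so the chain rule is applied only to the
    smooth [g]. Finite energy provides the local integrability of the new gradient. *)
Lemma weak_gradient_affine p u G : 1 <= p -> continuous u ->
  weak_gradient u G -> (energy p G < +oo)%E ->
  weak_gradient (u \o A) (fun x => s *: (G (A x) *m O^T)).
Proof.
move=> p1 cu uG Gfin i.
have mG := measurable_weak_gradient uG.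
have lG j : loc_integrable (fun x => G x 0 j) by have [] := uG j.
have lu := loc_integrable_continuous cu.
have sn : 0 < s ^+ n by exact: exprn_gt0.
have mGA : measurable_fun setT (fun x => s *: (G (A x) *m O^T)).
  have := measurableT_comp (measurable_affine_rV s O^T 0) (measurableT_comp mG mA).
  by under eq_fun do rewrite /= addr0.
split.
  have GAfin : (energy p (fun x => s *: (G (A x) *m O^T)) < +oo)%E.
    rewrite [ltLHS](energy_affine p mG) lte_mul_pinfty//.
    by rewrite lee_fin powR_ge0.
  exact: (@loc_integrable_energy R n p _ i p1 mGA GAfin).
move=> f tf.
pose g := f \o B.
have fE : f = g \o A by apply/funext => x; rewrite /g/= affine_inv.
have [sf /compact_supportP[L fL]] := tf.
have tg : test_function g.
  split; first exact: (@smooth_affine R n s^-1 O^T (- s^-1 *: (a *m O^T)) f sf).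
  apply/compact_supportP.
  (* Orthogonal maps preserve the Euclidean norm only; passing from the max-norm and back costs one
     factor [n], and the other is to spare. *)
  exists (s * (n%:R * (n%:R * L)) + `|a|) => y yL; rewrite /g/= fL//.
  rewrite ltNge; apply/negP => BL; move: yL; rewrite ltNge => /negP; apply.
  rewrite -{1}(affine_invK y) /A; apply: le_trans (ler_normD _ _) _.
  rewrite lerD2r normrZ (gtr0_norm s0) ler_pM2l//.
  apply: le_trans (norm_le_enorm _) _; rewrite enorm_mulmx//.
  apply: le_trans (enorm_le_norm _) _; apply: ler_wpM2l => //.
  have [n0|n0] := posnP n.
    suff -> : B y = 0 by rewrite normr0 mulr_ge0// (le_trans _ BL).
    by apply/rowP => j; move: (ltn_ord j); rewrite {2}n0.
  have L0 : 0 <= L by exact: le_trans (normr_ge0 (B y)) BL.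
  by apply: le_trans BL _; rewrite ler_peMl// ler1n.
have C1g : C1 g by have [/(_ [::])] := tg.
have mg : measurable_fun setT g by apply: continuous_measurable_rV; case: C1g.
have mpg j : measurable_fun setT (partial j g).
  by apply: continuous_measurable_rV; have [_ /(_ j)[]] := C1g.
have mu_ : measurable_fun setT u by exact: continuous_measurable_rV.
have mGj j : measurable_fun setT (fun x => G x 0 j).
  exact: (measurableT_comp (measurable_coord j)).
have pE x : partial i f x = \sum_(j < n) (s * O i j) * partial j g (A x).
  by rewrite fE; have [_] := partial_affine s O a i x C1g.
pose F x := \sum_(j < n) (s * O i j) * (u x * partial j g x).
pose H x := \sum_(j < n) (s * O i j) * (G x 0 j * g x).
have mF : measurable_fun setT F.
  apply: measurable_sum => j; apply: measurable_funM => //; exact: measurable_funM.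
have mH : measurable_fun setT H.
  apply: measurable_sum => j; apply: measurable_funM => //; exact: measurable_funM.
have int_sum (h : 'I_n -> 'rV[R]_n -> R) :
    (forall j, mu.-integrable setT (fun x => (h j x)%:E)) ->
    (\int[mu]_x (\sum_(j < n) (s * O i j) * h j x)%:E =
     \sum_(j < n) (s * O i j)%:E * \int[mu]_x (h j x)%:E)%E.
  move=> ih; under eq_integral do rewrite -sumEFin.
  rewrite integral_sum//=; last first.
    move=> j; have := integrableZl measurableT (s * O i j) (ih j).
    by apply: eq_integrable => // x _; rewrite EFinM.
  by apply: eq_bigr => j _; rewrite -integralZl.
have e1 : (\int[mu]_x (F x)%:E = - \int[mu]_x (H x)%:E)%E.
  rewrite /F /H !int_sum; last 2 first.
  - by move=> j; exact: integrable_mul_test.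
  - by move=> j; apply: integrable_mul_test => //; exact: test_function_partial.
  pose r j := fine (\int[mu]_x (G x 0 j * g x)%:E)%E.
  have rE j : (\int[mu]_x (G x 0%R j * g x)%:E = (r j)%:E)%E.
    rewrite /r fineK//; apply: (integrable_fin_num measurableT).
    exact: integrable_mul_test.
  rewrite (eq_bigr (fun j => (- (s * O i j * r j))%:E)); last first.
    by move=> j _; have [_ ->//] := uG j; rewrite rE -EFinN -EFinM mulrN.
  rewrite [in RHS](eq_bigr (fun j => (s * O i j * r j)%:E)); last first.
    by move=> j _; rewrite rE -EFinM.
  by rewrite !sumEFin -EFinN sumrN.
have cov h : measurable_fun setT h ->
    (\int[mu]_x (h (A x))%:E = (s ^- n)%:E * \int[mu]_x (h x)%:E)%E.
  move=> mh; rewrite (integral_affine_rV mh) muleA -EFinM mulVf ?gt_eqF//.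
  by rewrite mul1e.
transitivity (\int[mu]_x (F (A x))%:E)%E.
  apply: eq_integral => x _; rewrite pE /F mulr_sumr; congr EFin.
  by apply: eq_bigr => j _; rewrite /comp mulrCA.
transitivity (- \int[mu]_x (H (A x))%:E)%E.
  by rewrite (cov F mF) (cov H mH) e1 muleN.
congr (- _)%E; apply: eq_integral => x _; congr EFin.
rewrite !mxE mulr_sumr mulr_suml /H; apply: eq_bigr => j _.
by rewrite /g/= affine_inv !mxE; ring.
Qed.

End affine_change.

(** * Uniqueness of the weak gradient *)

Section test_function_approximation.
Variables (R : realType) (n : nat).
Local Notation mu := (lebesgue_rV R n).

Definition ocbox (a b : 'I_n -> R) : set 'rV[R]_n :=
  [set x | forall i, `]a i, b i]%classic (x 0 i)].

Lemma measurable_ocbox a b : measurable (ocbox a b).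
Proof. exact: (measurable_box_rV (A := fun i => `]a i, b i]%classic)). Qed.

(** For a fixed coordinate, the sets of reals whose preimage lies in the generated sigma-algebra
    form a sigma-algebra. It contains the half-open intervals, since a slab is a countable union of
    boxes. *)
Lemma ocbox_generates :
  measurable = <<s [set ocbox ab.1 ab.2 | ab in [set: ('I_n -> R) * ('I_n -> R)]] >>.
Proof.
set G := image _ _.
apply/seteqP; split; last first.
  apply: smallest_sub; first exact: sigma_algebra_measurable.
  by move=> _ [ab _ <-]; exact: measurable_ocbox.
apply: smallest_sub; first exact: smallest_sigma_algebra.
move=> C; rewrite -bigcup_seq => -[i _] [D mD <-]; rewrite setTI.
pose X := <<s G >>.
have sX : sigma_algebra setT X by exact: smallest_sigma_algebra.
have := sigma_algebra_image (fun x : 'rV[R]_n => x 0 i) sX.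
move=> sI.
suff : image_set_system setT (fun x : 'rV[R]_n => x 0 i) X D.
  by rewrite /image_set_system/= setTI.
move: D mD; apply: smallest_sub; first exact: sI.
move=> _ [[a b] _ <-] /=; rewrite /image_set_system/= setTI.
pose aN (N : nat) j := if j == i then a else - N%:R : R.
pose bN (N : nat) j := if j == i then b else N%:R : R.
rewrite (_ : _ @^-1` _ = \bigcup_N ocbox (aN N) (bN N)).
  apply: sigma_algebra_bigcup => N.
  by apply: sub_sigma_algebra; exists (aN N, bN N).
apply/seteqP; split => x /=.
  move=> xab; exists (Num.truncn `|x|).+1 => // j; rewrite /aN /bN.
  have [->//|ji] := eqVneq j i.
  have := le_lt_trans (norm_coord_le x j) (truncnS_gt `|x|).
  by rewrite ltr_norml /= in_itv/= => /andP[-> /ltW ->].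
by move=> [N _ /(_ i)]; rewrite /aN /bN eqxx.
Qed.

(** The indicator of the box is the pointwise limit of products of differences of steps, steepened
    by [m+1]. At every point the sequence is eventually constant, and [|k|] on a fixed ball
    dominates. *)
Lemma integral_ocbox_eq0 (k : 'rV[R]_n -> R) a b : (0 < n)%N -> loc_integrable k ->
  (forall f, test_function f -> \int[mu]_x (k x * f x)%:E = 0)%E ->
  (\int[mu]_(x in ocbox a b) (k x)%:E = 0)%E.
Proof.
move=> n0 lk kf.
have [ab|/existsP[i ba]] := boolP [forall i, a i <= b i]; last first.
  rewrite (_ : ocbox a b = set0) ?integral_set0//.
  apply/seteqP; split => // x /(_ i) /=; rewrite in_itv/= => /andP[ax xb].
  by move/negP: ba; apply; exact/ltW/(lt_le_trans ax xb).
have {}ab i : a i <= b i by exact: (forallP ab).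
have [_ [S [_ [sS _ S0 S1 S01]]]] := smooth_step_exists R.
pose st (c : R) (m : nat) (t : R) := S (m.+1%:R * t + - (m.+1%:R * c)).
(* At [t = c] the step has value [S 0 = 0], which is why the boxes are open on the left and closed
   on the right. *)
have st_cvg c t : \forall m \near \oo, st c m t = (c < t)%R%:R.
  have [tc|ct] := leP t c.
    by near=> m; rewrite /st S0// -mulrBr mulr_ge0_le0// subr_le0.
  near=> m; rewrite /st S1// -mulrBr -ler_pdivrMr ?subr_gt0// div1r.
  rewrite (@le_trans _ _ m%:R)// ?ler_nat//.
  by near: m; exact: nbhs_infty_ger.
pose phi m i t := st (a i) m t + - 1 * st (b i) m t.
pose f m := tensor (phi m).
pose L : R := \sum_i (`|a i| + `|b i|) + 1.
have phiL m i t : L < `|t| -> phi m i t = 0.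
  (* The added [1] leaves room for even the flattest step, [m = 0], to reach its final value. *)
  have abL : `|a i| + `|b i| + 1 <= L.
    by rewrite /L lerD2r (bigD1 i)//= lerDl sumr_ge0.
  have m1 : (1 : R) <= m.+1%:R by rewrite ler1n.
  have := ler_norm (a i); have := ler_norm (b i).
  have := ler_norm (- a i); have := ler_norm (- b i); rewrite !normrN.
  have := normr_ge0 (a i); have := normr_ge0 (b i).
  move=> ? ? ? ? ? ? Lt; rewrite /phi /st.
  have [t0|t0] := leP 0 t.
    rewrite ger0_norm// in Lt.
    by rewrite !S1 ?mulr1 ?subrr//; nra.
  rewrite ltr0_norm// in Lt.
  by rewrite !S0 ?mulr0 ?addr0//; nra.
have phi1 m i t : `|phi m i t| <= 1.
  rewrite /phi /st; move: (S01 (m.+1%:R * t + - (m.+1%:R * a i))).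
  move: (S01 (m.+1%:R * t + - (m.+1%:R * b i))) => /andP[? ?] /andP[? ?].
  by rewrite ler_norml; apply/andP; split; lra.
have tf m : test_function (f m).
  apply: (@test_function_tensor _ _ _ L) => //; last by move=> i; exact: phiL.
  move=> i.
  apply: smooth1D; last exact: smooth1_affine.
  rewrite (_ : st _ _ = (fun t => 1 * S (m.+1%:R * t + - (m.+1%:R * a i)))).
    exact: smooth1_affine.
  by apply/funext => t; rewrite mul1r.
have f1 m x : `|f m x| <= 1.
  rewrite /f /tensor normr_prod; apply: prodr_ile1 => i _.
  by rewrite normr_ge0 phi1.
have fL m x : L < `|x| -> f m x = 0.
  move=> Lx.
  have x0 : mx_norm x != 0.
    rewrite gt_eqF//; apply: le_lt_trans Lx; apply: addr_ge0 => //.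
    by apply: sumr_ge0 => i _; exact: addr_ge0.
  move: x0 => /mx_norm_neq0[[i j]/= xE]; rewrite (ord1 i) in xE.
  by rewrite /f /tensor (bigD1 j)//= phiL ?mul0r// -xE.
have fcvg x : \forall m \near \oo, f m x = \1_(ocbox a b) x.
  have : \forall m \near \oo, forall i, phi m i (x 0 i) =
      (a i < x 0 i)%R%:R - (b i < x 0 i)%R%:R.
    apply: filter_forall => i; near=> m; rewrite /phi mulN1r; congr (_ - _).
      by near: m; exact: st_cvg.
    by near: m; exact: st_cvg.
  apply: filterS => m H; rewrite /f /tensor (eq_bigr _ (fun i _ => H i)) indicE.
  have [xab|/negP xab] := boolP (x \in ocbox a b).
    rewrite big1// => i _; move: xab => /set_mem/(_ i)/=; rewrite in_itv/=.
    by move=> /andP[-> xb]; rewrite ltNge xb subr0.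
  have [i xi] : exists i, ~~ (a i < x 0 i <= b i).
    apply/not_existsP => xi; apply: xab; apply/mem_set => i /=.
    by rewrite in_itv/=; apply/negPn/negP; exact: xi.
  rewrite (bigD1 i)//= (_ : _%:R - _ = 0) ?mul0r//.
  move: xi; rewrite negb_and -leNgt -ltNge => /orP[xa|xb].
    by rewrite ltNge xa/= ltNge (le_trans xa)// subr0.
  by rewrite xb (le_lt_trans (ab i) xb) subrr.
have mk : measurable_fun setT k by case: lk.
have mf m : measurable_fun setT (f m).
  by apply: continuous_measurable_rV; have [/(_ [::])[]] := tf m.
have mB := measurable_ocbox a b.
have m1B : measurable_fun setT (\1_(ocbox a b) : 'rV[R]_n -> R).
  exact: measurable_indic.
have mN := @measurable_normball R n L.
have ik : mu.-integrable setT (fun x => (`|k x * \1_(@normball R n L) x|)%:E).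
  have : mu.-integrable setT (fun x => (k x * \1_(@normball R n L) x)%:E).
    apply: (@integrable_mul_compact_support R n k _ 1 L) => //.
    - by move=> x; rewrite indicE ger0_norm// lern1 leq_b1.
    - by move=> x Lx; rewrite indicE memNset//= => xL; move: Lx; rewrite ltNge xL.
  by move=> /integrable_abse.
have [||||_ _] := @dominated_convergence _ _ _ mu setT measurableT
  (fun m x => (k x * f m x)%:E) (fun x => (k x * \1_(ocbox a b) x)%:E)
  (fun x => (`|k x * \1_(@normball R n L) x|)%:E) _ _ _ ik.
- by move=> m; apply/measurable_EFinP; exact: measurable_funM.
- by apply/measurable_EFinP; exact: measurable_funM.
- apply: aeW => x _; apply: cvg_near_cst; near=> m.
  by congr (_ * _)%:E; near: m; exact: fcvg.
- apply: aeW => x m _; rewrite /= lee_fin !normrM.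
  have [xL|Lx] := leP `|x| L.
    by apply: ler_wpM2l => //; rewrite indicE mem_set//= normr1.
  by rewrite fL// normr0 mulr0 mulr_ge0.
under eq_fun do rewrite kf//.
move=> /(cvg_lim (@ereal_hausdorff R)); rewrite lim_cst// => H.
rewrite integral_mkcond [RHS]H; apply: eq_integral => x _.
rewrite patchE indicE; case: ifPn => _; first by rewrite mulr1.
by rewrite mulr0.
Unshelve. all: by end_near. Qed.

End test_function_approximation.

Section density_measure.
Local Open Scope ereal_scope.
Context d (T : measurableType d) (R : realType) (mu : {measure set T -> \bar R}).
Variables (f : T -> \bar R).
Hypotheses (mf : measurable_fun setT f) (f0 : forall x, 0 <= f x).

Definition density_measure (A : set T) : \bar R := \int[mu]_(x in A) f x.

Let density0 : density_measure set0 = 0.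
Proof. exact: integral_set0. Qed.

Let density_ge0 A : 0 <= density_measure A.
Proof. by apply: integral_ge0 => x _. Qed.

Let density_additive : semi_sigma_additive density_measure.
Proof. exact: semi_sigma_additive_nng_induced. Qed.

HB.instance Definition _ := isMeasure.Build _ _ _ density_measure
  density0 density_ge0 density_additive.

Definition measure_of_density : {measure set T -> \bar R} := density_measure.

End density_measure.

Section weak_gradient_uniqueness.
Variables (R : realType) (n : nat).
Local Notation mu := (lebesgue_rV R n).
Hypothesis n0 : (0 < n)%N.

(** The measures with densities the positive and the negative part of [k] are finite and equal on
    boxes, hence equal. One of them vanishes where [k >= 0] and the other where [k < 0], so both are
    zero. *)
Lemma du_bois_reymond (k : 'rV[R]_n -> R) : loc_integrable k ->
  (forall f, test_function f -> \int[mu]_x (k x * f x)%:E = 0)%E ->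
  {ae mu, forall x, k x = 0}.
Proof.
move=> lk kf.
have [mk _] := lk.
have mEk : measurable_fun setT (EFin \o k) by exact/measurable_EFinP.
pose kp := (EFin \o k)^\+%E; pose kn := (EFin \o k)^\-%E.
have mp : measurable_fun setT kp by exact: measurable_funepos.
have mn : measurable_fun setT kn by exact: measurable_funeneg.
pose m1 := measure_of_density mu mp (@funepos_ge0 _ _ (EFin \o k)).
pose m2 := measure_of_density mu mn (@funeneg_ge0 _ _ (EFin \o k)).
have m1E A : m1 A = (\int[mu]_(x in A) kp x)%E by [].
have m2E A : m2 A = (\int[mu]_(x in A) kn x)%E by [].
have boxfin (a b : 'I_n -> R) : (m1 (ocbox a b) < +oo)%E /\ (m2 (ocbox a b) < +oo)%E.
  have mB := measurable_ocbox a b.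
  pose L : R := \sum_i (`|a i| + `|b i|).
  have /loc_integrableP[_ /(_ _ (@compact_normball R n L)) ikL] := lk.
  have ik : mu.-integrable (ocbox a b) (EFin \o k).
    apply: (integrableS _ mB _ ikL); first exact: measurable_normball.
    move=> x xab /=; rewrite [leLHS]mx_normrE; apply: bigmax_le.
      by apply: sumr_ge0 => i _; exact: addr_ge0.
    move=> [i j] _ /=; rewrite (ord1 i); have := xab j; rewrite /= in_itv/=.
    have : `|a j| + `|b j| <= L.
      by rewrite /L (bigD1 j)//= lerDl; apply: sumr_ge0 => l _; exact: addr_ge0.
    have := ler_norm (b j); have := ler_norm (- a j); rewrite normrN.
    have := normr_ge0 (a j); have := normr_ge0 (b j).
    by move=> ? ? ? ? ? /andP[? ?]; rewrite ler_norml; apply/andP; split; lra.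
  by split; [exact: integral_funepos_lt_pinfty|exact: integral_funeneg_lt_pinfty].
have m12 A : measurable A -> m1 A = m2 A.
  apply: (@measure_unique _ R _
    [set ocbox ab.1 ab.2 | ab in [set: ('I_n -> R) * ('I_n -> R)]]
    (fun N : nat => ocbox (fun=> - N%:R) (fun=> N%:R))).
  - exact: ocbox_generates.
  - move=> _ _ [ab _ <-] [cd _ <-].
    exists (fun i => Num.max (ab.1 i) (cd.1 i), fun i => Num.min (ab.2 i) (cd.2 i)) => //.
    apply/seteqP; split => x /=.
      move=> H; split => i; have := H i; rewrite /= !in_itv/= gt_max le_min.
        by move=> /andP[/andP[-> _] /andP[-> _]].
      by move=> /andP[/andP[_ ->] /andP[_ ->]].
    move=> [H1 H2] i; have := H1 i; have := H2 i.
    by rewrite /= !in_itv/= gt_max le_min => /andP[-> ->] /andP[-> ->].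
  - by move=> N; exists ((fun=> - N%:R), (fun=> N%:R)).
  - apply/seteqP; split=> // x _; exists (Num.truncn `|x|).+1 => // j /=.
    have := le_lt_trans (norm_coord_le x j) (truncnS_gt `|x|).
    by rewrite ltr_norml /= in_itv/= => /andP[-> /ltW ->].
  - move=> _ [[a b] _ <-]; change (m1 (ocbox a b) = m2 (ocbox a b)).
    have [f1 f2] := boxfin a b.
    have E : (m1 (ocbox a b) - m2 (ocbox a b) = 0)%E.
      by rewrite -(integral_ocbox_eq0 a b n0 lk kf) [RHS]integralE.
    move: f1 f2 (measure_ge0 m1 (ocbox a b)) (measure_ge0 m2 (ocbox a b)) E.
    case: (m1 _) => [x| |]// _; case: (m2 _) => [y| |]// _ _ _.
    by rewrite -EFinB => -[] /eqP; rewrite subr_eq0 => /eqP ->.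
  - by move=> N; have [] := boxfin (fun=> - N%:R) (fun=> N%:R).
pose P := [set x | 0 <= k x].
have mP : measurable P.
  rewrite -[P]setTI (_ : P = k @^-1` `[0, +oo[%classic); first exact: mk.
  by apply/seteqP; split => x /=; rewrite in_itv/= andbT.
have P1 : m1 P = 0%E.
  rewrite m12// m2E integral0_eq// => x Px.
  by rewrite /kn funenegE; apply/max_idPr; rewrite /= lee_fin lerNl oppr0.
have P2 : m1 (~` P) = 0%E.
  rewrite m1E integral0_eq// => x /negP; rewrite -ltNge => Px.
  by rewrite /kp funeposE; apply/max_idPr; rewrite /= lee_fin ltW.
have T1 : m1 setT = 0%E.
  have := measureU m1 mP (measurableC mP) (setICr P).
  rewrite setUv => E; rewrite [LHS]E.
  by rewrite [X in (X + _)%E]P1 [X in (_ + X)%E]P2 adde0.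
have T2 : m2 setT = 0%E by rewrite -m12.
have : (\int[mu]_x `|(k x)%:E| = 0)%E.
  transitivity (\int[mu]_x (kp x + kn x))%E.
    by apply: eq_integral => x _; rewrite -[LHS]/((abse \o (EFin \o k)) x) fune_abse.
  rewrite ge0_integralD//; last 2 first.
    by move=> x _; exact: funepos_ge0.
    by move=> x _; exact: funeneg_ge0.
  by rewrite -[X in (X + _)%E]/(m1 setT) -[X in (_ + X)%E]/(m2 setT) T1 T2 adde0.
move=> /(ae_eq_integral_abs mu measurableT mEk).
by apply: filterS => x /(_ I) [].
Qed.

Lemma weak_partial_unique u i (g h : 'rV[R]_n -> R) :
  weak_partial u i g -> weak_partial u i h -> {ae mu, forall x, g x = h x}.
Proof.
move=> [lg ug] [lh uh].
have : {ae mu, forall x, 1 * g x + -1 * h x = 0}.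
  apply: du_bois_reymond; first exact: loc_integrable_lin.
  move=> f tf.
  have ig := integrable_mul_test lg tf; have ih := integrable_mul_test lh tf.
  have := ug f tf; rewrite (uh f tf) => /eqP; rewrite eqe_opp => /eqP E.
  transitivity (\int[mu]_x ((g x * f x)%:E - (h x * f x)%:E))%E.
    by apply: eq_integral => x _; rewrite -EFinB; congr EFin; ring.
  rewrite integralB// E subee//; exact: integrable_fin_num.
by apply: filterS => x; lra.
Qed.

Lemma weak_gradient_unique (u : 'rV[R]_n -> R) G H :
  weak_gradient u G -> weak_gradient u H -> {ae mu, forall x, G x = H x}.
Proof.
move=> uG uH.
have : {ae mu, forall x, forall i, G x 0 i = H x 0 i}.
  by apply: filter_forall => i; exact: weak_partial_unique (uG i) (uH i).
by apply: filterS => x GH; apply/rowP.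
Qed.

(** The gradient inside [grad_norm] is picked by choice; almost everywhere uniqueness allows any
    weak gradient to compute it. *)
Lemma grad_normE (p : R) (u : 'rV[R]_n -> R) G : 0 < p -> weak_gradient u G ->
  (grad_norm p u `^ p = energy p G)%E.
Proof.
move=> p0 uG.
have ugu : weak_gradient u (gradient u).
  exact: (@xgetPex _ (cst 0) (weak_gradient u) (ex_intro _ G uG)).
rewrite /grad_norm powR_Lnorm ?gt_eqF//.
rewrite (_ : (\int[_]_x _)%E = energy p (gradient u)); last first.
  by apply: eq_integral => x _; rewrite /= ger0_norm ?enorm_ge0.
apply: eq_energy; first exact: weak_gradient_unique ugu uG.
- exact: measurable_weak_gradient ugu.
- exact: measurable_weak_gradient uG.
Qed.

End weak_gradient_uniqueness.

(** * Morrey's inequality *)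

Section sobolev_energy.
Variables (R : realType) (n : nat).
Implicit Types (u v : 'rV[R]_n -> R) (p e : R).

(** Only upper bounds of the energy are ever compared, so the gradient can stay under the
    existential. *)
Definition sobolev_le p e u := continuous u /\
  exists2 G, weak_gradient u G & (energy p G <= e%:E)%E.

Lemma continuous_lin_rV a b u v : continuous u -> continuous v ->
  continuous (fun x : 'rV[R]_n => a * u x + b * v x).
Proof. exact: (@Ck_lin R n 0). Qed.

Lemma sobolev_leZ p e c u : sobolev_le p e u ->
  sobolev_le p (`|c| `^ p * e) (fun x => c * u x).
Proof.
move=> [cu [G uG Ge]].
have E : (fun x => c * u x) = (fun x => c * u x + 0 * u x).
  by apply/funext => x; rewrite mul0r addr0.
have mG := measurable_weak_gradient uG.
split; first by rewrite E; exact: continuous_lin_rV.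
exists (fun x => c *: G x).
  have := weak_gradient_lin c 0 cu cu uG uG; rewrite -E.
  by under [X in weak_gradient _ X]eq_fun do rewrite scale0r addr0.
rewrite [leLHS](energyZ p c mG) EFinM lee_wpmul2l// lee_fin powR_ge0.
Qed.

Lemma sobolev_le_affine p e (s : R) (O : 'M[R]_n) (a : 'rV[R]_n) u : 1 <= p -> 0 < s ->
  O *m O^T = 1%:M -> sobolev_le p e u ->
  sobolev_le p (s `^ (p - n%:R) * e) (fun x => u (s *: (x *m O) + a)).
Proof.
move=> p1 s0 OO [cu [G uG Ge]].
have mG := measurable_weak_gradient uG.
split; first exact: (@continuous_affine_rV R n s O a u cu).
exists (fun x => s *: (G (s *: (x *m O) + a) *m O^T)).
  exact: (@weak_gradient_affine R n s O a s0 OO p u G p1 cu uG (le_lt_trans Ge (ltry _))).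
rewrite [leLHS](@energy_affine R n s O a s0 OO p G mG) EFinM lee_wpmul2l//.
by rewrite lee_fin powR_ge0.
Qed.

Lemma sobolev_le_scale p e (s : R) (a : 'rV[R]_n) u : 1 <= p -> 0 < s ->
  sobolev_le p e u ->
  sobolev_le p (s `^ (p - n%:R) * e) (fun x => u (s *: x + a)).
Proof.
move=> p1 s0 ue.
have II : 1%:M *m (1%:M : 'M[R]_n)^T = 1%:M by rewrite trmx1 mulmx1.
have := sobolev_le_affine a p1 s0 II ue.
by under [X in sobolev_le _ _ X]eq_fun do rewrite mulmx1.
Qed.

Lemma le_sobolev_le p e e' u : e <= e' -> sobolev_le p e u -> sobolev_le p e' u.
Proof.
move=> ee [cu [G uG Ge]]; split => //; exists G => //.
by apply: le_trans Ge _; rewrite lee_fin.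
Qed.

End sobolev_energy.

Section morrey.
Variables (R : realType) (n : nat).
Local Notation mu := (lebesgue_rV R n).
Implicit Types (u v : 'rV[R]_n -> R) (p e : R).
Hypothesis n0 : (0 < n)%N.

(** The factors [theta i] are replaced by [psi i] one at a time. Each replacement changes the
    product by the partial derivative of the product test function with [T k] in place [k]; moving
    the derivative onto [u] leaves an integral bounded by the energy. *)
Lemma hybrid_bound p u (theta psi T : 'I_n -> R -> R) (M L : R) :
  1 <= p -> 0 <= M -> sobolev_le p 1 u ->
  (forall i, smooth1 (theta i)) -> (forall i, smooth1 (psi i)) ->
  (forall i, smooth1 (T i)) ->
  (forall i, (T i)^`()%classic = (fun t => theta i t - psi i t)) ->
  (forall i t, L < `|t| -> theta i t = 0) ->
  (forall i t, L < `|t| -> psi i t = 0) ->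
  (forall i t, L < `|t| -> T i t = 0) ->
  (forall i t, `|theta i t| <= M) -> (forall i t, `|psi i t| <= M) ->
  (forall i t, `|T i t| <= M) ->
  `|fine (\int[mu]_x (u x * tensor theta x)%:E)%E -
    fine (\int[mu]_x (u x * tensor psi x)%:E)%E| <=
  n%:R * (M ^+ n * (fine (mu (@normball R n L)) + 1)).
Proof.
move=> p1 M0 [cu [G uG Ge]] sth spsi sT dT thL psiL TL thM psiM TM.
have mG := measurable_weak_gradient uG.
have lu := loc_integrable_continuous cu.
(* The hybrid in which the first [k] factors are already replaced. *)
pose h (k : nat) (i : 'I_n) := if (i < k)%N then psi i else theta i.
pose F k := tensor (h k).
have F0 : F 0 = tensor theta by [].
have Fn : F n = tensor psi.
  by apply/funext => x; apply: eq_bigr => i _; rewrite /h ltn_ord.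
have tF k : test_function (F k).
  apply: (@test_function_tensor _ _ _ L) => //.
    by move=> i; rewrite /h; case: ifP.
  by move=> i t; rewrite /h; case: ifP => _; [exact: psiL|exact: thL].
pose I k := fine (\int[mu]_x (u x * F k x)%:E)%E.
have IE k : (\int[mu]_x (u x * F k x)%:E = (I k)%:E)%E.
  by rewrite fineK//; apply: (integrable_fin_num measurableT); exact: integrable_mul_test.
have step (k : 'I_n) : `|I k - I k.+1| <= M ^+ n * (fine (mu (@normball R n L)) + 1).
  pose H i := if i == k then T i else h k i.
  have sH i : smooth1 (H i).
    by rewrite /H; case: ifP => // _; rewrite /h; case: ifP.
  have HL i t : L < `|t| -> H i t = 0.
    move=> Lt; rewrite /H; case: ifP => // _; first exact: TL.
    by rewrite /h; case: ifP => _; [exact: psiL|exact: thL].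
  have tH : test_function (tensor H) by exact: (@test_function_tensor _ _ _ L).
  have HM x : `|tensor H x| <= M ^+ n.
    have -> : M ^+ n = \prod_(i < n) M by rewrite prodr_const card_ord.
    rewrite /tensor normr_prod.
    apply: ler_prod => i _; rewrite normr_ge0/= /H; case: ifP => // _.
    by rewrite /h; case: ifP.
  have HL' x : L < `|x| -> tensor H x = 0.
    move=> Lx; have [x0|x0] := eqVneq x 0.
      have i0 : 'I_n := Ordinal n0.
      rewrite x0 normr0 in Lx; rewrite x0 /tensor (bigD1 (Ordinal n0))//= HL ?mul0r//.
      by rewrite mxE normr0.
    have : mx_norm x != 0 by apply/eqP => /mx_norm_eq0 /eqP; rewrite (negbTE x0).
    move=> /mx_norm_neq0[[i j]/= xE]; rewrite (ord1 i) in xE.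
    by rewrite /tensor (bigD1 j)//= HL ?mul0r// -xE.
  have pH : partial k (tensor H) = (fun x => F k x - F k.+1 x).
    rewrite partial_tensor//; apply/funext => x.
    rewrite /F /tensor (bigD1 k)//= [X in _ = X - _](bigD1 k)//=.
    rewrite [X in _ = _ - X](bigD1 k)//= /H eqxx dT /h ltnn ltnS leqnn.
    rewrite mulrBl; congr (_ * _ - _ * _).
      by apply: eq_bigr => i ik; rewrite (negbTE ik).
    apply: eq_bigr => i ik; rewrite (negbTE ik) ltnS [in RHS]leq_eqVlt.
    by rewrite val_eqE (negbTE ik).
  have [_ /(_ _ tH)] := uG k; rewrite pH.
  have -> : (\int[mu]_x (u x * (F k x - F k.+1 x))%:E = (I k - I k.+1)%:E)%E.
    rewrite EFinB -!IE -integralB//; try exact: integrable_mul_test.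
    by apply: eq_integral => x _; rewrite -EFinB mulrBr.
  move=> E; rewrite -lee_fin -[X in (X <= _)%E]/(`|(I k - I k.+1)%:E|%E) E abseN.
  have mH : measurable_fun setT (tensor H).
    by apply: continuous_measurable_rV; have [/(_ [::])[]] := tH.
  apply: le_trans (le_abse_integral mu measurableT _) _.
    apply/measurable_EFinP; apply: measurable_funM => //.
    exact: (measurableT_comp (measurable_coord k)).
  have := integral_energy_bound k p1 ltr01 (exprn_ge0 n M0) mG mH HM HL' Ge.
  by rewrite powR1 !mul1r.
have -> : fine (\int[mu]_x (u x * tensor theta x)%:E)%E -
    fine (\int[mu]_x (u x * tensor psi x)%:E)%E = \sum_(k < n) (I k - I k.+1).
  rewrite -F0 -Fn -/(I 0) -/(I n).
  rewrite -(big_mkord xpredT (fun k => I k - I k.+1)).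
  rewrite (eq_bigr (fun k => - (I k.+1 - I k))); last by move=> k _; rewrite opprB.
  by rewrite sumrN telescope_sumr// opprB.
apply: le_trans (ler_norm_sum _ _ _) _.
apply: (@le_trans _ _ (\sum_(k < n) M ^+ n * (fine (mu (@normball R n L)) + 1))).
  by apply: ler_sum => k _; exact: step.
by rewrite sumr_const card_ord mulr_natl lexx.
Qed.

(** Averaging the rescaled and shifted [u] against [rho] is averaging [u] against the product of the
    [k th(k t + d_i)]. Each such factor has the same integral as [th], so their difference has the
    compactly supported primitive [S(t) - S(k t + d_i)] and [hybrid_bound] applies. The uses are
    [k = 2], [d = 0] (halving the scale) and [k = 1] (a shift). *)
Lemma averaging_kernel_exists : exists (rho : 'rV[R]_n -> R) (C : R),
  [/\ test_function rho, forall y, 0 <= rho y,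
      0 < fine (\int[mu]_x (rho x)%:E)%E,
      forall y, 1 < `|y| -> rho y = 0 &
      0 <= C /\ forall p u (k : R) (d : 'rV[R]_n), 1 <= p -> sobolev_le p 1 u ->
        1 <= k <= 2 -> `|d| <= 1 ->
        `|fine (\int[mu]_x (u x * rho x)%:E)%E -
          fine (\int[mu]_x (u (k^-1 *: x + - (k^-1 *: d)) * rho x)%:E)%E| <= C].
Proof.
have [th [S [[sth th0 thz thp] [sS dS S0 S1 S01]]]] := smooth_step_exists R.
have cth := smooth1_continuous sth.
have [M0 M00 thM] : exists2 M0 : R, 0 <= M0 & forall t, `|th t| <= M0.
  have : compact (th @` `[0%R, 1%R]%classic).
    apply: continuous_compact; first exact: continuous_subspaceT.
    exact: segment_compact.
  move=> /compact_bounded/bounded_setP[M HM].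
  exists (Num.max 0 M) => [|t]; first by rewrite le_max lexx.
  have [/andP[t0 t1]|t01] := boolP (0 < t < 1); last by rewrite thz// normr0 le_max lexx.
  rewrite le_max; apply/orP; right; apply: HM; exists t => //.
  by rewrite /= in_itv/= !ltW.
(* One bound for all factors: [k th] is at most [2 M0] as [k <= 2], and a difference of two steps is
   at most [1]. *)
pose M : R := 2 * M0 + 1.
pose rho : 'rV[R]_n -> R := tensor (fun=> th).
have thL (L : R) t : 1 <= L -> L < `|t| -> th t = 0.
  move=> L1 Lt; rewrite thz//; apply/negP => /andP[t0 t1].
  rewrite gtr0_norm// in Lt.
  by have := lt_trans Lt t1; rewrite ltNge L1.
have trho : test_function rho.
  by apply: (@test_function_tensor _ _ _ 1) => // i t; exact: thL.
have rho0 y : 0 <= rho y by apply: prodr_ge0.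
have crho : continuous rho by have [/(_ [::])[]] := trho.
have mrho : measurable_fun setT rho by exact: continuous_measurable_rV.
have l1 : loc_integrable (cst 1 : 'rV[R]_n -> R).
  by apply: loc_integrable_continuous; exact: cst_continuous.
have irho : mu.-integrable setT (fun x => (rho x)%:E).
  have := integrable_mul_test l1 trho.
  by apply: eq_integrable => // x _; rewrite /= mul1r.
have rho1 y : 1 < `|y| -> rho y = 0.
  move=> Ly; have : mx_norm y != 0 by rewrite gt_eqF// (lt_trans ltr01).
  move=> /mx_norm_neq0[[i j]/= xE]; rewrite (ord1 i) in xE.
  by rewrite /rho /tensor (bigD1 j)//= (thL 1) ?mul0r// -xE.
have crho_gt0 : 0 < fine (\int[mu]_x (rho x)%:E)%E.
  rewrite fine_gt0//; apply/andP; split; last first.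
    rewrite -ge0_fin_numE; first exact: integrable_fin_num.
    by apply: integral_ge0 => x _; rewrite lee_fin.
  rewrite lt_def integral_ge0 ?andbT; last by move=> x _; rewrite lee_fin.
  apply/eqP => I0.
  have : (\int[mu]_x `|(rho x)%:E| = 0)%E.
    by rewrite -[RHS]I0; apply: eq_integral => x _; rewrite /= ger0_norm.
  have mEr : measurable_fun setT (EFin \o rho) by exact/measurable_EFinP.
  move=> /(ae_eq_integral_abs mu measurableT mEr) [N [mN N0 HN]].
  pose Q : set 'rV[R]_n := [set x | forall i, `]0%R, 1%R[%classic (x 0 i)].
  have mQ : measurable Q by exact: (measurable_box_rV (A := fun=> `]0%R, 1%R[%classic)).
  have QN : Q `<=` N.
    move=> x Qx; apply: HN => /= /(_ I) [] /eqP; rewrite gt_eqF//.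
    by apply: prodr_gt0 => i _; apply: thp; have := Qx i; rewrite /= in_itv.
  have : (mu Q <= 0)%E by rewrite -N0; apply: le_measure; rewrite ?inE.
  rewrite [X in (X <= _)%E](_ : _ =
      \prod_(i < n) (@lebesgue_measure R `]0%R, 1%R[%classic))%E; last first.
    exact: (@lebesgue_rV_box R n (fun=> `]0%R, 1%R[%classic)).
  rewrite lebesgue_measure_itv/= lte_fin ltr01 oppr0 adde0.
  by rewrite prodEFin lee_fin prodr_const expr1n ler10.
exists rho, (n%:R * (M ^+ n * (fine (mu (@normball R n 3)) + 1))); split=> //.
have M1 : 0 <= M by rewrite /M; lra.
split; first by rewrite !mulr_ge0 ?exprn_ge0// addr_ge0// fine_ge0.
move=> p u k d p1 up /andP[k1 k2] d1.
have k0 : 0 < k by lra.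
pose psi (i : 'I_n) (t : R) := k * th (k * t + d 0 i).
pose T (i : 'I_n) (t : R) := S t + -1 * S (k * t + d 0 i).
have di i : `|d 0 i| <= 1 by exact: le_trans (norm_coord_le _ _) d1.
have sT2 i : smooth1 (fun t => -1 * S (k * t + d 0 i)) by exact: smooth1_affine.
have dT i : (T i)^`()%classic = (fun t => th t - psi i t).
  rewrite [LHS](derive1D_smooth1 sS (sT2 i)) dS; apply/funext => t; congr (_ + _).
  rewrite derive1_affine; last by move=> x; exact: smooth1_derivable.
  by rewrite dS /psi mulN1r mulNr.
(* As [k >= 1] and [|d_i| <= 1], beyond [3] both arguments have left the unit interval on the same
   side; this fixes the support radius. *)
have aff_large i t : 3 < `|t| -> (0 <= t /\ 1 <= k * t + d 0 i /\ 1 <= t) \/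
    (t < 0 /\ k * t + d 0 i <= 0).
  have := di i; rewrite ler_norml => /andP[? ?] t3.
  have [t0|t0] := leP 0 t.
    by rewrite ger0_norm// in t3; left; split=> //; split; nra.
  by rewrite ltr0_norm// in t3; right; split=> //; nra.
have psiL i t : 3 < `|t| -> psi i t = 0.
  move=> /(aff_large i); rewrite /psi => -[[_ [t1 _]]|[_ t1]].
    by rewrite thz ?mulr0// negb_and -!leNgt t1 orbT.
  by rewrite thz ?mulr0// negb_and -!leNgt t1.
have TL i t : 3 < `|t| -> T i t = 0.
  move=> /(aff_large i); rewrite /T => -[[_ [t1 t2]]|[t1 t2]].
    by rewrite !S1// mulr1 subrr.
  by rewrite !S0// ?ltW// mulr0 addr0.
have psiM i t : `|psi i t| <= M.
  rewrite /psi normrM gtr0_norm//; have := thM (k * t + d 0 i).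
  have := normr_ge0 (th (k * t + d 0 i)); rewrite /M; nra.
have TM i t : `|T i t| <= M.
  rewrite /T; move: (S01 t) (S01 (k * t + d 0 i)) => /andP[? ?] /andP[? ?].
  by rewrite ler_norml /M; apply/andP; split; lra.
have thM' (i : 'I_n) t : `|th t| <= M by apply: le_trans (thM t) _; rewrite /M; lra.
have thL' (i : 'I_n) t : 3 < `|t| -> th t = 0 by apply: thL; lra.
have spsi i : smooth1 (psi i) by exact: smooth1_affine.
have := @hybrid_bound p u (fun=> th) psi T M 3 p1 M1 up (fun=> sth)
  spsi (fun i => smooth1D sS (sT2 i)) dT
  thL' psiL TL thM' psiM TM.
apply: le_trans; rewrite le_eqVlt; apply/orP; left; apply/eqP.
congr (`|_ - _|); congr fine.
have [cu _] := up.
have II : 1%:M *m (1%:M : 'M[R]_n)^T = 1%:M by rewrite trmx1 mulmx1.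
have ki : 0 < k^-1 by rewrite invr_gt0.
have cpsi : continuous (tensor psi).
  by apply: tensor_continuous => i; apply: smooth1_continuous; exact: smooth1_affine.
have mF : measurable_fun setT (fun x => u x * tensor psi x).
  by apply: measurable_funM; exact: continuous_measurable_rV.
pose uA (x : 'rV[R]_n) := u (k^-1 *: x + - (k^-1 *: d)).
have cuA : continuous uA.
  have := @continuous_affine_rV R n k^-1 1%:M (- (k^-1 *: d)) u cu.
  by rewrite /comp; under eq_fun do rewrite mulmx1.
have iuA := integrable_mul_test (loc_integrable_continuous cuA) trho.
(* The substitution has Jacobian [k^-n], which cancels the [n] factors [k] of [psi]. *)
rewrite (integral_affine_rV (- (k^-1 *: d)) ki II mF).
transitivity ((k^-1 ^+ n)%:E * ((k ^+ n)%:E * \int[mu]_x (uA x * rho x)%:E))%E.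
  rewrite muleA -EFinM -exprMn mulVf ?gt_eqF// expr1n mul1e.
  by [].
congr (_ * _)%E; rewrite -integralZl//; apply: eq_integral => x _.
rewrite -EFinM mulmx1 /uA; congr EFin; rewrite mulrCA; congr (_ * _).
rewrite /tensor.
have -> : k ^+ n = \prod_(i < n) k by rewrite prodr_const card_ord.
rewrite /rho /tensor -big_split/=; apply: eq_bigr => i _.
by rewrite /psi !mxE; congr (_ * th _); field; rewrite gt_eqF.
Qed.

End morrey.

Section morrey_inequality.
Variables (R : realType) (n : nat) (p : R).
Local Notation mu := (lebesgue_rV R n).
Implicit Types (u v : 'rV[R]_n -> R).
Hypotheses (n0 : (0 < n)%N) (np : n%:R < p).

Let p1 : 1 <= p.
Proof. by apply: ltW; apply: le_lt_trans np; rewrite ler1n. Qed.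

Let p0 : 0 < p. Proof. exact: lt_le_trans p1. Qed.

Let alpha : R := 1 - n%:R / p.

Lemma morrey_exponent_gt0 : 0 < alpha.
Proof. by rewrite subr_gt0 ltr_pdivrMr// mul1r. Qed.

Lemma morrey_exponentE : alpha * p = p - n%:R.
Proof. by rewrite /alpha mulrBl mul1r divfK// gt_eqF. Qed.

(* [s^-alpha u(s y + x)] has the same energy as [u]. *)
Lemma sobolev_le_rescale (s : R) (x : 'rV[R]_n) u : 0 < s -> sobolev_le p 1 u ->
  sobolev_le p 1 (fun y => s `^ (- alpha) * u (s *: y + x)).
Proof.
move=> s0 /(sobolev_le_scale x p1 s0) /(sobolev_leZ (s `^ (- alpha))).
apply: le_sobolev_le; rewrite mulr1 ger0_norm ?powR_ge0//.
rewrite -powRrM mulNr morrey_exponentE -powRD ?addNr ?powRr0//.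
by rewrite (gt_eqF s0) implybT.
Qed.

(** Let [a u x k] be the average of [u] at scale [2^-k] about [x]. Since the rescaling of
    [sobolev_le_rescale] keeps the energy at most [1], consecutive averages differ by at most
    [C q^k] with [q = 2^-alpha < 1], and they converge to [c u(x)]. At scale [1], the averages about
    [x] and [x + b] differ by at most [C]. *)
Lemma morrey_unit : exists2 K : R, 0 <= K &
  forall u, sobolev_le p 1 u -> forall x b, `|b| <= 1 -> `|u x - u (x + b)| <= K.
Proof.
have [rho [C [trho rho0 c0 rho1 [C0 HC]]]] := averaging_kernel_exists R n0.
pose c := fine (\int[mu]_x (rho x)%:E)%E.
pose J u := fine (\int[mu]_x (u x * rho x)%:E)%E.
have lcont u : continuous u -> loc_integrable u := @loc_integrable_continuous R n u.
have ir u : continuous u -> mu.-integrable setT (fun x => (u x * rho x)%:E).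
  by move=> cu; apply: integrable_mul_test => //; exact: lcont.
have JZ a u : continuous u -> J (fun x => a * u x) = a * J u.
  move=> cu; rewrite /J.
  under eq_integral do rewrite -mulrA EFinM.
  rewrite integralZl//; last exact: ir.
  by rewrite fineM// (integrable_fin_num measurableT)//; exact: ir.
have cres u (s : R) x : continuous u -> continuous (fun y : 'rV[R]_n => u (s *: y + x)).
  move=> cu; have := @continuous_affine_rV R n s 1%:M x u cu.
  by rewrite /comp; under eq_fun do rewrite mulmx1.
pose q : R := (2^-1) `^ alpha.
have q0 : 0 <= q by exact: powR_ge0.
have q1 : q < 1.
  apply: (@lt_le_trans _ _ (1 `^ alpha)); last by rewrite powR1.
  apply: gt0_ltr_powR; rewrite ?nnegrE ?morrey_exponent_gt0 ?invr_ge0//.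
  by rewrite invf_lt1// ltr1n.
pose s (k : nat) : R := 2^-1 ^+ k.
have s0 k : 0 < s k by rewrite exprn_gt0// invr_gt0.
have sq k : s k `^ alpha = q ^+ k.
  rewrite /s -powR_mulrn ?invr_ge0// -powRrM mulrC powRrM powR_mulrn//.
pose a u x k := J (fun y => u (s k *: y + x)).
have step u x k : sobolev_le p 1 u -> `|a u x k - a u x k.+1| <= C * q ^+ k.
  move=> up; have [cu _] := up.
  have uk := sobolev_le_rescale x (s0 k) up.
  have k12 : 1 <= (2 : R) <= 2 by rewrite ler1n lexx.
  have d0 : `|0 : 'rV[R]_n| <= 1 by rewrite normr0.
  have := HC p _ 2 0 p1 uk k12 d0.
  rewrite -/(J _) -/(J _) JZ; last exact: cres.
  have -> : J (fun y => s k `^ (- alpha) *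
        u (s k *: (2^-1 *: y + - (2^-1 *: 0)) + x)) =
      s k `^ (- alpha) * a u x k.+1.
    rewrite -JZ; last exact: cres.
    by congr J; apply/funext => y; rewrite scaler0 subr0 scalerA /s exprSr.
  rewrite -mulrBr normrM (ger0_norm (powR_ge0 _ _)) powRN sq => H.
  have sk : 0 < q ^+ k by rewrite -sq powR_gt0.
  by move: H; rewrite mulrC ler_pdivrMr.
have geom u x N : sobolev_le p 1 u -> `|a u x 0 - a u x N| <= C / (1 - q).
  move=> up.
  have : `|a u x 0 - a u x N| <= \sum_(0 <= k < N) C * q ^+ k.
    elim: N => [|N ih]; first by rewrite subrr normr0 big_geq.
    rewrite big_nat_recr//=; apply: le_trans (lerD ih (step u x N up)).
    by rewrite -[X in `|X|](_ : a u x 0 - a u x N + (a u x N - a u x N.+1) = _) ?ler_normD//; ring.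
  move=> /le_trans; apply; rewrite -mulr_sumr; apply: ler_wpM2l => //.
  have q10 : 0 < 1 - q by rewrite subr_gt0.
  rewrite -[leRHS]mul1r ler_pdivlMr//.
  have := subrX1 q N; rewrite big_mkord => E.
  have -> : (\sum_(i < N) q ^+ i) * (1 - q) = 1 - q ^+ N.
    by rewrite -opprB mulrN mulrC -E opprB.
  by rewrite gerBl exprn_ge0.
have lim u x e : continuous u -> 0 < e -> exists N, `|a u x N - c * u x| <= e * c.
  move=> cu e0; have /continuous_rVP/(_ x e e0)[d d0 dP] := cu.
  have [N Nd] : exists N, s N < d.
    have : s N @[N --> \oo] --> (0 : R).
      by apply: cvg_expr; rewrite ger0_norm ?invr_ge0// invf_lt1// ltr1n.
    move=> /cvgrPdist_lt/(_ d d0) [N _ /(_ N (leqnn N))].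
    by rewrite sub0r normrN (gtr0_norm (s0 N)) => ?; exists N.
  exists N.
  have irho : mu.-integrable setT (fun y => (rho y)%:E).
    have := ir (cst 1) (@cst_continuous _ _ _).
    by apply: eq_integrable => // y _; rewrite /= mul1r.
  have cE : (\int[mu]_x (rho x)%:E = c%:E)%E by rewrite fineK// integrable_fin_num.
  have iN := ir _ (cres u (s N) x cu).
  have -> : a u x N - c * u x =
      fine (\int[mu]_y ((u (s N *: y + x) - u x) * rho y)%:E)%E.
    have -> : (\int[mu]_y ((u (s N *: y + x)%R - u x) * rho y)%:E =
        \int[mu]_y (u (s N *: y + x)%R * rho y)%:E - (u x)%:E * c%:E)%E.
      rewrite -cE -integralZl// -integralB//.
        by apply: eq_integral => y _; rewrite -EFinM -EFinB mulrBl.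
      exact: integrableZl.
    rewrite fineB//; last exact: integrable_fin_num.
    by rewrite /= mulrC.
  have mint : measurable_fun setT
      (fun y : 'rV[R]_n => (u (s N *: y + x) - u x) * rho y).
    apply: measurable_funM.
      by apply: measurable_funB => //; apply: continuous_measurable_rV; exact: cres.
    by apply: continuous_measurable_rV; have [/(_ [::])[]] := trho.
  have H : (`|\int[mu]_y ((u (s N *: y + x) - u x) * rho y)%:E| <= (e * c)%:E)%E.
    apply: le_trans (le_abse_integral mu measurableT _) _.
      exact/measurable_EFinP.
    rewrite EFinM -cE -ge0_integralZl//; last 3 first.
      by apply/measurable_EFinP; apply: continuous_measurable_rV; have [/(_ [::])[]] := trho.
      by move=> y _; rewrite lee_fin.
      by rewrite lee_fin ltW.
    apply: ge0_le_integral => //.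
      by apply/measurable_EFinP; apply: measurableT_comp.
      apply/measurable_EFinP; apply: measurable_funM => //.
      by apply: continuous_measurable_rV; have [/(_ [::])[]] := trho.
    move=> y _; rewrite -EFinM /= lee_fin normrM (ger0_norm (rho0 y)).
    have [y1|y1] := leP `|y| 1; last by rewrite rho1// !mulr0.
    apply: ler_wpM2r => //; rewrite distrC ltW//; apply: dP.
    rewrite opprD addrCA subrr addr0 normrN normrZ (gtr0_norm (s0 N)).
    by apply: le_lt_trans Nd; rewrite ler_piMr// ltW.
  (* For an infinite value [fine] is [0], and the bound is trivial. *)
  by move: H; case: (integral _ _ _) => [r| |]//=; rewrite ?lee_fin// normr0 => _; rewrite mulr_ge0// ltW.
(* Two geometric series, one at each point, and one shift, divided by the mass of the kernel. *)
exists ((2 * (C / (1 - q)) + C) / c).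
  by rewrite divr_ge0 ?(ltW c0)// addr_ge0// mulr_ge0// divr_ge0// subr_ge0 ltW.
move=> u up x b b1; have [cu _] := up.
have center y : `|a u y 0 - c * u y| <= C / (1 - q).
  apply/ler_addgt0Pr => e e0.
  have [N HN] := lim u y (e / c) cu (divr_gt0 e0 c0).
  rewrite divfK ?gt_eqF// in HN.
  apply: le_trans (lerD (geom u y N up) HN).
  by rewrite -[X in `|X| <= _](_ : a u y 0 - a u y N + (a u y N - c * u y) = _) ?ler_normD//; ring.
have trans : `|a u x 0 - a u (x + b) 0| <= C.
  have := sobolev_le_rescale x ltr01 up; rewrite powR1 => u1.
  have k12 : 1 <= (1 : R) <= 2 by rewrite lexx/= ler1n.
  have nb : `|- b| <= 1 by rewrite normrN.
  (* With [k = 1] and [d = -b] the comparison map is the translation by [b]. *)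
  have := HC p _ 1 (- b) p1 u1 k12 nb.
  rewrite -/(J _) -/(J _) /a /s expr0.
  have -> : J (fun y => 1 * u (1 *: y + x)) = J (fun y => u (1 *: y + x)).
    by congr J; apply/funext => y; rewrite mul1r.
  have -> // : J (fun y => 1 * u (1 *: (1^-1 *: y + - (1^-1 *: - b)) + x)) =
      J (fun y => u (1 *: y + (x + b))).
  congr J; apply/funext => y.
  by rewrite mul1r invr1 !scale1r opprK -addrA (addrC b).
rewrite ler_pdivlMr// -{1}[c](ger0_norm (ltW c0)) -normrM mulrC mulrBr.
have := center x; have := center (x + b); rewrite !ler_norml.
move: trans; rewrite ler_norml.
rewrite -/c; move: (C / (1 - q)) (c * u x) (c * u (x + b)) => Z X Y.
move: (a u x 0) (a u (x + b) 0) => A B.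
by move=> /andP[? ?] /andP[? ?] /andP[? ?]; apply/andP; split; lra.
Qed.

(** Division by [M] and rescaling about [x] by the max-norm distance [r] reduce to [morrey_unit]. *)
Theorem morrey : exists2 K : R, 0 <= K & forall u (M : R), 0 < M ->
  sobolev_le p (M `^ p) u -> forall x y, `|u x - u y| <= K * M * `|x - y| `^ alpha.
Proof.
have [K K0 HK] := morrey_unit; exists K => // u M M0 uM x y.
have [->|xy] := eqVneq x y.
  by rewrite !subrr !normr0 mulr_ge0 ?powR_ge0// mulr_ge0// ltW.
have r0 : 0 < `|x - y| by rewrite normr_gt0 subr_eq0.
set r := `|x - y|.
have u1 : sobolev_le p 1 (fun z => M^-1 * u z).
  apply: le_sobolev_le (sobolev_leZ M^-1 uM).
  rewrite ger0_norm ?invr_ge0 ?(ltW M0)// -powRM ?invr_ge0 ?(ltW M0)//.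
  by rewrite mulVf ?gt_eqF// powR1.
have := HK _ (sobolev_le_rescale x r0 u1) 0 (r^-1 *: (y - x)).
rewrite normrZ ger0_norm ?invr_ge0 ?(ltW r0)// [`|y - x|]distrC mulVf ?gt_eqF//.
move=> /(_ (lexx _)).
rewrite scaler0 !add0r scalerA mulfV ?gt_eqF// scale1r subrK.
rewrite -mulrBr normrM (ger0_norm (powR_ge0 _ _)) -mulrBr normrM.
rewrite ger0_norm ?invr_ge0 ?(ltW M0)// powRN.
have ra : 0 < r `^ alpha by rewrite powR_gt0.
rewrite ler_pdivrMl// ler_pdivrMl// => H; apply: le_trans H _.
by rewrite le_eqVlt; apply/orP; left; apply/eqP; ring.
Qed.

End morrey_inequality.

(** * Almost minimisers *)

Section sequences.
Variable R : realType.
Implicit Types (a b : R ^nat) (C : R).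

Lemma cvg_of_cauchy_rate a b : (forall k l, (k <= l)%N -> `|a k - a l| <= b k) ->
  b k @[k --> \oo] --> (0 : R) ->
  exists2 l : R, a k @[k --> \oo] --> l & forall k, `|a k - l| <= b k.
Proof.
move=> ab b0.
have ca : cvgn a.
  apply/cauchy_cvgP; apply: cauchy_exP => e e0.
  have /cvgrPdist_lt/(_ e e0)[N _ HN] := b0.
  exists (a N); exists N => // k /= Nk; rewrite /ball/=.
  apply: le_lt_trans (ab N k Nk) _; apply: le_lt_trans (ler_norm _) _.
  by have := HN N (leqnn N); rewrite sub0r normrN.
exists (limn a) => // k.
have H : `|a k - a l| @[l --> \oo] --> `|a k - limn a|.
  by apply: cvg_norm; apply: cvgB => //; exact: cvg_cst.
rewrite -(cvg_lim _ H)//; apply: limr_le; first by apply/cvg_ex; eexists; exact: H.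
by exists k => // l /= kl; exact: ab.
Qed.

Lemma geometric_cauchy_rate a C : (forall k, `|a k - a k.+1| <= C * 2^-1 ^+ k) ->
  forall k l, (k <= l)%N -> `|a k - a l| <= 2 * C * 2^-1 ^+ k.
Proof.
move=> aC k l kl.
have C0 : 0 <= C by have := aC 0; rewrite expr0 mulr1; exact: le_trans.
(* Subtracting the remaining tail makes the bound telescope in the induction. *)
suff H (m : nat) : `|a k - a (k + m)%N| <= 2 * C * 2^-1 ^+ k - 2 * C * 2^-1 ^+ (k + m)%N.
  rewrite -(subnKC kl); apply: le_trans (H _) _.
  by rewrite gerBl mulr_ge0// ?exprn_ge0// ?invr_ge0// mulr_ge0.
elim: m => [|m ih]; first by rewrite addn0 !subrr normr0.
rewrite addnS.
have -> : a k - a (k + m)%N.+1 = (a k - a (k + m)%N) + (a (k + m)%N - a (k + m)%N.+1) by ring.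
apply: le_trans (ler_normD _ _) _.
apply: le_trans (lerD ih (aC _)) _.
rewrite exprS; set z := 2^-1 ^+ (k + m)%N.
by rewrite le_eqVlt; apply/orP; left; apply/eqP; field.
Qed.

Lemma cvg_expr_half : (2^-1 : R) ^+ k @[k --> \oo] --> (0 : R).
Proof. by apply: cvg_expr; rewrite ger0_norm ?invr_ge0// invf_lt1// ltr1n. Qed.

Lemma powR_cvg_nneg a (l p : R) : 0 < p -> (forall k, 0 <= a k) ->
  a k @[k --> \oo] --> l -> (a k `^ p) @[k --> \oo] --> l `^ p.
Proof.
move=> p0 a0 al.
have l0 : 0 <= l.
  by rewrite -(cvg_lim _ al)//; apply: limr_ge; [apply/cvg_ex; exists l|exact: nearW].
have [l00|ln0] := eqVneq l 0; last first.
  have lp : 0 < l by rewrite lt_def ln0.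
  have cp : {for l, continuous (fun x : R => x `^ p)}.
    apply: differentiable_continuous; apply/derivable1_diffP.
    by apply: derivable_powR; rewrite in_itv/= lp.
  exact: (continuous_cvg _ cp al).
rewrite l00 powR0 ?gt_eqF//; apply/cvgrPdist_le => e e0.
pose d := e `^ p^-1.
have d0 : 0 < d by exact: powR_gt0.
rewrite l00 in al; move/cvgrPdist_lt : al => /(_ d d0).
apply: filterS => k; rewrite !sub0r !normrN (ger0_norm (a0 k)) => ad.
rewrite ger0_norm ?powR_ge0//.
apply: (@le_trans _ _ (d `^ p)).
  by apply: ge0_ler_powR; rewrite ?nnegrE ?(ltW p0)// ltW.
by rewrite /d -powRrM mulVf ?gt_eqF// powRr1// ltW.
Qed.

End sequences.

(** * Limits of vector fields and of weak gradients in energy *)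

Section energy_limits.
Variables (R : realType) (n : nat) (p : R).
Local Notation mu := (lebesgue_rV R n).
Hypothesis p0 : 0 < p.

Lemma enorm_cvg (H_ : nat -> 'rV[R]_n) (H : 'rV[R]_n) :
  (forall i, H_ k 0 i @[k --> \oo] --> H 0 i) ->
  enorm (H_ k) @[k --> \oo] --> enorm H.
Proof.
move=> HH; apply/cvgrPdist_lt => e e0.
have /continuous_rVP/(_ H e e0)[d d0 dP] := @enorm_continuous R n.
have : \forall k \near \oo, forall i, `|H 0 i - H_ k 0 i| < d.
  apply: filter_forall => i.
  by have /cvgrPdist_lt/(_ d d0) := HH i.
apply: filterS => k Hk; apply: dP.
rewrite [ltLHS]mx_normrE; apply: bigmax_lt => // -[i j] _ /=.
by rewrite (ord1 i) !mxE.
Qed.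

(** Fatou's lemma; this is the lower semicontinuity that weak compactness would otherwise supply. *)
Lemma energy_fatou (H_ : nat -> 'rV[R]_n -> 'rV[R]_n)
    (H : 'rV[R]_n -> 'rV[R]_n) (c : R) :
  (forall k, measurable_fun setT (H_ k)) -> measurable_fun setT H ->
  {ae mu, forall x, forall i, H_ k x 0 i @[k --> \oo] --> H x 0 i} ->
  (forall k, energy p (H_ k) <= c%:E)%E -> (energy p H <= c%:E)%E.
Proof.
move=> mH_ mH HH Hc.
pose f k x := (enorm (H_ k x) `^ p)%:E.
have mf k : measurable_fun setT (f k) by exact: measurable_energy.
have f0 k x : setT x -> (0 <= f k x)%E by move=> _; rewrite lee_fin powR_ge0.
have := fatou mu measurableT mf f0.
rewrite (_ : (\int[mu]_x limn_einf _)%E = energy p H); last first.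
  apply: ge0_ae_eq_integral => //.
  - rewrite (_ : (fun _ => _) = (fun x => - limn_esup (-%E \o f^~ x))%E).
      apply: measurableT_comp => //; apply: measurable_fun_limn_esup => k.
      exact: measurableT_comp.
    by apply/funext => x; rewrite limn_esupN oppeK.
  - exact: measurable_energy.
  - move=> x _; rewrite limn_einf_lim; apply: lime_ge; first exact: is_cvg_einfs.
    by apply: nearW => k; apply: le_ereal_inf_tmp => _ [l _ <-]; exact: f0.
  - by move=> x _; rewrite lee_fin powR_ge0.
  - apply: filterS HH => x HHx _.
    have : f k x @[k --> \oo] --> (enorm (H x) `^ p)%:E.
      apply: cvg_EFin; first exact: nearW.
      apply: powR_cvg_nneg => //; first by move=> k; exact: enorm_ge0.
      exact: enorm_cvg.
    by move=> /cvg_limn_einf_sup[].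
move=> /le_trans; apply; rewrite limn_einf_lim.
apply: lime_le; first exact: is_cvg_einfs.
apply: nearW => k; apply: le_trans (Hc k).
by apply: ereal_inf_lbound; exists k => //=.
Qed.

End energy_limits.

Section energy_cauchy.
Variables (R : realType) (n : nat) (p : R).
Local Notation mu := (lebesgue_rV R n).
Hypotheses (n0 : (0 < n)%N) (np : n%:R < p).

Let p1 : 1 <= p.
Proof. by apply: ltW; apply: le_lt_trans np; rewrite ler1n. Qed.

Let p0 : 0 < p. Proof. exact: lt_le_trans p1. Qed.

Lemma measurable_subv (G H : 'rV[R]_n -> 'rV[R]_n) : measurable_fun setT G ->
  measurable_fun setT H -> measurable_fun setT (fun x => G x - H x).
Proof.
move=> mG mH; have := measurable_lin 1 (-1) mG mH.
by under eq_fun do rewrite scale1r scaleN1r.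
Qed.

(** The argument of Riesz and Fischer. The rate [4^-k] leaves room to multiply the [k]-th increment
    by [2^k] and still have summable energies. Where the sum of these densities is finite, the
    increments are at most a constant times [2^-k]. *)
Lemma energy_cauchy_ae_cvg (G_ : nat -> 'rV[R]_n -> 'rV[R]_n) :
  (forall k, measurable_fun setT (G_ k)) ->
  (forall k, energy p (fun x => G_ k x - G_ k.+1 x)%R <= ((4^-1 ^+ k) `^ p)%:E)%E ->
  exists2 G : 'rV[R]_n -> 'rV[R]_n, measurable_fun setT G &
    {ae mu, forall x, forall i, G_ k x 0 i @[k --> \oo] --> G x 0 i}.
Proof.
move=> mG GE.
pose d k x := G_ k x - G_ k.+1 x.
have md k : measurable_fun setT (d k) by exact: measurable_subv.
pose D k x := (enorm (2 ^+ k *: d k x) `^ p)%:E.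
have m2d k : measurable_fun setT (fun x => 2 ^+ k *: d k x).
  have := measurable_lin (2 ^+ k) 0 (md k) (md k).
  by under eq_fun do rewrite scale0r addr0.
have mD k : measurable_fun setT (D k) by exact: measurable_energy.
have D0 k x : (0 <= D k x)%E by rewrite lee_fin powR_ge0.
have ID k : (\int[mu]_x D k x <= (2 / (2 ^ k.+1)%:R)%:E)%E.
  rewrite -[leLHS]/(energy p (fun x => 2 ^+ k *: d k x)).
  rewrite [leLHS](energyZ p (2 ^+ k) (md k)).
  apply: (@le_trans _ _ ((`|2 ^+ k| `^ p)%:E * ((4^-1 ^+ k) `^ p)%:E)%E).
    by apply: lee_wpmul2l; [rewrite lee_fin powR_ge0|exact: GE].
  rewrite -EFinM lee_fin ger0_norm ?exprn_ge0// -powRM ?exprn_ge0 ?invr_ge0//.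
  have -> : 2 / (2 ^ k.+1)%:R = 2^-1 ^+ k :> R.
    by rewrite natrX exprS invfM mulrA mulfV// mul1r exprVn.
  have -> : 2 ^+ k * 4^-1 ^+ k = 2^-1 ^+ k :> R.
    by rewrite -exprMn; congr (_ ^+ _); field.
  apply: ge1r_powR => //; rewrite exprn_gt0 ?invr_gt0//=.
  by rewrite exprn_ile1 ?invr_ge0// invf_le1// ler1n.
pose S x := (\sum_(0 <= k <oo) D k x)%E.
have mS : measurable_fun setT S.
  exact: (ge0_emeasurable_sum (P := xpredT)).
have S0 x : (0 <= S x)%E by apply: nneseries_ge0 => k _ _; exact: D0.
have iS : mu.-integrable setT S.
  apply/integrableP; split => //.
  under eq_integral do rewrite gee0_abs//.
  rewrite /S integral_nneseries//.
  apply: (@le_lt_trans _ _ (2%:E)); last exact: ltry.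
  apply: le_trans (epsilon_trick0 xpredT (ler0n R 2)).
  apply: lee_nneseries => k *; first by apply: integral_ge0 => x _.
  exact: ID.
(* Multiplication by the indicator of [A] makes the fields converge everywhere, so the limit is
   measurable; [A] has full measure. *)
pose A := [set x | S x \is a fin_num].
have mA : measurable A by rewrite -[A]setTI; exact: emeasurable_fin_num.
have Acvg x i : exists l : R, G_ k x 0 i * \1_A x @[k --> \oo] --> l.
  rewrite indicE; case: (boolP (x \in A)) => [/set_mem Ax|_]; last first.
    exists 0; rewrite (_ : (fun _ => _) = cst 0); first exact: cvg_cst.
    by apply/funext => k; rewrite mulr0.
  pose r := fine (S x).
  have Dr k : enorm (2 ^+ k *: d k x) `^ p <= r.
    rewrite -lee_fin /r fineK//.
    apply: le_trans (@nneseries_lim_ge _ (fun k => D k x) xpredT 0 k.+1 _); last first.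
      by move=> l _ _; exact: D0.
    rewrite big_nat_recr//= leeDr//.
    by apply: sume_ge0 => l _; exact: D0.
  have r0 : 0 <= r by apply: le_trans (Dr 0); exact: powR_ge0.
  pose C := r `^ p^-1.
  have dC k : `|G_ k x 0 i - G_ k.+1 x 0 i| <= C * 2^-1 ^+ k.
    have e1 : enorm (2 ^+ k *: d k x) <= C.
      have E y : 0 <= y -> y = (y `^ p) `^ p^-1.
        by move=> y0; rewrite -powRrM mulfV ?gt_eqF// powRr1.
      rewrite [leLHS]E ?enorm_ge0//.
      by apply: ge0_ler_powR; rewrite ?nnegrE ?powR_ge0 ?invr_ge0 ?(ltW p0).
    rewrite enormZ ger0_norm ?exprn_ge0// in e1.
    have := norm_coord_le_enorm (d k x) i; rewrite /d !mxE => e2.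
    apply: le_trans e2 _; rewrite exprVn ler_pdivlMr ?exprn_gt0//.
    by rewrite mulrC.
  have C0 : (2 * C * 2^-1 ^+ k) @[k --> \oo] --> (0 : R).
    rewrite -[X in _ --> X](mulr0 (2 * C)).
    by apply: cvgM; [exact: cvg_cst|exact: cvg_expr_half].
  have [l Gl _] := cvg_of_cauchy_rate (geometric_cauchy_rate dC) C0.
  by exists l; rewrite (_ : (fun _ => _) = (fun k => G_ k x 0 i))//;
    apply/funext => k; rewrite mulr1.
have /choice[G GP] : forall xi : 'rV[R]_n * 'I_n, exists l : R,
    G_ k xi.1 0 xi.2 * \1_A xi.1 @[k --> \oo] --> l.
  by move=> [x i]; exact: Acvg.
exists (fun x => \row_i G (x, i)).
  apply: measurable_fun_rV => i; under eq_fun do rewrite mxE.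
  apply: (@measurable_fun_cvg _ _ _ _ (fun k x => G_ k x 0 i * \1_A x)).
    move=> k; apply: measurable_funM; last exact: measurable_indic.
    exact: (measurableT_comp (measurable_coord i)).
  by move=> x _; exact: (GP (x, i)).
have := integrable_ae measurableT iS.
apply: filterS => x /(_ I) Ax i; rewrite mxE.
have := GP (x, i); rewrite indicE mem_set//.
by under eq_fun do rewrite /= mulr1.
Qed.

End energy_cauchy.

Section weak_gradient_closed.
Variables (R : realType) (n : nat) (p : R).
Local Notation mu := (lebesgue_rV R n).
Hypothesis p1 : 1 <= p.

Lemma integral_normball_bound (f : 'rV[R]_n -> R) (M L : R) : 0 <= M ->
  measurable_fun setT f -> (forall x, `|x| <= L -> `|f x| <= M) ->
  (forall x, L < `|x| -> f x = 0) ->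
  (\int[mu]_x `|f x|%:E <= (M * fine (mu (@normball R n L)))%:E)%E.
Proof.
move=> M0 mf fM fL.
have mK := @measurable_normball R n L.
apply: (@le_trans _ _ (\int[mu]_x (M%:E * (\1_(@normball R n L) x)%:E))%E).
  apply: ge0_le_integral => //.
  - by apply/measurable_EFinP; exact: measurableT_comp.
  - by apply/measurable_EFinP; apply: measurable_funM => //; exact: measurable_indic.
  move=> x _; rewrite -EFinM lee_fin indicE.
  have [xL|Lx] := leP `|x| L; first by rewrite mem_set// mulr1 fM.
  by rewrite fL// normr0 mulr_ge0.
rewrite ge0_integralZl//; last by apply/measurable_EFinP; exact: measurable_indic.
rewrite integral_indic// setIT EFinM fineK// ge0_fin_numE//.
exact: normball_lty.
Qed.

(** The defect [A + B] in the integration by parts equals the integral of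
    [(w - u) D_i f + (G - H)_i f], because [u] with [H] has no defect. The first term is small by
    uniform closeness on the support, the second by [integral_energy_bound]. *)
Lemma weak_gradient_closed (w : 'rV[R]_n -> R) (G : 'rV[R]_n -> 'rV[R]_n) :
  continuous w -> measurable_fun setT G -> (energy p G < +oo)%E ->
  (forall L e : R, 0 < e -> exists u H, [/\ continuous u, weak_gradient u H,
     forall x, `|x| <= L -> `|w x - u x| <= e &
     (energy p (fun x => G x - H x)%R <= e%:E)%E]) ->
  weak_gradient w G.
Proof.
move=> cw mG Gfin approx i.
have lG := loc_integrable_energy i p1 mG Gfin.
have lw := loc_integrable_continuous cw.
split=> // f tf.
have tf' := test_function_partial i tf.
have [M [L [M0 fM fL]]] := test_function_bounded tf.
have [M' [L' [M'0 fM' fL']]] := test_function_bounded tf'.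
have mf : measurable_fun setT f.
  by apply: continuous_measurable_rV; have [/(_ [::])[]] := tf.
have mf' : measurable_fun setT (partial i f).
  by apply: continuous_measurable_rV; have [/(_ [::])[]] := tf'.
have iw := integrable_mul_test lw tf'.
have iG := integrable_mul_test lG tf.
have fin_w := integrable_fin_num measurableT iw.
have fin_G := integrable_fin_num measurableT iG.
rewrite -(fineK fin_w) -(fineK fin_G) -EFinN; congr EFin.
set A := fine _; set B := fine _.
apply/eqP; rewrite -subr_eq0 opprK -normr_eq0 eq_le normr_ge0 andbT.
apply/ler_addgt0Pl => e e0; rewrite addr0.
pose V := fine (mu (@normball R n L)); pose V' := fine (mu (@normball R n L')).
have V0 : 0 <= V by rewrite fine_ge0.
have V'0 : 0 <= V' by rewrite fine_ge0.
(* The parameter [t] disposes of the term with the volume of the support; only then is [d] chosen,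
   against [t^(1-p)]. Each takes half of [e]. *)
pose t : R := e / (2 * (M * V + 1)).
have MV : 0 <= M * V by exact: mulr_ge0.
have t0 : 0 < t by rewrite divr_gt0// mulr_gt0// ltr_wpDl.
pose c := M' * V' + M * t `^ (1 - p).
have c0 : 0 <= c by rewrite addr_ge0 ?mulr_ge0 ?powR_ge0.
pose d : R := e / (2 * (c + 1)).
have d0 : 0 < d by rewrite divr_gt0// mulr_gt0// ltr_wpDl.
have [u [H [cu uH wu GH]]] := approx L' d d0.
have mH := measurable_weak_gradient uH.
have lu := loc_integrable_continuous cu.
have [lH /(_ _ tf) uHE] := uH i.
have iu := integrable_mul_test lu tf'.
have iH := integrable_mul_test lH tf.
have AB : (A + B)%:E = (\int[mu]_x ((w x - u x) * partial i f x)%:E +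
    \int[mu]_x ((G x - H x) 0%R i * f x)%:E)%E.
  have -> : (\int[mu]_x ((w x - u x) * partial i f x)%:E =
      A%:E - \int[mu]_x (u x * partial i f x)%:E)%E.
    rewrite /A fineK// -integralB//.
    by apply: eq_integral => x _; rewrite -EFinB mulrBl.
  have -> : (\int[mu]_x ((G x - H x) 0%R i * f x)%:E =
      B%:E - \int[mu]_x (H x 0%R i * f x)%:E)%E.
    rewrite /B fineK// -integralB//.
    by apply: eq_integral => x _; rewrite -EFinB !mxE mulrBl.
  rewrite uHE oppeK.
  have := integrable_fin_num measurableT iH.
  case: (\int[mu]_x _)%E => // r _.
  by rewrite -!EFinN -!EFinD; congr EFin; ring.
have mwu : measurable_fun setT (fun x => (w x - u x) * partial i f x).
  apply: measurable_funM => //.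
  by apply: measurable_funB; exact: continuous_measurable_rV.
have mGH : measurable_fun setT (fun x => G x - H x).
  have := measurable_lin 1 (-1) mG mH.
  by under eq_fun do rewrite scale1r scaleN1r.
have b1 : (`|\int[mu]_x ((w x - u x) * partial i f x)%:E| <= (d * M' * V')%:E)%E.
  apply: le_trans (le_abse_integral mu measurableT _) _; first exact/measurable_EFinP.
  apply: integral_normball_bound => //.
  - by rewrite mulr_ge0// ltW.
  - by move=> x xL; rewrite normrM ler_pM// wu.
  - by move=> x /fL' ->; rewrite mulr0.
have b2 : (`|\int[mu]_x ((G x - H x) 0%R i * f x)%:E| <=
    (M * (t * V + t `^ (1 - p) * d))%:E)%E.
  apply: le_trans (le_abse_integral mu measurableT _) _.
    apply/measurable_EFinP; apply: measurable_funM => //.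
    exact: (measurableT_comp (measurable_coord i)).
  exact: (integral_energy_bound i p1 t0 M0 mGH mf fM fL GH).
rewrite -lee_fin -[X in (X <= _)%E]/(`|(A + B)%:E|%E) AB.
apply: le_trans (lee_abs_add _ _) _.
apply: le_trans (leeD b1 b2) _; rewrite -EFinD lee_fin.
have frac (z : R) : 0 <= z -> (e : R) / (2 * (z + 1)) * z <= e / 2.
  move=> z0; have z1 : 0 < z + 1 by rewrite ltr_wpDl.
  rewrite [leLHS](_ : _ = e / 2 * (z / (z + 1))); last by field; rewrite gt_eqF.
  by rewrite ler_piMr ?divr_ge0 ?(ltW e0)// ler_pdivrMr// mul1r lerDl.
have tE : t * (M * V) <= e / 2 by exact: frac.
have dE : d * c <= e / 2 by exact: frac.
rewrite /c in dE.
have -> : d * M' * V' + M * (t * V + t `^ (1 - p) * d) =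
  d * (M' * V' + M * t `^ (1 - p)) + t * (M * V) by ring.
by rewrite (splitr e) lerD.
Qed.

End weak_gradient_closed.

Section sobolev_limit.
Variables (R : realType) (n : nat) (p : R).
Local Notation mu := (lebesgue_rV R n).
Hypotheses (n0 : (0 < n)%N) (np : n%:R < p).

Let p1 : 1 <= p.
Proof. by apply: ltW; apply: le_lt_trans np; rewrite ler1n. Qed.

Let p0 : 0 < p. Proof. exact: lt_le_trans p1. Qed.

Let q : R := 4^-1.

Let q0 : 0 < q. Proof. by rewrite invr_gt0. Qed.

Let q1 : q < 1. Proof. by rewrite invf_lt1// ltr1n. Qed.

Lemma expr_quarter_small (C e : R) : 0 < e -> exists N, forall k, (N <= k)%N ->
  C * q ^+ k <= e.
Proof.
move=> e0.
have : C * q ^+ k @[k --> \oo] --> (0 : R).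
  rewrite -[X in _ --> X](mulr0 C); apply: cvgM; first exact: cvg_cst.
  by apply: cvg_expr; rewrite ger0_norm// ltW.
move=> /cvgrPdist_lt/(_ e e0)[N _ HN]; exists N => k /HN /=.
by rewrite sub0r normrN => /ltW; apply: le_trans; exact: ler_norm.
Qed.

Lemma energy_subC (G H : 'rV[R]_n -> 'rV[R]_n) :
  energy p (fun x => G x - H x) = energy p (fun x => H x - G x).
Proof. by apply: eq_integral => x _; rewrite -enormN opprB. Qed.

(** The common value at [x0] lets Morrey's inequality, applied to [u_k - u_l], control the functions
    themselves, locally uniformly. Fatou's lemma is used twice, for the energy of the limit field
    and for its distance in energy to [G_k]; the latter identifies it as the weak gradient of
    [w]. *)
Lemma sobolev_limit (x0 : 'rV[R]_n) (c m : R) (u_ : nat -> 'rV[R]_n -> R)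
    (G_ : nat -> 'rV[R]_n -> 'rV[R]_n) :
  (forall k, continuous (u_ k)) -> (forall k, weak_gradient (u_ k) (G_ k)) ->
  (forall k, u_ k x0 = c) ->
  (forall k l, (k <= l)%N ->
     (energy p (fun x => G_ k x - G_ l x)%R <= ((4^-1 ^+ k) `^ p)%:E)%E) ->
  (forall e : R, 0 < e -> \forall k \near \oo, (energy p (G_ k) <= (m + e)%:E)%E) ->
  exists2 w, sobolev_le p m w & forall x, u_ k x @[k --> \oo] --> w x.
Proof.
move=> cu uG ux0 GC Gm.
have mG k := measurable_weak_gradient (uG k).
have [K K0 HK] := morrey n0 np.
set al := 1 - n%:R / p in HK.
have al0 : 0 < al := morrey_exponent_gt0 n0 np.
have rate x k l : (k <= l)%N -> `|u_ k x - u_ l x| <= K * `|x - x0| `^ al * q ^+ k.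
  move=> kl.
  have S : sobolev_le p ((q ^+ k) `^ p) (fun x => 1 * u_ k x + -1 * u_ l x).
    split; first exact: continuous_lin_rV.
    exists (fun x => 1 *: G_ k x + -1 *: G_ l x).
      exact: weak_gradient_lin.
    apply: le_trans (GC _ _ kl).
    rewrite le_eqVlt; apply/orP; left; apply/eqP.
    by apply: eq_integral => y _; rewrite scale1r scaleN1r.
  have := HK _ _ (exprn_gt0 k q0) S x x0.
  rewrite !ux0 !mul1r !mulN1r subrr subr0 => /le_trans; apply.
  by rewrite mulrAC.
have rate0 x : K * `|x - x0| `^ al * q ^+ k @[k --> \oo] --> (0 : R).
  rewrite -[X in _ --> X](mulr0 (K * `|x - x0| `^ al)).
  apply: cvgM; first exact: cvg_cst.
  by apply: cvg_expr; rewrite ger0_norm// ltW.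
have /choice[w wP] : forall x, exists l : R,
    u_ k x @[k --> \oo] --> l /\ forall k, `|u_ k x - l| <= K * `|x - x0| `^ al * q ^+ k.
  by move=> x; have [l ul lr] := cvg_of_cauchy_rate (rate x) (rate0 x); exists l.
have unif (L e : R) : 0 < e -> exists N, forall k, (N <= k)%N ->
    forall x, `|x| <= L -> `|w x - u_ k x| <= e.
  move=> e0; have [N HN] := expr_quarter_small (K * (L + `|x0|) `^ al) e0.
  exists N => k /HN Nk x xL; rewrite distrC; have [_ /(_ k) wk] := wP x.
  apply: le_trans wk _; apply: le_trans Nk.
  rewrite ler_wpM2r ?exprn_ge0 ?(ltW q0)// ler_wpM2l//.
  have xx : `|x - x0| <= L + `|x0|.
    by apply: le_trans (ler_normB _ _) _; rewrite lerD2r.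
  by apply: ge0_ler_powR; rewrite ?nnegrE ?(ltW al0)// (le_trans _ xx).
have cw : continuous w.
  apply/continuous_rVP => x e e0.
  have e3 : 0 < e / 3 by rewrite divr_gt0.
  have [N /(_ N (leqnn N)) HN] := unif (`|x| + 1) (e / 3) e3.
  have /continuous_rVP/(_ x _ e3)[d d0 dP] := cu N.
  exists (Num.min d 1); first by rewrite lt_min d0 ltr01.
  move=> y; rewrite lt_min => /andP[yd y1].
  have yx : `|y| <= `|x| + 1.
    rewrite -[y](subrK x) addrC; apply: le_trans (ler_normD _ _) _.
    by rewrite lerD2l distrC ltW.
  have h1 := HN _ yx.
  have h2 : `|w x - u_ N x| <= e / 3 by apply: HN; rewrite lerDl.
  have h3 := dP _ yd.
  have -> : w x - w y = (w x - u_ N x) + (u_ N x - u_ N y) - (w y - u_ N y) by ring.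
  apply: le_lt_trans (ler_normB _ _) _.
  apply: le_lt_trans (lerD (ler_normD _ _) (lexx _)) _.
  have -> : e = e / 3 + e / 3 + e / 3 by field.
  by rewrite ltr_leD// ler_ltD.
exists w; last by move=> x; have [] := wP x.
split=> //.
have [G mGl GG] := energy_cauchy_ae_cvg n0 np mG (fun k => GC k k.+1 (leqnSn k)).
have Gm' : (energy p G <= m%:E)%E.
  apply/lee_addgt0Pr => e e0; have [N _ HN] := Gm e e0.
  apply: (@energy_fatou _ _ _ p0 (fun k => G_ (k + N)%N)) => //.
    by apply: filterS GG => x GGx i; rewrite (cvg_shiftn N (fun k => G_ k x 0 i)).
  by move=> k; apply: HN; rewrite /= leq_addl.
have GGk k : (energy p (fun x => G x - G_ k x)%R <= ((q ^+ k) `^ p)%:E)%E.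
  rewrite [leLHS]energy_subC.
  apply: (@energy_fatou _ _ _ p0 (fun l x => G_ k x - G_ (l + k)%N x)) => //.
  - by move=> l; exact: measurable_subv.
  - exact: measurable_subv.
  - apply: filterS GG => x GGx i; rewrite !mxE.
    under eq_fun do rewrite !mxE.
    apply: cvgB; first exact: cvg_cst.
    by rewrite (cvg_shiftn k (fun k => G_ k x 0 i)).
  - by move=> l; apply: GC; rewrite leq_addl.
exists G => //.
apply: (weak_gradient_closed p1 cw mGl (le_lt_trans Gm' (ltry _))) => L e e0.
have [N1 HN1] := unif L e e0.
have [N2 HN2] := expr_quarter_small 1 e0.
pose k := maxn N1 N2.
exists (u_ k), (G_ k); split => //; first by apply: HN1; exact: leq_maxl.
apply: le_trans (GGk k) _; rewrite lee_fin.
apply: le_trans (HN2 k (leq_maxr _ _)); rewrite mul1r.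
by apply: ge1r_powR => //; rewrite exprn_gt0//= exprn_ile1// ltW.
Qed.

End sobolev_limit.

Section sobolev_minimize.
Variables (R : realType) (n : nat) (p : R).
Hypotheses (n0 : (0 < n)%N) (np : n%:R < p) (p2 : 2 <= p).

Let p0 : 0 < p. Proof. exact: lt_le_trans p2. Qed.

Let q : R := 4^-1.

Let q0 : 0 < q. Proof. by rewrite invr_gt0. Qed.

Let q1 : q <= 1. Proof. by rewrite invf_le1// ler1n. Qed.

Lemma lee_sub_of_add (A B : \bar R) (a b : R) :
  (a%:E <= A)%E -> (A + B <= b%:E)%E -> (B <= (b - a)%:E)%E.
Proof.
move=> aA AB.
by rewrite EFinB leeBrDl//; apply: le_trans AB; rewrite leeD2r.
Qed.

(* Clarkson's inequality makes almost minimisers a Cauchy sequence in energy,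
   which replaces the weak compactness of bounded sets. *)
Lemma sobolev_minimize (K_ : nat -> set ('rV[R]_n -> R)) (x0 : 'rV[R]_n) (c e : R) :
  (forall i j, (i <= j)%N -> K_ j `<=` K_ i) ->
  (forall j u v, K_ j u -> K_ j v -> K_ j (fun x => 2^-1 * u x + 2^-1 * v x)) ->
  (forall j u, K_ j u -> u x0 = c) ->
  (forall j (d : R), 0 < d -> exists2 u, K_ j u & sobolev_le p (e + d) u) ->
  exists u_ w, [/\ forall k, K_ k (u_ k), sobolev_le p e w &
    forall x, u_ k x @[k --> \oo] --> w x].
Proof.
move=> Kdec Kmid Kx0 Ke.
pose S j := [set z : \bar R | exists u G,
  [/\ K_ j u, continuous u, weak_gradient u G & z = energy p G]].
pose E j := ereal_inf (S j).
have E0 j : (0 <= E j)%E.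
  by apply: le_ereal_inf_tmp => _ [u [G [_ _ _ ->]]]; exact: energy_ge0.
have Ee j : (E j <= e%:E)%E.
  apply/lee_addgt0Pr => d d0; have [u Ku [cu [G uG Ge]]] := Ke j d d0.
  by apply: le_trans Ge; apply: ereal_inf_lbound; exists u, G.
have Efin j : E j \is a fin_num.
  by rewrite ge0_fin_numE//; apply: le_lt_trans (Ee j) (ltry _).
pose m_ j := fine (E j).
have Em j : E j = (m_ j)%:E by rewrite fineK.
have m_nd i j : (i <= j)%N -> m_ i <= m_ j.
  move=> ij; rewrite -lee_fin -!Em; apply: le_ereal_inf => _ [u [G [Ku cu uG ->]]].
  by exists u, G; split => //; exact: (Kdec i j).
have m_le j : m_ j <= e by rewrite -lee_fin -Em.
have supm : has_sup (range m_).
  split; first by exists (m_ 0); exists 0%N.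
  by exists e => _ [j _ <-].
(* The infima over the decreasing sets increase and are bounded by [e]; [m] is their limit. *)
pose m := sup (range m_).
have m_m j : m_ j <= m by apply: ub_le_sup; [exact: supm.2|exists j].
have me : m <= e by apply: ge_sup; [exact: supm.1|move=> _ [j _ <-]].
(* Chosen so that [2^p] times the gap [2 d_k] in Clarkson's inequality is exactly [(4^-k)^p]. *)
pose z : R := (2 * 2 `^ p)^-1.
have tp : 0 < 2 `^ p :> R by exact: powR_gt0.
have z0 : 0 < z by rewrite invr_gt0 mulr_gt0.
pose d k := z * (q ^+ k) `^ p.
have d0 k : 0 < d k by rewrite mulr_gt0// powR_gt0// exprn_gt0.
have d_ni k l : (k <= l)%N -> d l <= d k.
  move=> kl; rewrite ler_wpM2l ?(ltW z0)//; apply: ge0_ler_powR.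
  - exact: ltW.
  - by rewrite nnegrE exprn_ge0// ltW.
  - by rewrite nnegrE exprn_ge0// ltW.
  - by rewrite ler_wiXn2l// ltW.
have /choice[J HJ] : forall k, exists J, m - d k <= m_ J.
  move=> k; have [_ [J _ <-] HJ] := sup_adherent (d0 k) supm.
  by exists J; exact: ltW.
(* Summation makes the index monotone and at least both [J k] and [k]. *)
pose j k := (\sum_(i < k.+1) (J i + i))%N.
have j_nd : {homo j : k l / (k <= l)%N}.
  apply: homo_leq => //; first exact: leq_trans.
  by move=> k; rewrite /j [X in (_ <= X)%N]big_ord_recr/= leq_addr.
have jJ k : (J k <= j k)%N.
  by rewrite /j big_ord_recr/= addnCA leq_addr.
have jk k : (k <= j k)%N.
  by rewrite /j big_ord_recr/= addnA leq_addl.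
have /choice[uG HuG] : forall k, exists uG : ('rV[R]_n -> R) * ('rV[R]_n -> 'rV[R]_n),
    [/\ K_ (j k) uG.1, continuous uG.1, weak_gradient uG.1 uG.2 &
        (energy p uG.2 <= (m + d k)%:E)%E].
  move=> k; have [_ [u [G [Ku cu uG ->]]] GE] := lb_ereal_inf_adherent (d0 k) (Efin (j k)).
  exists (u, G); split => //; apply: le_trans (ltW GE) _.
  by rewrite -/(E _) Em -EFinD lee_fin lerD2r.
pose u_ k := (uG k).1; pose G_ k := (uG k).2.
have mG k : measurable_fun setT (G_ k).
  by have [_ _ /measurable_weak_gradient] := HuG k.
have [] := @sobolev_limit R n p n0 np x0 c m u_ G_.
- by move=> k; have [] := HuG k.
- by move=> k; have [] := HuG k.
- by move=> k; have [/Kx0] := HuG k.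
- move=> k l kl.
  have [Kk ck wk ek] := HuG k; have [Kl cl wl el] := HuG l.
  (* The sets decrease, so the midpoint is a competitor for the larger set, of index [j k]. *)
  have low : ((m - d k)%:E <= energy p (fun x => 2^-1 *: G_ k x + 2^-1 *: G_ l x)%R)%E.
    apply: (@le_trans _ _ (E (j k))).
      by rewrite Em lee_fin (le_trans (HJ k))// m_nd.
    apply: ereal_inf_lbound; exists (fun x => 2^-1 * u_ k x + 2^-1 * u_ l x).
    exists (fun x => 2^-1 *: G_ k x + 2^-1 *: G_ l x); split => //.
    + by apply: Kmid => //; exact: (Kdec _ _ (j_nd _ _ kl)).
    + exact: continuous_lin_rV.
    + exact: weak_gradient_lin.
  have up : (2^-1%:E * (energy p (G_ k) + energy p (G_ l)) <= (m + d k)%:E)%E.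
    apply: (@le_trans _ _ (2^-1%:E * ((m + d k)%:E + (m + d k)%:E))%E).
      apply: lee_wpmul2l; first by rewrite lee_fin invr_ge0.
      apply: leeD; first exact: ek.
      apply: le_trans el _.
      by rewrite lee_fin lerD2l d_ni.
    by rewrite -EFinD -EFinM lee_fin le_eqVlt; apply/orP; left; apply/eqP; field.
  have := clarkson p2 (mG k) (mG l) => /le_trans/(_ up).
  move=> /(lee_sub_of_add low).
  set B := energy p _ => B2.
  have -> : energy p (fun x => G_ k x - G_ l x)%R = ((2 `^ p)%:E * B)%E.
    rewrite -[X in (X `^ p)%:E](@ger0_norm _ 2)//.
    have mK2 := measurable_lin 2^-1 (- 2^-1) (mG k) (mG l).
    rewrite -[RHS](energyZ p 2 mK2).
    apply: eq_integral => x _; congr (_ `^ _)%:E; congr enorm.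
    by rewrite scalerDr !scalerA mulrN mulfV// scale1r scaleN1r.
  apply: (@le_trans _ _ ((2 `^ p)%:E * (m + d k - (m - d k))%:E)%E).
    by apply: lee_wpmul2l => //; rewrite lee_fin ltW.
  rewrite -EFinM lee_fin /d /z le_eqVlt; apply/orP; left; apply/eqP.
  by rewrite -/q; field; rewrite gt_eqF.
- move=> a a0; have [N HN] := expr_quarter_small z a0.
  exists N => // k /= /HN zk; have [_ _ _ ek] := HuG k.
  apply: le_trans ek _; rewrite lee_fin lerD2l; apply: le_trans zk.
  rewrite ler_wpM2l ?(ltW z0)//; apply: ge1r_powR; last by apply: le_trans p2; rewrite ler1n.
  by rewrite exprn_gt0//= exprn_ile1// ltW.
move=> w wm uw; exists u_, w; split => //; last exact: le_sobolev_le wm.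
by move=> k; apply: (Kdec _ _ (jk k)); have [] := HuG k.
Qed.

End sobolev_minimize.

(** * Blow-up at a boundary point *)

Section C1_domain_normal.
Variables (R : realType) (n : nat).

Lemma norm_col'_le (l : 'I_n) (v : 'rV[R]_n) : `|col' l v| <= `|v|.
Proof.
rewrite [leLHS]mx_normrE; apply: bigmax_le => // -[i j] _ /=.
by rewrite (ord1 i) mxE norm_coord_le.
Qed.

(* To first order at a boundary point, [Omega] lies on the inner side of the
   tangent hyperplane through any nearby point of its complement. *)
Lemma C1_domain_normal (Omega : set 'rV[R]_n) (x0 : 'rV[R]_n) :
  C1_domain Omega -> boundary Omega x0 ->
  exists2 nu : 'rV[R]_n, enorm nu = 1 & forall e : R, 0 < e ->
    exists2 rho : R, 0 < rho & forall x z : 'rV[R]_n,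
      enorm (x - x0) < rho -> enorm (z - x0) < rho -> Omega x -> ~ Omega z ->
      - (e * enorm (x - z)) <= dotv (x - z) nu.
Proof.
move=> CO /CO[r [Q [b [h [l [r0 QQ Ch _ HO]]]]]].
have QQ' : Q^T *m Q = 1%:M by exact: mulmx1C.
pose P (x : 'rV[R]_n) := col' l (x *m Q + b).
(* The inner normal [(-Dh, 1)] of the graph; [a] is the same vector in the original coordinates. Its
   entry [1] gives norm at least [1], so normalising at the end only improves the bound. *)
pose c : 'rV[R]_n := \row_i oapp (fun j => - partial j h (P x0)) 1 (unlift l i).
have cE (v : 'rV[R]_n) :
    dotv v c = v 0 l - \sum_(j < n.-1) partial j h (P x0) * v 0 (lift l j).
  rewrite /dotv (bigD1_ord l)//= mxE unlift_none/= mulr1; congr (_ + _).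
  rewrite -sumrN; apply: eq_bigr => j _.
  by rewrite mxE liftK/= mulrN mulrC.
pose a := c *m Q^T.
have aE (v : 'rV[R]_n) : dotv v a = dotv (v *m Q) c.
  by rewrite -(dotv_mulmx v a QQ) /a -mulmxA QQ' mulmx1.
have a1 : 1 <= enorm a.
  rewrite enorm_mulmx ?trmxK//.
  apply: le_trans (norm_coord_le_enorm _ l).
  by rewrite mxE unlift_none/= normr1.
have a0 : 0 < enorm a by exact: lt_le_trans a1.
exists ((enorm a)^-1 *: a).
  by rewrite enormZ ger0_norm ?invr_ge0 ?enorm_ge0// mulVf// gt_eqF.
move=> e e0; have [d d0 dP] := C1_strict_differentiable (P x0) Ch e0.
exists (Num.min r d); first by rewrite lt_min r0.
move=> x z; rewrite !lt_min => /andP[xr xd] /andP[zr zd] Ox Oz.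
have QB (y y' : 'rV[R]_n) i :
    (y *m Q + b) 0 i - (y' *m Q + b) 0 i = ((y - y') *m Q) 0 i.
  by rewrite mulmxBl; move: (y *m Q) (y' *m Q) => v v'; rewrite !mxE; ring.
have Pc (y y' : 'rV[R]_n) j : P y 0 j - P y' 0 j = ((y - y') *m Q) 0 (lift l j).
  by rewrite -QB /P; move: (y *m Q + b) (y' *m Q + b) => v v'; rewrite !mxE.
have Pd y y' : P y - P y' = col' l ((y - y') *m Q).
  apply/rowP => j; rewrite [RHS]mxE -Pc.
  by move: (P y) (P y') => v v'; rewrite !mxE.
have Pn y y' : `|P y - P y'| <= enorm (y - y').
  rewrite Pd; apply: le_trans (norm_col'_le _ _) _.
  by apply: le_trans (norm_le_enorm _) _; rewrite enorm_mulmx.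
have := dP (P x) (P z) (le_lt_trans (Pn _ _) xd) (le_lt_trans (Pn _ _) zd).
have hx : h (P x) < (x *m Q + b) 0 l by apply/(HO x xr).
have hz : (z *m Q + b) 0 l <= h (P z).
  by rewrite leNgt; apply/negP => hz; apply: Oz; apply/(HO z zr).
have -> : \sum_(j < n.-1) partial j h (P x0) * (P x 0 j - P z 0 j) =
    (x *m Q + b) 0 l - (z *m Q + b) 0 l - dotv (x - z) a.
  rewrite QB aE cE opprB addrCA subrr addr0.
  by apply: eq_bigr => j _; rewrite Pc.
have exz : e * `|P x - P z| <= e * enorm (x - z) by rewrite ler_wpM2l ?(ltW e0).
rewrite ler_norml => /andP[+ _] => H.
have {H}H : - (e * enorm (x - z)) <= dotv (x - z) a.
  move: H exz hx hz; move: (h (P x)) (h (P z)) ((x *m Q + b) 0 l) ((z *m Q + b) 0 l).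
  move: (dotv _ _) (e * `|P x - P z|) (e * enorm (x - z)) => A B C X Y Z W.
  by move=> *; lra.
rewrite dotvZr ler_pdivlMl//; apply: le_trans H.
by rewrite mulrN lerN2 ler_peMl// mulr_ge0 ?enorm_ge0// ltW.
Qed.

End C1_domain_normal.

Section dist_compl.
Variables (R : realType) (n : nat) (Omega : set 'rV[R]_n).
Local Notation d := (dist_compl Omega).
Implicit Types x y z : 'rV[R]_n.

Lemma dist_compl_le x z : ~ Omega z -> d x <= enorm (x - z).
Proof.
move=> Oz; apply: ge_inf; last by exists z.
by exists 0 => _ [y _ <-]; exact: enorm_ge0.
Qed.

Lemma dist_compl_adherent x (e : R) : ~` Omega !=set0 -> 0 < e ->
  exists2 z, ~ Omega z & enorm (x - z) < d x + e.
Proof.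
move=> [z0 Oz0] e0.
have [] := @inf_adherent _ [set enorm (x - y) | y in ~` Omega] e e0.
  split; first by exists (enorm (x - z0)), z0.
  by exists 0 => _ [y _ <-]; exact: enorm_ge0.
by move=> _ [z Oz <-] xz; exists z.
Qed.

Lemma dist_compl_gt0 x : open Omega -> ~` Omega !=set0 -> Omega x -> 0 < d x.
Proof.
move=> oO cO0 Ox; have /nbhs_ballP[e /= e0 eO] := open_nbhs_nbhs (conj oO Ox).
apply: (lt_le_trans e0); apply: lb_le_inf.
  by have [z0 Oz0] := cO0; exists (enorm (x - z0)), z0.
move=> _ [y Oy <-]; rewrite leNgt; apply/negP => xy; apply: Oy; apply: eO.
by rewrite -ball_normE /ball_ /=; apply: le_lt_trans (norm_le_enorm _) xy.
Qed.

Lemma dist_compl_lipschitz x y : ~` Omega !=set0 ->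
  `|d x - d y| <= enorm (x - y).
Proof.
move=> cO0.
have H a b : d a <= d b + enorm (a - b).
  apply/ler_addgt0Pr => e e0.
  have [z Oz bz] := dist_compl_adherent b cO0 e0.
  apply: le_trans (dist_compl_le a Oz) _.
  have -> : a - z = (a - b) + (b - z) by rewrite addrA subrK.
  apply: le_trans (ler_enormD _ _) _.
  by rewrite addrC -addrA (addrC _ e) addrA lerD2r ltW.
have := H x y; have := H y x; rewrite -(enormN (y - x)) opprB.
by rewrite ler_norml => h1 h2; apply/andP; split; lra.
Qed.

(* In the coordinates [eta = (y - x) / d x] of the blow-up at [x], the domain
   is asymptotically contained in the half-space [eta . nu > -1]. *)
Lemma C1_domain_blowup x0 : C1_domain Omega -> boundary Omega x0 -> ~ Omega x0 ->
  exists2 nu : 'rV[R]_n, enorm nu = 1 & forall c L : R, 0 < c ->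
    exists2 rho : R, 0 < rho & forall x, enorm (x - x0) < rho -> 0 < d x ->
      forall eta, enorm eta <= L -> dotv eta nu <= - (1 + c) ->
      ~ Omega (x + d x *: eta).
Proof.
move=> CO bO Ox0; have [nu nu1 nuP] := C1_domain_normal CO bO.
exists nu => // c L c0.
(* Chosen so that [x + s eta] and [z] fall within [r0] of [x0], and their distance is at most
   [sD - (c/2)s], strictly below [sD]. *)
pose D : R := 2 + c + `|L|.
have D0 : 0 < D by rewrite /D; have := normr_ge0 L; lra.
have e0 : 0 < c / 2 / D by rewrite !divr_gt0.
have [r0 r00 rP] := nuP _ e0.
exists (r0 / D); first by rewrite divr_gt0.
move=> x xx0 dx eta eL etanu Oeta.
set s := d x in dx Oeta.
have sx : s <= enorm (x - x0) by exact: dist_compl_le.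
have [z Oz xz] := @dist_compl_adherent x (c / 2 * s) (ex_intro _ x0 Ox0)
  (mulr_gt0 (divr_gt0 c0 (ltr0Sn _ 1)) dx).
rewrite -/s in xz.
have L0 : 0 <= L by apply: le_trans eL; exact: enorm_ge0.
rewrite ltr_pdivlMr// /D ger0_norm// in xx0.
have E0 := enorm_ge0 (x - x0).
have n1 : enorm (x + s *: eta - x0) < r0.
  rewrite addrAC; apply: le_lt_trans (ler_enormD _ _) _.
  rewrite enormZ gtr0_norm//; have := enorm_ge0 eta; nra.
have n2 : enorm (z - x0) < r0.
  have -> : z - x0 = - (x - z) + (x - x0) by rewrite opprB addrA subrK.
  apply: le_lt_trans (ler_enormD _ _) _; rewrite enormN; nra.
have := rP _ _ n1 n2 Oeta Oz.
have n3 : enorm (x + s *: eta - z) <= s * D - c / 2 * s.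
  rewrite addrAC; apply: le_trans (ler_enormD _ _) _.
  rewrite enormZ gtr0_norm// /D ger0_norm//.
  have := ler_wpM2l (ltW dx) eL; nra.
have n4 : dotv (x + s *: eta - z) nu <= - (c / 2 * s).
  rewrite addrAC dotvDl dotvZl.
  have := ler_wpM2l (ltW dx) etanu.
  have := le_trans (ler_norm _) (dotv_le (x - z) nu); rewrite nu1 mulr1; lra.
move=> /le_trans/(_ n4); rewrite lerN2 => n5.
have := ler_wpM2l (ltW e0) n3 => /(le_trans n5).
(* The normal component of [x + s eta - z] is at most [-(c/2)s], while the slope [c/(2D)] only
   permits a descent strictly smaller than that. *)
have -> : c / 2 / D * (s * D - c / 2 * s) = c / 2 * s - c / 2 / D * (c / 2 * s).
  by field; rewrite gt_eqF.
rewrite lerDl oppr_ge0 leNgt => /negP; apply.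
by rewrite !mulr_gt0// ?invr_gt0.
Qed.

End dist_compl.

Lemma powRV (R : realType) (a p : R) : 0 <= a -> a^-1 `^ p = (a `^ p)^-1.
Proof. by move=> a0; rewrite -powR_inv1// powRAC powR_inv1// powR_ge0. Qed.

(** * Integrability of the components of the gradient and finite energy *)

Section D1p_energy.
Variables (R : realType) (n : nat) (p : R).
Local Notation mu := (lebesgue_rV R n).
Hypothesis p1 : 1 <= p.

Let p0 : 0 < p. Proof. exact: lt_le_trans p1. Qed.

Lemma sobolev_le_D1p e (u : 'rV[R]_n -> R) : sobolev_le p e u -> D1p p u.
Proof.
move=> [cu [G uG Ge]]; split; first exact: loc_integrable_continuous.
have mG := measurable_weak_gradient uG.
exists G => // i.
have mGi : measurable_fun setT (fun x => G x 0 i).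
  exact: (measurableT_comp (measurable_coord i)).
rewrite inE; apply/andP; split; first by rewrite inE.
rewrite inE/= /finite_norm; apply: (@lty_poweRy _ _ p); first by rewrite gt_eqF.
rewrite powR_Lnorm ?gt_eqF//; apply: (@le_lt_trans _ _ (energy p G)); last first.
  exact: le_lt_trans Ge (ltry _).
rewrite -[leLHS]/(\int[mu]_x (`|G x 0%R i| `^ p)%:E)%E.
apply: ge0_le_integral => //.
- apply/measurable_EFinP; apply: (measurableT_comp (measurable_powR p)).
  exact: measurableT_comp.
- exact: measurable_energy.
- move=> x _; rewrite lee_fin; apply: ge0_ler_powR.
  + exact: ltW.
  + by rewrite nnegrE.
  + by rewrite nnegrE enorm_ge0.
  + exact: norm_coord_le_enorm.
Qed.

Lemma norm_powR_le_sum (x : 'rV[R]_n) : `|x| `^ p <= \sum_(i < n) `|x 0 i| `^ p.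
Proof.
have [x0|x0] := eqVneq `|x| 0.
  by rewrite x0 powR0 ?gt_eqF// sumr_ge0// => i _; exact: powR_ge0.
have /mx_norm_neq0[[i j]/= xE] : mx_norm x != 0 by [].
rewrite (ord1 i) in xE; rewrite [`|x|]xE (bigD1 j)//= lerDl.
by apply: sumr_ge0 => k _; exact: powR_ge0.
Qed.

Lemma D1p_energy_lty (u : 'rV[R]_n -> R) : D1p p u ->
  exists2 G, weak_gradient u G & (energy p G < +oo)%E.
Proof.
move=> [_ [G uG GL]]; exists G => //.
have mG := measurable_weak_gradient uG.
have iG := integrableZl measurableT (n%:R `^ p)
  (integrable_sum measurableT (index_enum 'I_n) (P := xpredT)
    (fun i _ => Lfun_integrable p1 (GL i))).
move/integrableP : iG => [miG]; apply: le_lt_trans.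
apply: ge0_le_integral => //.
- by move=> x _; rewrite lee_fin powR_ge0.
- exact: measurable_energy.
- exact: measurableT_comp.
move=> x _; apply: le_trans (lee_abs _).
rewrite sumEFin -EFinM lee_fin.
apply: (@le_trans _ _ ((n%:R * `|G x|) `^ p)).
  apply: ge0_ler_powR; rewrite ?nnegrE ?enorm_ge0 ?(ltW p0) ?mulr_ge0//.
  exact: enorm_le_norm.
by rewrite powRM// ler_wpM2l ?powR_ge0// norm_powR_le_sum.
Qed.

End D1p_energy.

(** * Concentration of minimising sequences *)

Section rayleigh.
Variables (R : realType) (n : nat) (p : R) (Omega : set 'rV[R]_n).
Hypotheses (n0 : (0 < n)%N) (np : n%:R < p).
Local Notation d := (dist_compl Omega).

Let p1 : 1 <= p.
Proof. by apply: ltW; apply: le_lt_trans np; rewrite ler1n. Qed.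

Let p0 : 0 < p. Proof. exact: lt_le_trans p1. Qed.

Let alpha : R := 1 - n%:R / p.

Let alphaE : alpha * p = p - n%:R.
Proof. exact: morrey_exponentE. Qed.

Lemma rayleigh_ge0 u : (0 <= rayleigh p Omega u)%E.
Proof. by rewrite mule_ge0// ?inve_ge0 poweR_ge0. Qed.

Lemma lambda_ge0 : (0 <= lambda p Omega)%E.
Proof. by apply: le_ereal_inf_tmp => _ [u _ <-]; exact: rayleigh_ge0. Qed.

Lemma D1p0_neq0_of_sobolev_le e u (x : 'rV[R]_n) : sobolev_le p e u ->
  (forall y, ~ Omega y -> u y = 0) -> u x = 1 -> D1p0_neq0 p Omega u.
Proof.
move=> ue u0 ux; split; last first.
  by move=> u00; move: ux; rewrite u00 => /eqP; rewrite eq_sym oner_eq0.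
split=> //; first exact: sobolev_le_D1p ue.
by case: ue.
Qed.

(** The Hardy norm is bounded below by its value at the single point [x], and [alpha p = p - n]. *)
Lemma rayleigh_le e u (x : 'rV[R]_n) : sobolev_le p e u -> Omega x -> u x = 1 ->
  0 < d x -> (rayleigh p Omega u <= (d x `^ (p - n%:R) * e)%:E)%E.
Proof.
move=> [cu [G uG Ge]] Ox ux dx.
rewrite /rayleigh (grad_normE n0 p0 uG).
have e0 : 0 <= e by rewrite -lee_fin; apply: le_trans Ge; exact: energy_ge0.
rewrite EFinM; apply: lee_pmul => //.
- by rewrite inve_ge0 poweR_ge0.
- exact: energy_ge0.
have D0 : 0 < d x `^ (p - n%:R) by exact: powR_gt0.
rewrite inve_ple ?inE ?poweR_ge0// ?lee_fin ?(ltW D0)//.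
rewrite inver (gt_eqF D0).
have -> : ((d x `^ (p - n%:R))^-1)%:E = ((d x `^ (- alpha))%:E `^ p)%E.
  by rewrite poweR_EFin -powRrM mulNr alphaE powRN.
have H : ((d x `^ (- alpha))%:E <= hardy_norm p Omega u)%E.
  apply: ereal_sup_ubound; exists x => //.
  rewrite ux mul1r ger0_norm ?invr_ge0 ?powR_ge0//.
  by rewrite powRN.
apply: gt0_ler_poweR => //; first exact: ltW.
- by rewrite in_itv/= leey andbT lee_fin powR_ge0.
- by rewrite in_itv/= leey andbT (le_trans _ H)// lee_fin powR_ge0.
Qed.

Lemma lambda_le e u (x : 'rV[R]_n) : sobolev_le p e u ->
  (forall y, ~ Omega y -> u y = 0) -> Omega x -> u x = 1 ->
  0 < d x -> (lambda p Omega <= (d x `^ (p - n%:R) * e)%:E)%E.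
Proof.
move=> ue u0 Ox ux dx; apply: le_trans (rayleigh_le ue Ox ux dx).
by apply: ereal_inf_lbound; exists u => //; exact: D1p0_neq0_of_sobolev_le ue u0 ux.
Qed.

(** For [u] with quotient below [L + e], the Hardy norm exceeds [t = (E/(L+e))^(1/p)], hence so does
    [|u|/d^alpha] at some [x]; dividing by [u(x)] gives the energy bound. *)
Lemma lambda_near_minimizer (L e : R) : open Omega -> ~` Omega !=set0 ->
  lambda p Omega = L%:E -> 0 < e ->
  exists x u, [/\ Omega x, u x = 1, forall y, ~ Omega y -> u y = 0 &
    sobolev_le p ((L + e) / d x `^ (p - n%:R)) u].
Proof.
move=> oO cO lL e0.
have lfin : lambda p Omega \is a fin_num by rewrite lL.
have [_ [u [[Du cu u0] un0] <-]] := lb_ereal_inf_adherent e0 lfin.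
rewrite -/(lambda p Omega) lL -EFinD => ur.
have [G uG Gfin] := D1p_energy_lty p1 Du.
rewrite /rayleigh (grad_normE n0 p0 uG) in ur.
have E0 := energy_ge0 p G.
set E := fine (energy p G).
have EE : energy p G = E%:E by rewrite fineK// ge0_fin_numE.
rewrite EE in E0 ur.
have {}E0 : 0 <= E by [].
have Le : 0 < L + e.
  apply: ltr_wpDl => //.
  by rewrite -lee_fin -lL; exact: lambda_ge0.
pose t := (E / (L + e)) `^ p^-1.
have tp : t `^ p = E / (L + e).
  by rewrite /t -powRrM mulVf ?gt_eqF// powRr1// divr_ge0// ltW.
have [x1 ux1] : exists x, u x != 0.
  apply: contrapT => H; apply: un0; apply/funext => x.
  by apply/eqP; apply: contrapT => /negP ?; apply: H; exists x.
have Ox1 : Omega x1 by apply: contrapT => /u0 /eqP; rewrite (negbTE ux1).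
have dp x : Omega x -> 0 < d x by exact: dist_compl_gt0.
have H0 : (0 < hardy_norm p Omega u)%E.
  apply: (@lt_le_trans _ _ (`|u x1 / d x1 `^ alpha|)%:E).
    by rewrite lte_fin normr_gt0 mulf_neq0// invr_eq0 gt_eqF// powR_gt0// dp.
  by apply: ereal_sup_ubound; exists x1.
have tH : (t%:E < hardy_norm p Omega u)%E.
  (* The Hardy norm is not known to be finite; an infinite one exceeds [t] trivially. *)
  move: ur H0; case: (hardy_norm p Omega u) => [h| |]//; last by move=> _ _; rewrite ltry.
  rewrite !lte_fin => + h0; rewrite poweR_EFin inver gt_eqF ?powR_gt0//.
  rewrite -EFinM lte_fin ltr_pdivrMl ?powR_gt0// => Eh.
  rewrite ltNge; apply/negP => ht.
  have : h `^ p <= t `^ p.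
    by apply: ge0_ler_powR; rewrite ?nnegrE ?powR_ge0// ltW.
  by rewrite tp ler_pdivlMr// leNgt Eh.
have [_ [x Ox <-]] := ereal_sup_gt tH; rewrite lte_fin => tx.
have da : 0 < d x `^ alpha by rewrite powR_gt0// dp.
rewrite -/alpha normrM normfV (ger0_norm (ltW da)) ltr_pdivlMr// in tx.
have ux0 : 0 < `|u x| by apply: le_lt_trans tx; rewrite mulr_ge0 ?powR_ge0.
have uxn : u x != 0 by rewrite -normr_gt0.
exists x, (fun y => (u x)^-1 * u y); split => //.
- by rewrite mulVf.
- by move=> y /u0 ->; rewrite mulr0.
have uE : sobolev_le p E u by split => //; exists G => //; rewrite EE.
apply: le_sobolev_le (sobolev_leZ (u x)^-1 uE).
have : E / (L + e) * d x `^ (p - n%:R) <= `|u x| `^ p.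
  rewrite -tp -alphaE powRrM -powRM ?powR_ge0//.
  apply: ge0_ler_powR; rewrite ?nnegrE ?(ltW p0)// ?mulr_ge0 ?powR_ge0//.
  exact: ltW.
have D0 : 0 < d x `^ (p - n%:R) by rewrite powR_gt0// dp.
have U0 : 0 < `|u x| `^ p by rewrite powR_gt0.
rewrite normfV powRV//.
rewrite mulrAC ler_pdivrMr// => H.
by rewrite ler_pdivlMr// -mulrA ler_pdivrMl.
Qed.

End rayleigh.

Section minimizing_sequence.
Variables (R : realType) (n : nat) (p : R) (Omega : set 'rV[R]_n).
Hypotheses (n0 : (0 < n)%N) (np : n%:R < p).
Local Notation d := (dist_compl Omega).

(** A cluster point is approached at a geometric rate. Strict monotonicity of [phi] is not asked
    for: [k <= phi k] already transfers the decreasing energy slack. *)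
Lemma bounded_subsequence (x_ : nat -> 'rV[R]_n) (B : R) :
  (forall k, `|x_ k| <= B) -> exists (x0 : 'rV[R]_n) (phi : nat -> nat),
    forall k, (k <= phi k)%N /\ enorm (x_ (phi k) - x0) <= 2^-1 ^+ k.
Proof.
move=> xB.
have FB : (x_ @ \oo) [set x | `|x| <= B] by exists 0%N => // k _; exact: xB.
have [x0 [_ cx0]] := @compact_normball R n B (x_ @ \oo) _ FB.
have H k : exists l, (k <= l)%N /\ enorm (x_ l - x0) <= 2^-1 ^+ k.
  have r0 : 0 < 2^-1 ^+ k / n.+1%:R :> R by rewrite divr_gt0// exprn_gt0// invr_gt0.
  have Fk : (x_ @ \oo) [set x_ l | l in [set l | (k <= l)%N]].
    by exists k => // l /= kl; exists l.
  have [_ [[l kl <-]]] := cx0 _ _ Fk (nbhsx_ballx x0 _ r0).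
  rewrite -ball_normE /ball_/= distrC => xl; exists l; split => //.
  apply: le_trans (enorm_le_norm _) _.
  rewrite ltr_pdivlMr// in xl; apply: le_trans (ltW xl).
  by rewrite mulrC ler_wpM2l// ler_nat.
by have [phi phiP] := choice H; exists x0, phi.
Qed.

Lemma minimizing_sequence (L : R) : open Omega -> bounded_set Omega ->
  ~` Omega !=set0 -> lambda p Omega = L%:E ->
  exists x0 x_ u_, forall k, [/\ Omega (x_ k), u_ k (x_ k) = 1,
    forall y, ~ Omega y -> u_ k y = 0,
    sobolev_le p ((L + 2^-1 ^+ k) / d (x_ k) `^ (p - n%:R)) (u_ k) &
    enorm (x_ k - x0) <= 2^-1 ^+ k].
Proof.
move=> oO /bounded_setP[B OB] cO lL.
have h0 k : 0 < 2^-1 ^+ k :> R by rewrite exprn_gt0// invr_gt0.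
have /choice[xu xuP] : forall k, exists xu : 'rV[R]_n * ('rV[R]_n -> R),
    [/\ Omega xu.1, xu.2 xu.1 = 1, forall y, ~ Omega y -> xu.2 y = 0 &
    sobolev_le p ((L + 2^-1 ^+ k) / d xu.1 `^ (p - n%:R)) xu.2].
  move=> k; have [x [u [Ox ux u0 us]]] := lambda_near_minimizer n0 np oO cO lL (h0 k).
  by exists (x, u).
have xB k : `|(xu k).1| <= B by apply: OB; have [] := xuP k.
have [x0 [phi phiP]] := bounded_subsequence xB.
exists x0, (fun k => (xu (phi k)).1), (fun k => (xu (phi k)).2) => k.
have [kp xk] := phiP k; have [Ox ux u0 us] := xuP (phi k).
split => //; apply: le_sobolev_le us.
rewrite ler_wpM2r ?invr_ge0 ?powR_ge0// lerD2l.
by rewrite ler_wiXn2l ?invr_ge0// invf_le1// ler1n.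
Qed.

Lemma cvg_of_le_expr_half (a : nat -> R) (l : R) :
  (forall k, `|a k - l| <= 2^-1 ^+ k) -> a k @[k --> \oo] --> l.
Proof.
move=> al; apply/cvgrPdist_le => e e0.
have /cvgrPdist_le/(_ e e0) := @cvg_expr_half R.
apply: filterS => k; rewrite sub0r normrN distrC => /(le_trans (ler_norm _)).
exact: le_trans (al k).
Qed.

End minimizing_sequence.

Section interior_concentration.
Variables (R : realType) (n : nat) (p : R) (Omega : set 'rV[R]_n).
Hypotheses (n0 : (0 < n)%N) (np : n%:R < p) (p2 : 2 <= p).
Local Notation d := (dist_compl Omega).

Let p0 : 0 < p. Proof. exact: lt_le_trans p2. Qed.

Lemma interior_extremal (L : R) (x0 : 'rV[R]_n) (x_ : nat -> 'rV[R]_n)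
    (u_ : nat -> 'rV[R]_n -> R) :
  open Omega -> ~` Omega !=set0 -> lambda p Omega = L%:E ->
  (forall k, [/\ Omega (x_ k), u_ k (x_ k) = 1,
    forall y, ~ Omega y -> u_ k y = 0,
    sobolev_le p ((L + 2^-1 ^+ k) / d (x_ k) `^ (p - n%:R)) (u_ k) &
    enorm (x_ k - x0) <= 2^-1 ^+ k]) ->
  Omega x0 -> exists u, extremal p Omega u.
Proof.
move=> oO cO lL xu Ox0.
have L0 : 0 <= L by rewrite -lee_fin -lL; exact: lambda_ge0.
have s0 : 0 < d x0 by exact: dist_compl_gt0.
have pn : 0 < p - n%:R by rewrite subr_gt0.
have sn0 : 0 < d x0 `^ (p - n%:R) by exact: powR_gt0.
pose e : R := L / d x0 `^ (p - n%:R).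
pose e_ k : R := (L + 2^-1 ^+ k) / d (x_ k) `^ (p - n%:R).
have d_cvg : d (x_ k) @[k --> \oo] --> d x0.
  apply: cvg_of_le_expr_half => k; have [_ _ _ _] := xu k.
  by apply: le_trans; exact: dist_compl_lipschitz.
have e_gt0 k : 0 < e_ k.
  have [Oxk _ _ _ _] := xu k.
  rewrite divr_gt0 ?powR_gt0 ?dist_compl_gt0//.
  by rewrite ltr_wpDl// exprn_gt0// invr_gt0.
have e_cvg : e_ k @[k --> \oo] --> e.
  apply: cvgM.
    rewrite -[X in _ --> X]addr0; apply: cvgD; first exact: cvg_cst.
    exact: cvg_expr_half.
  apply: cvgV; first by rewrite gt_eqF.
  apply: powR_cvg_nneg => // k; have [Oxk _ _ _ _] := xu k.
  by apply: ltW; exact: dist_compl_gt0.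
have [K K0 HK] := morrey n0 np.
have al0 := morrey_exponent_gt0 n0 np.
set al := 1 - n%:R / p in HK al0.
pose M_ k := e_ k `^ p^-1.
have M_cvg : M_ k @[k --> \oo] --> e `^ p^-1.
  by apply: powR_cvg_nneg => //; [rewrite invr_gt0|move=> k; exact: ltW].
(* The functions are normalised at the moving points [x_k]; dividing by [c_k], which tends to [1],
   moves the normalisation to [x0] at an asymptotically negligible cost in energy. *)
pose c_ k := u_ k x0.
have c_bound k : `|1 - c_ k| <= K * M_ k * `|x_ k - x0| `^ al.
  have [_ uk _ us _] := xu k; rewrite -{1}uk; apply: HK.
    by rewrite powR_gt0.
  by rewrite /M_ -powRrM mulVf ?gt_eqF// powRr1// ltW.
have xx_cvg : (`|x_ k - x0| `^ al) @[k --> \oo] --> (0 : R).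
  rewrite -(powR0 (lt0r_neq0 al0)); apply: powR_cvg_nneg => //.
  apply: cvg_of_le_expr_half => k; rewrite subr0 normr_id.
  by have [_ _ _ _] := xu k; apply: le_trans; exact: norm_le_enorm.
have c_cvg : c_ k @[k --> \oo] --> (1 : R).
  have B0 : (K * M_ k * `|x_ k - x0| `^ al) @[k --> \oo] --> (0 : R).
    rewrite -[X in _ --> X](mulr0 (K * e `^ p^-1)); apply: cvgM => //.
    by apply: cvgM => //; exact: cvg_cst.
  apply/cvgrPdist_le => t t0; have /cvgrPdist_le/(_ t t0) := B0.
  apply: filterS => k; rewrite sub0r normrN => /(le_trans (ler_norm _)).
  exact: le_trans (c_bound k).
have f_cvg : (`|(c_ k)^-1| `^ p * e_ k) @[k --> \oo] --> e.
  rewrite -[X in _ --> X]mul1r; apply: cvgM => //.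
  have <- : 1 `^ p = 1 :> R by rewrite powR1.
  apply: powR_cvg_nneg => //.
  rewrite -[X in _ --> X](@normr1 R); apply: cvg_norm.
  by rewrite -[X in _ --> X](@invr1 R); apply: cvgV => //; exact: oner_neq0.
(* Here the constraint does not depend on [j]: the domain is fixed. *)
pose K_ (j : nat) : set ('rV[R]_n -> R) :=
  [set u | u x0 = 1 /\ forall y, ~ Omega y -> u y = 0].
have Ke (j : nat) (t : R) : 0 < t -> exists2 u, K_ j u & sobolev_le p (e + t) u.
  move=> t0; have /cvgrPdist_lt/(_ _ (@ltr01 R)) := c_cvg.
  have /cvgrPdist_le/(_ t t0) := f_cvg.
  move=> [N1 _ HN1] [N2 _ HN2].
  pose k := maxn N1 N2.
  have ck := HN2 k (leq_maxr _ _); have fk := HN1 k (leq_maxl _ _).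
  have cn0 : c_ k != 0.
    by apply/eqP => c0; move: ck; rewrite /= c0 subr0 normr1 ltxx.
  have [_ _ u0 us _] := xu k.
  exists (fun x => (c_ k)^-1 * u_ k x).
    split; first by rewrite mulVf.
    by move=> y /u0 ->; rewrite mulr0.
  apply: le_sobolev_le (sobolev_leZ (c_ k)^-1 us).
  rewrite /= distrC in fk.
  by rewrite -lerBlDl; exact: le_trans (ler_norm _) fk.
have [||||v_ [w [Kv we vw]]] := @sobolev_minimize R n p n0 np p2 K_ x0 1 e.
- by move=> i j _ u.
- move=> j u v [u1 u0] [v1 v0]; split; first by rewrite u1 v1; field.
  by move=> y Oy; rewrite u0// v0// !mulr0 addr0.
- by move=> j u [].
- exact: Ke.
have w1 : w x0 = 1.
  have H : v_ k x0 @[k --> \oo] --> (1 : R).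
    rewrite (_ : (fun _ => _) = cst 1); first exact: cvg_cst.
    by apply/funext => k; have [] := Kv k.
  exact: (@cvg_unique _ (@norm_hausdorff _ _) _ _ _ _ (vw x0) H).
have w0 y : ~ Omega y -> w y = 0.
  move=> Oy; have H : v_ k y @[k --> \oo] --> (0 : R).
    rewrite (_ : (fun _ => _) = cst 0); first exact: cvg_cst.
    by apply/funext => k; have [_] := Kv k; apply.
  exact: (@cvg_unique _ (@norm_hausdorff _ _) _ _ _ _ (vw y) H).
exists w.
have Dw := D1p0_neq0_of_sobolev_le n0 np we w0 w1.
split => //; apply/eqP; rewrite eq_le; apply/andP; split; last first.
  by apply: ereal_inf_lbound; exists w.
apply: le_trans (rayleigh_le n0 np we Ox0 w1 s0) _.
by rewrite lL lee_fin /e mulrC divfK// gt_eqF.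
Qed.

End interior_concentration.

(** * Rotation of a half-space to the standard one *)

Section half_space.
Variables (R : realType) (n : nat).

Lemma dotv_delta (x : 'rV[R]_n) (l : 'I_n) : dotv x (delta_mx 0 l) = x 0 l.
Proof.
rewrite /dotv (bigD1 l)//= big1 => [|i il]; first by rewrite mxE !eqxx mulr1 addr0.
by rewrite mxE (negbTE il) andbF mulr0.
Qed.

Lemma mulmx_trV (x y : 'rV[R]_n) : x *m y^T = (dotv x y)%:M.
Proof.
apply/matrixP => i j; rewrite (ord1 i) (ord1 j) !mxE eqxx mulr1n.
by apply: eq_bigr => k _; rewrite mxE.
Qed.

(* A Householder reflection does it. *)
Lemma orthogonal_row (l : 'I_n) (nu : 'rV[R]_n) : enorm nu = 1 ->
  exists2 O : 'M[R]_n, O *m O^T = 1%:M & delta_mx 0 l *m O = nu.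
Proof.
move=> nu1; set a : 'rV[R]_n := delta_mx 0 l; pose v := a - nu.
have aa : dotv a a = 1 by rewrite /a dotv_delta mxE !eqxx.
have nn : dotv nu nu = 1 by rewrite dotvv nu1 expr1n.
(* When [nu] already is the basis vector there is no reflection to define, and the identity
   serves. *)
have [v0|v0] := eqVneq (dotv v v) 0.
  exists 1%:M; first by rewrite trmx1 mulmx1.
  have /enorm_eq0 vv : enorm v = 0.
    by apply/eqP; rewrite -sqrf_eq0 -dotvv v0.
  by rewrite mulmx1; apply/eqP; rewrite -subr_eq0 -/v vv.
pose c := 2 / dotv v v; pose P := v^T *m v.
have PP : P *m P = dotv v v *: P.
  by rewrite /P -mulmxA (mulmxA v) mulmx_trV mul_scalar_mx scalemxAr.
have PT : P^T = P by rewrite /P trmx_mul trmxK.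
exists (1%:M - c *: P).
  have -> : (1%:M - c *: P)^T = 1%:M - c *: P.
    by rewrite raddfB/= trmx1; congr (_ - _); rewrite -[in RHS]PT;
      apply/matrixP => i j; rewrite !mxE.
  rewrite mulmxBl !mulmxBr !mul1mx mulmx1.
  rewrite -scalemxAl -scalemxAr PP !scalerA -addrA -opprD.
  rewrite [X in _ - X](_ : _ = 0) ?subr0//.
  rewrite addrA -mulr2n -scaler_nat scalerA -scalerBl.
  have -> : 2 * c - c * c * dotv v v = 0 by rewrite /c; field.
  by rewrite scale0r.
rewrite mulmxBr mulmx1 -scalemxAr /P mulmxA mulmx_trV mul_scalar_mx scalerA.
have -> : c * dotv a v = 1.
  (* Holds because [a] and [nu] are both unit vectors. *)
  have E : dotv v v = 2 * dotv a v.
    rewrite /v !(dotvDl, dotvDr, dotvNl, dotvNr) aa nn (dotvC nu a).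
    by move: (dotv a nu) => z; ring.
  have av : dotv a v != 0 by apply: contraNneq v0 => z; rewrite E z mulr0.
  by rewrite /c E; field.
by rewrite scale1r /v opprB addrC subrK.
Qed.

Lemma half_spaceE (l : 'I_n) : l.+1 = n ->
  half_space R n = [set x : 'rV[R]_n | 0 < x 0 l].
Proof.
move=> ln; apply/seteqP; split => x /=; last by move=> xl; exists l.
move=> [k kn xk]; have -> // : l = k.
by apply/val_inj/eqP; rewrite -eqSS ln kn.
Qed.

Lemma open_half_space : (0 < n)%N -> open (half_space R n).
Proof.
move=> n0; have pn : (n.-1 < n)%N by rewrite prednK.
rewrite (@half_spaceE (Ordinal pn)) /= ?prednK//.
apply: (@open_comp _ _ (fun x : 'rV[R]_n => x 0 (Ordinal pn)) [set y : R | 0 < y]).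
  by move=> x _; exact: coord_continuous.
exact: open_gt.
Qed.

End half_space.

Section boundary_concentration.
Variables (R : realType) (n : nat) (p : R) (Omega : set 'rV[R]_n).
Hypotheses (n0 : (0 < n)%N) (np : n%:R < p) (p2 : 2 <= p).
Local Notation d := (dist_compl Omega).

(** The map [x -> xQ - nu], with [Q] taking the last basis vector [a] to [nu], sends [a] to the
    origin and the complement of the standard half-space into [eta . nu <= -1]. The transported
    function is thus admissible with value [1] at [a], whose distance to the complement is at most
    [1]. *)
Lemma lambda_half_space_le (L : R) (nu : 'rV[R]_n) w : enorm nu = 1 ->
  sobolev_le p L w -> w 0 = 1 -> (forall eta, dotv eta nu <= -1 -> w eta = 0) ->
  (lambda p (half_space R n) <= L%:E)%E.
Proof.
move=> nu1 wL w1 w0.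
have p1 : 1 <= p by apply: le_trans p2; rewrite ler1n.
have pn : 0 < p - n%:R by rewrite subr_gt0.
have L0 : 0 <= L.
  by have [_ [G _ GL]] := wL; rewrite -lee_fin; apply: le_trans GL; exact: energy_ge0.
have nn : (n.-1 < n)%N by rewrite prednK.
pose l := Ordinal nn.
have ln : l.+1 = n by rewrite /= prednK.
have [Q QQ aQ] := orthogonal_row l nu1.
pose a : 'rV[R]_n := delta_mx 0 l.
have wtL := sobolev_le_affine (- nu) p1 ltr01 QQ wL.
rewrite powR1 mul1r in wtL.
have oH := @open_half_space R n n0.
have H0 : ~ half_space R n 0 by rewrite (@half_spaceE R n l ln) /= mxE ltxx.
have Ha : half_space R n a by rewrite (@half_spaceE R n l ln) /= mxE !eqxx ltr01.
have da0 : 0 < dist_compl (half_space R n) a.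
  by apply: dist_compl_gt0 => //; exists 0.
have da1 : dist_compl (half_space R n) a <= 1.
  apply: le_trans (dist_compl_le a H0) _; rewrite subr0.
  have -> // : enorm a = 1.
  apply/eqP; rewrite -(@eqrXn2 _ 2) ?enorm_ge0//.
  by rewrite -dotvv dotv_delta mxE !eqxx expr1n.
apply: le_trans (lambda_le n0 np wtL _ Ha _ da0) _.
- move=> y; rewrite (@half_spaceE R n l ln) /= => /negP; rewrite -leNgt => yl.
  apply: w0; rewrite scale1r dotvDl dotvNl dotvv nu1 expr1n.
  by rewrite -{1}aQ dotv_mulmx// dotv_delta gerDr.
- by rewrite scale1r aQ subrr.
rewrite lee_fin ler_piMl//.
apply: (@le_trans _ _ (1 `^ (p - n%:R))); last by rewrite powR1.
by apply: ge0_ler_powR; rewrite ?nnegrE ?(ltW pn)// ltW.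
Qed.

Lemma boundary_concentration (L : R) (x0 : 'rV[R]_n) (x_ : nat -> 'rV[R]_n)
    (u_ : nat -> 'rV[R]_n -> R) :
  open Omega -> C1_domain Omega ->
  (forall k, [/\ Omega (x_ k), u_ k (x_ k) = 1,
    forall y, ~ Omega y -> u_ k y = 0,
    sobolev_le p ((L + 2^-1 ^+ k) / d (x_ k) `^ (p - n%:R)) (u_ k) &
    enorm (x_ k - x0) <= 2^-1 ^+ k]) ->
  ~ Omega x0 -> (lambda p (half_space R n) <= L%:E)%E.
Proof.
move=> oO CO xu Ox0.
have p1 : 1 <= p by apply: le_trans p2; rewrite ler1n.
have half_small (e : R) : 0 < e -> \forall k \near \oo, 2^-1 ^+ k < e :> R.
  move=> e0; have /cvgrPdist_lt/(_ e e0) := @cvg_expr_half R.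
  by apply: filterS => k; rewrite sub0r normrN => /(le_lt_trans (ler_norm _)).
have bO : boundary Omega x0.
  split; last by move=> /interior_subset.
  move=> B /nbhs_ballP[e /= e0 eB]; have [N _ HN] := half_small e e0.
  have [OxN _ _ _ xN] := xu N; exists (x_ N); split => //; apply: eB.
  rewrite -ball_normE /ball_/= distrC; apply: le_lt_trans (norm_le_enorm _) _.
  exact: le_lt_trans xN (HN N (leqnn N)).
have dp k : 0 < d (x_ k).
  by have [Oxk _ _ _ _] := xu k; apply: dist_compl_gt0 => //; exists x0.
have [nu nu1 nuP] := C1_domain_blowup CO bO Ox0.
pose K_ (j : nat) : set ('rV[R]_n -> R) := [set v | v 0 = 1 /\
  forall eta, enorm eta <= j%:R -> dotv eta nu <= - (1 + j.+1%:R^-1) -> v eta = 0].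
have Kdec i j : (i <= j)%N -> K_ j `<=` K_ i.
  move=> ij v [v1 v0]; split => // eta ei enu; apply: v0.
    by apply: le_trans ei _; rewrite ler_nat.
  by apply: le_trans enu _; rewrite lerN2 lerD2l lef_pV2 ?posrE// ler_nat ltnS.
have [||||v_ [w [Kv we vw]]] := @sobolev_minimize R n p n0 np p2 K_ 0 1 L.
- exact: Kdec.
- move=> j u v [u1 u0] [v1 v0]; split; first by rewrite u1 v1; field.
  by move=> eta e1 e2; rewrite u0// v0// !mulr0 addr0.
- by move=> j u [].
- move=> j t t0; have [|rho rho0 rhoP] := nuP j.+1%:R^-1 j%:R; first by rewrite invr_gt0.
  have [N1 _ HN1] := half_small rho rho0; have [N2 _ HN2] := half_small t t0.
  pose k := maxn N1 N2.
  have kr := HN1 k (leq_maxl _ _); have kt := HN2 k (leq_maxr _ _).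
  have [Oxk uk u0 us xk] := xu k.
  exists (fun eta => u_ k (d (x_ k) *: eta + x_ k)).
    split; first by rewrite scaler0 add0r.
    move=> eta ej enu; apply: u0; rewrite addrC.
    by apply: rhoP => //; exact: le_lt_trans xk kr.
  apply: le_sobolev_le (sobolev_le_scale (x_ k) p1 (dp k) us).
  (* The scaling factor of the energy cancels the weight exactly, leaving [L + 2^-k]. *)
  rewrite mulrC divfK ?gt_eqF ?powR_gt0//.
  by rewrite lerD2l ltW.
have w1 : w 0 = 1.
  have H : v_ k 0 @[k --> \oo] --> (1 : R).
    rewrite (_ : (fun _ => _) = cst 1); first exact: cvg_cst.
    by apply/funext => k; have [] := Kv k.
  exact: (@cvg_unique _ (@norm_hausdorff _ _) _ _ _ _ (vw 0) H).
(* For a strict inequality, [eta] falls under the [k]-th constraint once [k >= |eta|] and [1/(k+1)]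
   is at most the gap [t]. *)
have wneg eta : dotv eta nu < -1 -> w eta = 0.
  move=> enu; pose t := - 1 - dotv eta nu.
  have t0 : 0 < t by rewrite subr_gt0.
  pose N := maxn (Num.truncn (enorm eta)).+1 (Num.truncn t^-1).+1.
  have H : v_ k eta @[k --> \oo] --> (0 : R).
    apply: cvg_near_cst; exists N => // k /= Nk.
    have [_] := Kv k; apply.
      apply: ltW; apply: lt_le_trans (truncnS_gt _) _.
      by rewrite ler_nat (leq_trans (leq_maxl _ _) Nk).
    suff : k.+1%:R^-1 <= t 
      by rewrite /t; move: (dotv eta nu) k.+1%:R^-1 => a b; lra.
    rewrite -[leRHS]invrK lef_pV2 ?posrE ?invr_gt0//.
    apply: ltW; apply: lt_le_trans (truncnS_gt _) _.
    by rewrite ler_nat (leq_trans (leq_maxr _ _) (leqW Nk)).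
  exact: (@cvg_unique _ (@norm_hausdorff _ _) _ _ _ _ (vw eta) H).
apply: (lambda_half_space_le nu1 we w1) => eta enu.
have [cw _] := we.
apply/eqP; apply: contrapT => /negP w0.
have /continuous_rVP/(_ eta `|w eta|) := cw.
rewrite normr_gt0 => /(_ w0)[r r0 rP].
(* On the bounding hyperplane the strict case is reached by dilating: [(1 + t) eta] lies strictly
   beyond it and within the radius of continuity [r]. *)
pose t := r / (`|eta| + 1).
have E1 : 0 < `|eta| + 1 by rewrite ltr_wpDl.
have t0 : 0 < t by rewrite divr_gt0.
have : `|eta - (1 + t) *: eta| < r.
  rewrite scalerDl scale1r opprD addrA subrr sub0r normrN normrZ gtr0_norm//.
  by rewrite /t mulrAC ltr_pdivrMr// ltr_pM2l// ltrDl ltr01.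
move=> /rP; rewrite [w (_ *: _)]wneg ?subr0 ?ltxx//.
by rewrite dotvZl; nra.
Qed.

End boundary_concentration.

Theorem theoremC (R : realType) (n : nat) (hn : (2 <= n)%N)
    (p : R) (hp : n%:R < p) (Omega : set 'rV[R]_n)
    (Omega_neq0 : Omega !=set0) (Omega_bounded : bounded_set Omega)
    (Omega_open : open Omega) (Omega_C1 : C1_domain Omega)
    (hlambda : (lambda p Omega < lambda p (half_space R n))%E) :
  exists u : 'rV[R]_n -> R, extremal p Omega u.
Proof.
have n0 : (0 < n)%N by exact: leq_trans hn.
have p2 : 2 <= p by apply: le_trans (ltW hp); rewrite ler_nat.
have cO : ~` Omega !=set0.
  have /bounded_setP[B OB] := Omega_bounded.
  (* A point of the complement, found outside a ball that contains [Omega]. *)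
  exists (const_mx (`|B| + 1)) => /OB BB.
  have := le_trans (norm_coord_le _ (Ordinal n0)) BB; rewrite mxE.
  have := ler_norm B; have := normr_ge0 B; move: `|B| => b b0 Bb.
  by rewrite ger0_norm ?addr_ge0//; lra.
have lfin : lambda p Omega \is a fin_num.
  rewrite ge0_fin_numE ?lambda_ge0//.
  (* Finiteness comes from the strict inequality assumed between the two constants. *)
  by apply: lt_le_trans hlambda _; rewrite leey.
have lL : lambda p Omega = (fine (lambda p Omega))%:E by rewrite fineK.
have [x0 [x_ [u_ xu]]] := minimizing_sequence n0 hp Omega_open Omega_bounded cO lL.
have [Ox0|Ox0] := pselect (Omega x0).
  exact: (interior_extremal n0 hp p2 Omega_open cO lL xu Ox0).
have := boundary_concentration n0 hp p2 Omega_open Omega_C1 xu Ox0.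
by rewrite -lL leNgt hlambda.
Qed.
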